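(* There exists a smooth origin-symmetric convex body of revolution $K\subset\mathbb{R}^4$ such that $K\in\mathcal{P}^4_s(2)$ but $K\notin\mathcal{K}^4_s(2)$.
   Context: $K$ is the $j$-projection body of $L$ (origin-symmetric convex bodies with non-empty interior) if $\mathrm{vol}_j(K|E^\perp)=\mathrm{vol}_{n-j}(L|E)$ for every $(n-j)$-dimensional linear subspace $E$ ($K|E$ orthogonal projection). $\mathcal{P}^n_s(j)$ is the closure in the Hausdorff metric of the set of all $j$-projection bodies of such $L$. $\mathcal{K}^n_s(j)$ is the class of origin-symmetric convex bodies $K$ for which there is a non-negative Borel measure $\varrho$ on the Grassmannian $\mathrm{Gr}_{j,n}$ with $\mathrm{vol}_j(K|F)=\int_{\mathrm{Gr}_{j,n}}|\cos(E,F)|\,d\varrho(E)$ for all $F\in\mathrm{Gr}_{j,n}$, where $|\cos(E,F)|$ is the factor by which orthogonal projection from $E$ onto $F$ scales $j$-dimensional volume. *)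

(* Defs.v *)
(* R^4 is modelled as row vectors 'rV[R]_4
   over an arbitrary realType R (with the product topology, which is the
   Euclidean topology). Everything is specialised to n = 4, j = 2. *)
From mathcomp Require Import all_boot all_order all_algebra.
From mathcomp Require Import all_classical all_reals all_analysis.
Import Order.TTheory GRing.Theory Num.Theory numFieldNormedType.Exports.

Set Implicit Arguments.
Unset Strict Implicit.
Unset Printing Implicit Defensive.

Local Open Scope ring_scope.
Local Open Scope classical_set_scope.

Section ConvexGeometry.
Variable R : realType.

Notation vec := 'rV[R]_4.

Definition dotp (x y : vec) : R := (x *m y^T) 0 0.
Definition enorm (x : vec) : R := Num.sqrt (dotp x x).

Definition convex_set (K : set vec) : Prop :=
  forall x y (t : R), K x -> K y -> 0 <= t <= 1 -> K (t *: x + (1 - t) *: y).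

Definition origin_symmetric (K : set vec) : Prop := forall x, K x -> K (- x).

Definition osym_body (K : set vec) : Prop :=
  [/\ compact K, convex_set K, K° !=set0 & origin_symmetric K].

(* Grassmannian Gr_{2,4}: a 2-dimensional linear subspace E of R^4 is represented
   by its orthogonal projection matrix P (symmetric, idempotent, of rank 2);
   E is the row space of P, and E^perp corresponds to 1 - P.  Gr_{2,4} carries
   the topology induced from the space of 4x4 matrices. *)
Definition Gr24 : set 'M[R]_4 :=
  [set P | P^T = P /\ P *m P = P /\ \rank P = 2%N].

(* a chosen orthonormal basis (the two rows of U) of the subspace with
   projection matrix P:  U U^T = 1 and U^T U = P *)
Definition onb (P : 'M[R]_4) : 'M[R]_(2, 4) :=
  xget 0 [set U : 'M[R]_(2, 4) | U *m U^T = 1%:M /\ U^T *m U = P].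

Definition coords (P : 'M[R]_4) (x : vec) : R * R :=
  let c := x *m (onb P)^T in (c 0 0, c 0 1).

Definition lebesgue2 : set (R * R) -> \bar R :=
  (@lebesgue_measure R \x @lebesgue_measure R)%E.

(* vol_2 (A | E): 2-dimensional volume of the orthogonal projection of A onto
   the subspace E (given by its projection matrix P), computed in orthonormal
   coordinates of E.  (The coordinates of x and of its projection coincide.) *)
Definition vol2proj (P : 'M[R]_4) (A : set vec) : \bar R :=
  lebesgue2 (coords P @` A).

(* |cos(E,F)|: factor by which orthogonal projection E -> F scales 2-dim volume,
   i.e. |det| of the matrix of this linear map in orthonormal bases of E and F. *)
Definition abscos (PE PF : 'M[R]_4) : R :=
  `| \det (onb PF *m (onb PE)^T) |.

Definition proj_body2 (K L : set vec) : Prop :=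
  osym_body K /\ osym_body L /\
  forall E, Gr24 E -> vol2proj (1%:M - E) K = vol2proj E L.

Definition hausdorff_le (K K' : set vec) (e : R) : Prop :=
  (forall x, K x -> exists2 y, K' y & enorm (x - y) <= e) /\
  (forall y, K' y -> exists2 x, K x & enorm (x - y) <= e).

Definition in_P4s2 (K : set vec) : Prop :=
  forall e : R, 0 < e -> exists K' L, proj_body2 K' L /\ hausdorff_le K K' e.

(* Borel sets of the matrix space; a Borel measure on Gr_{2,4} is a Borel
   measure on 4x4 matrices integrated over the closed set Gr24. *)
Definition MatBorel := g_sigma_algebraType [set U : set 'M[R]_4 | open U].

Definition in_K4s2 (K : set vec) : Prop :=
  osym_body K /\
  exists rho : {measure set MatBorel -> \bar R},
    forall F, Gr24 F ->
      vol2proj F K = (\int[rho]_(E in (Gr24 : set MatBorel)) (abscos E F)%:E)%E.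

(* Smoothness: the Minkowski functional (gauge) of K is C^infinity on R^4 \ {0},
   i.e. all iterated directional derivatives exist and are (Frechet)
   differentiable away from the origin. *)
Definition gauge (K : set vec) (x : vec) : R :=
  inf [set t : R | 0 < t /\ exists2 y, K y & x = t *: y].

Definition iter_dir_deriv (vs : seq vec) (f : vec -> R) : vec -> R :=
  foldr (fun v g => fun x => 'D_v g x) f vs.

Definition smooth_body (K : set vec) : Prop :=
  forall (vs : seq vec) (x : vec), x != 0 ->
    differentiable (iter_dir_deriv vs (gauge K)) x.

Definition body_of_revolution (K : set vec) : Prop :=
  exists2 u : vec, u != 0 &
    forall Q : 'M[R]_4, Q *m Q^T = 1%:M -> \det Q = 1 -> u *m Q = u ->
      (fun x => x *m Q) @` K = K.

End ConvexGeometry.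

(* Main.v *)
(* [K] is the body [|y|^2 <= R(z)] with axis [z], where [R] is chosen so that the area of the
   projection of [K] onto a plane [F] is a constant times [31 + 14 t - 14 t^2], [t] being the
   squared cosine of the angle between [F] and the axis. As [t] becomes [1 - t] on the orthogonal
   complement, [K] is its own 2-projection body.

   Unit self-dual and anti-self-dual bivectors identify Gr(2,4) with pairs [(x, y)] of points of
   S^2 up to a common sign; then [|cos(E,F)| = |x.x' + y.y'| / 2] and [t = (1 + x'.y') / 2].
   Averaging a function [f(x'.y')] against [|cos(E,F)|] acts on Legendre polynomials in [x.y] by
   non-zero multipliers in even degrees (Funk-Hecke), and there is an [f] whose average is the square
   of a polynomial while its average against the projection areas of [K] is negative. By Tonelli
   no non-negative measure represents the areas. *)
Require Import Defs.
From HB Require Import structures.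
From mathcomp Require Import all_boot all_order all_algebra.
From mathcomp Require Import all_classical all_reals all_analysis.
From mathcomp Require Import measurable_realfun ring lra zify.
Import Order.TTheory GRing.Theory Num.Theory numFieldNormedType.Exports.

Set Implicit Arguments.
Unset Strict Implicit.
Unset Printing Implicit Defensive.

Local Open Scope ring_scope.
Local Open Scope classical_set_scope.

(** * Calculus on the line *)

(** Put [u = x'.y'], let P2 be the Legendre polynomial of degree 2, and let [A] stand for the
    constant 31. The areas are proportional to [A + 7/3 - 7/3 P2(u)]. The average against
    [|cos(E,F)|] has multipliers 1/3 and -1/105 in degrees 0 and 2, so the formal density of the
    areas is [3 A + 7 + 245 P2(u)]; the negative multiplier is why the areas must be smallest where
    [u^2] is largest. Two demands compete: the profile needs [npol > 0], that is [A > 91/3], while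
    the density is negative at [u = 0] only for [A < 77/2]. The value 31 lies in between. For
    [A = 31] the density is [(735 u^2 - 45) / 2], negative for [u^2 < 3/49]. A test function must
    therefore concentrate near [u = 0], and the square of [u^4 - 4/3 u^2 + 2/5] does: it is 4/25 at
    0 and only 1/225 at 1. The density itself never occurs in the proof. Pairing the areas with a
    weight whose transform is this square covers arbitrary measures, with no inversion or uniqueness
    theorem for the transform. *)

Section Antiderivative.
Context {R : realType}.
Notation mu := (@lebesgue_measure R).

Lemma continuous_integrable_itv (f : R -> R) (a b : R) : continuous f ->
  mu.-integrable `[a, b] (EFin \o f).
Proof.
move=> cf; apply: (@continuous_compact_integrable R f); first exact: segment_compact.
exact: continuous_subspaceT.
Qed.

Lemma derivable_continuous (f : R -> R) : (forall x, derivable f x 1) -> continuous f.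
Proof. by move=> df x; apply/differentiable_continuous/derivable1_diffP/df. Qed.

Lemma is_derive1_continuous (f g : R -> R) :
  (forall x, is_derive x (1 : R) f (g x)) -> continuous f.
Proof. by move=> df; apply: derivable_continuous => x; apply: (@ex_derive _ _ _ _ _ _ _ (df x)). Qed.

Lemma is_derive_pow (f : R -> R) n (x df : R) : is_derive x (1 : R) f df ->
  is_derive x (1 : R) (fun y => f y ^+ n) (n%:R * f x ^+ n.-1 * df).
Proof.
move=> fx; have -> : (fun y => f y ^+ n) = f ^+ n.
  apply/funext => y; elim: n => [|n IH]; first by rewrite !expr0.
  by rewrite !exprS IH.
exact: is_deriveX.
Qed.

Lemma ge_derive_ge (f g : R -> R) (a b : R) : a <= b ->
  (forall x, is_derive x (1 : R) f (g x)) ->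
  (forall x, a < x < b -> 0 <= g x) -> f a <= f b.
Proof.
move=> ab df g0.
have cf : {within `[a, b], continuous f}.
  exact/continuous_subspaceT/(is_derive1_continuous df).
move: ab; rewrite le_eqVlt => /predU1P[->//|ab].
have [c cab fE] := @MVT _ f g a b ab (fun x _ => df x) cf.
by rewrite -subr_ge0 fE mulr_ge0 ?subr_ge0 ?g0// ?ltW//; move: cab; rewrite in_itv.
Qed.

Lemma gt_derive_gt (f g : R -> R) (a b : R) : a < b ->
  (forall x, is_derive x (1 : R) f (g x)) ->
  (forall x, 0 < g x) -> f a < f b.
Proof.
move=> ab df g0.
have cf : {within `[a, b], continuous f}.
  exact/continuous_subspaceT/(is_derive1_continuous df).
have [c cab fE] := @MVT _ f g a b ab (fun x _ => df x) cf.
by rewrite -subr_gt0 fE mulr_gt0 ?subr_gt0.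
Qed.

(** As [f r - c r] is monotone, [f] has passed [y] at distance [|y - f 0| / c] from 0 on one side
    and not yet reached it on the other. The result lives in [Type] because the inverses enter
    definitions. *)
Lemma derive_ge_bijective (f df : R -> R) (c : R) : 0 < c ->
  (forall x, is_derive x (1 : R) f (df x)) -> (forall x, c <= df x) ->
  {g : R -> R | cancel f g & cancel g f}.
Proof.
move=> c0 fE dfc.
have df0 x : 0 < df x by rewrite (lt_le_trans c0).
have cf := is_derive1_continuous fE.
have dl r : is_derive r (1 : R) (fun r => f r - c * r) (df r - c).
  have := fE r => ?; apply: is_derive_eq.
  by rewrite /GRing.scale/= mulr1.
have mono x y : x <= y -> f x - c * x <= f y - c * y.
  by move=> xy; apply: (ge_derive_ge xy dl) => u _; rewrite subr_ge0.
have surj y : {x | f x = y}.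
  apply: cid; pose u := `|y - f 0| / c.
  have cu : c * u = `|y - f 0| by rewrite /u mulrC divfK// gt_eqF.
  have u0 : 0 <= u by rewrite divr_ge0// ltW.
  have m1 := mono 0 u u0; have m2 := mono (- u) 0 ltac:(by rewrite oppr_le0).
  rewrite mulr0 subr0 cu in m1; rewrite mulr0 subr0 mulrN cu opprK in m2.
  have b1 : y <= f u by have := ler_norm (y - f 0); lra.
  have b2 : f (- u) <= y by have := ler_norm (- (y - f 0)); rewrite normrN; lra.
  have [|||x _ xE] := @IVT _ f (- u) u y; last by exists x.
  - lra.
  - exact: continuous_subspaceT.
  - by rewrite min_l ?max_r ?b1 ?b2//; lra.
have inj : injective f.
  move=> x y xy; apply/eqP; have [h|h|//] := ltgtP x y.
    by have := gt_derive_gt h fE df0; rewrite xy ltxx.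
  by have := gt_derive_gt h fE df0; rewrite xy ltxx.
exists (fun y => sval (surj y)) => x; last exact: svalP (surj x).
by apply: inj; rewrite (svalP (surj (f x))).
Qed.

Lemma Rintegral_itv_split (f : R -> R) (u c v : R) : continuous f -> u <= c -> c <= v ->
  (\int[mu]_(t in `[u, v]) f t)%R =
  (\int[mu]_(t in `[u, c]) f t)%R + (\int[mu]_(t in `[c, v]) f t)%R.
Proof.
move=> cf uc cv.
have -> : (\int[mu]_(t in `[c, v]) f t)%R = (\int[mu]_(t in `]c, v]) f t)%R.
  rewrite [RHS]Rintegral_itv_obnd_cbnd//.
  apply: integrableS (continuous_integrable_itv c v cf) => //.
  by apply: subset_itv; rewrite bnd_simp.
rewrite -(@Rintegral_itvB _ f (BLeft u) (BRight v) c); last 3 first.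
- exact: continuous_integrable_itv.
- by rewrite bnd_simp.
- by rewrite bnd_simp.
by rewrite addrC subrK.
Qed.

Lemma continuous_antiderivative (f : R -> R) : continuous f ->
  {F : R -> R | F 0 = 0 & forall x, is_derive x (1 : R) F (f x)}.
Proof.
move=> cf.
(* The integral starts at [- A], to the left of both [x] and 0, and is then normalised at 0; by [FE]
   every large enough [A] gives the same [F]. *)
pose G A x := (\int[mu]_(t in `[- A, x]) f t)%R.
pose F x := G (`|x| + 1) x - G (`|x| + 1) 0.
have FE A x : `|x| + 1 <= A -> F x = G A x - G A 0.
  move=> xA.
  have := ler_norm x; have := lerNnormlW (lexx `|x|) => h1 h2.
  rewrite /F /G.
  have h4 : - (`|x| + 1) <= x by lra.
  have h5 : 0 <= `|x| by [].
  rewrite (@Rintegral_itv_split f (- A) (- (`|x| + 1)) x cf); try lra.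
  rewrite (@Rintegral_itv_split f (- A) (- (`|x| + 1)) 0 cf); try lra.
exists F => [|x]; first by rewrite /F subrr.
pose A := `|x| + 2.
have xA : - A < x by rewrite /A; have := lerNnormlW (lexx `|x|); lra.
have [dG GE] : derivable (G A) x 1 /\ (G A)^`() x = f x.
  apply: (@continuous_FTC1_closed R f (- A) x (x + 1)) => //; first by lra.
    exact: continuous_integrable_itv.
  exact: cf.
have dH : is_derive x (1 : R) (fun y => G A y - G A 0) (f x).
  have dG' : is_derive x (1:R) (G A) (f x) by apply: DeriveDef; [exact: dG | rewrite -derive1E; exact: GE].
  by rewrite -[f x]subr0; apply: is_deriveB.
apply: (@near_eq_is_derive _ _ _ (fun y => G A y - G A 0) F x 1 (f x)) => //.
near=> y; rewrite (FE A)//.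
have : `|y - x| < 1 by near: y; apply: cvgr_distC_lt => //; exact: cvg_id.
have : `|y| <= `|x| + `|y - x| by rewrite (le_trans _ (ler_normD _ _))// addrC subrK.
by rewrite /A; lra.
Unshelve. all: by end_near.
Qed.

End Antiderivative.

(** * The profile of the body *)

Section Profile.
Context {R : realType}.
Implicit Types s z : R.

(* [wpol] solves [int_{-1}^1 sqrt(1-p^2) (w - t (1-p^2) w')(t p^2) dp = (31 + 14 t - 14 t^2) I0]
   (see [subgraph_area]), and [npol = w - (1-x) w']. The profile is parametrised by
   [z = zf s], [R = (1 - s^2) w(s^2)], which makes [R' = -2 s sqrt(w(s^2))] explicit. *)
Definition wpol (x : R) : R := 31 - 28 * x + 112 * x ^+ 2.
Definition npol (x : R) : R := 59 - 280 * x + 336 * x ^+ 2.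
Definition qf s : R := Num.sqrt (wpol (s ^+ 2)).

Lemma wpol_gt0 x : 0 < wpol x.
Proof. by rewrite /wpol; have := sqr_ge0 (x - 1/8); nra. Qed.

(** The minimum, at 5/12, is only 2/3: with 30 in place of 31 in [wpol], the value there would be
    negative. *)
Lemma npol_gt0 x : 0 < npol x.
Proof. by rewrite /npol; have := sqr_ge0 (x - 5/12); nra. Qed.

Lemma wxpol_gt0 (x : R) : 0 < 31 - 56 * x + 336 * x ^+ 2.
Proof. by have := sqr_ge0 (x - 1/12); nra. Qed.

Lemma qf_gt0 s : 0 < qf s. Proof. by rewrite sqrtr_gt0 wpol_gt0. Qed.
Lemma qf_neq0 s : qf s != 0. Proof. by rewrite gt_eqF// qf_gt0. Qed.
Lemma qf_sqr s : qf s ^+ 2 = wpol (s ^+ 2).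
Proof. by rewrite sqr_sqrtr// ltW// wpol_gt0. Qed.

Lemma qfN s : qf (- s) = qf s. Proof. by rewrite /qf sqrrN. Qed.

Lemma is_derive_qf s :
  is_derive s (1 : R) qf (s * (- 28 + 224 * s ^+ 2) / qf s).
Proof.
have dw : is_derive s (1 : R) (fun s => wpol (s ^+ 2)) (2 * s * (- 28 + 224 * s ^+ 2)).
  rewrite /wpol; apply: is_derive_eq.
  by rewrite /GRing.scale/=; ring.
have dq := @is_derive1_comp _ Num.sqrt (fun s => wpol (s ^+ 2)) s _ _ (is_derive1_sqrt (wpol_gt0 (s ^+ 2))) dw.
apply: (is_derive_eq dq); rewrite -/(qf s).
by have := qf_neq0 s => ?; field.
Qed.

Lemma continuous_qf : continuous qf.
Proof. exact: is_derive1_continuous is_derive_qf. Qed.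

Lemma continuous_npol2 : continuous (fun s : R => npol (s ^+ 2)).
Proof.
apply: derivable_continuous => s; rewrite /npol; apply: ex_derive.
Qed.

(** The function [(1 - s^2) w(s^2)] has derivative [-2 s npol(s^2)] in [s], so this is the speed
    [dz/ds] that yields [R' = -2 s qf(s)]. *)
Definition dzf s : R := npol (s ^+ 2) / qf s.

Lemma dzf_gt0 s : 0 < dzf s.
Proof. by rewrite divr_gt0 ?npol_gt0 ?qf_gt0. Qed.

Lemma continuous_dzf : continuous dzf.
Proof.
move=> s; apply: cvgM; first exact: continuous_npol2.
by apply: cvgV; [exact: qf_neq0 | exact: continuous_qf].
Qed.

Definition zf : R -> R := s2val (continuous_antiderivative continuous_dzf).

Lemma zf0 : zf 0 = 0.
Proof. exact: (s2valP (continuous_antiderivative continuous_dzf)). Qed.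

Lemma is_derive_zf s : is_derive s (1 : R) zf (dzf s).
Proof. exact: (s2valP' (continuous_antiderivative continuous_dzf)). Qed.

Lemma continuous_zf : continuous zf.
Proof. exact: is_derive1_continuous is_derive_zf. Qed.

Lemma zf_lt s s' : s < s' -> zf s < zf s'.
Proof. by move=> ss; apply: (gt_derive_gt ss is_derive_zf dzf_gt0). Qed.

Lemma zfN s : zf (- s) = - zf s.
Proof.
apply/eqP; rewrite -subr_eq0 opprK; apply/eqP.
have d r : is_derive r (1 : R) (fun r => zf (- r) + zf r) 0.
  have dN : is_derive r (1 : R) (zf \o -%R) (dzf (- r) * -1).
    by apply: is_derive1_comp; exact: is_derive_zf.
  have dz := is_derive_zf r.
  apply: (is_derive_eq (is_deriveD dN dz)).
  by rewrite /dzf qfN sqrrN; ring.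
by rewrite (is_derive_0_is_cst s 0 d) oppr0 zf0 addr0.
Qed.

Lemma dzf_lb s : 1 / 100 <= dzf s.
Proof.
rewrite /dzf ler_pdivlMr ?qf_gt0//.
(* The bound [2 q <= q^2 + 1] trades the square root for a polynomial. *)
have h := sqr_ge0 (qf s - 1); have hw := qf_sqr s.
have h2 : 2 * qf s <= wpol (s ^+ 2) + 1 by rewrite -hw; lra.
have : wpol (s ^+ 2) + 1 <= 200 * npol (s ^+ 2).
  by rewrite /wpol /npol; have := sqr_ge0 (s ^+ 2 - 5 / 12); nra.
by lra.
Qed.

Let hundredth_gt0 : 0 < 1 / 100 :> R. Proof. by lra. Qed.

Definition sf : R -> R := s2val (derive_ge_bijective hundredth_gt0 is_derive_zf dzf_lb).

Lemma sfK : cancel zf sf. Proof. exact: (s2valP (derive_ge_bijective _ _ _)). Qed.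

Lemma zfK : cancel sf zf. Proof. exact: (s2valP' (derive_ge_bijective _ _ _)). Qed.

Lemma zf_inj : injective zf. Proof. exact: can_inj sfK. Qed.

Lemma sf0 : sf 0 = 0. Proof. by rewrite -[in LHS]zf0 sfK. Qed.

Lemma sfN z : sf (- z) = - sf z.
Proof. by apply: zf_inj; rewrite zfN !zfK. Qed.

Lemma zf_mono : {mono zf : s t / s <= t}.
Proof. by apply: le_mono; exact: zf_lt. Qed.

Lemma is_derive_sf z : is_derive z (1 : R) sf (qf (sf z) / npol (sf z ^+ 2)).
Proof.
rewrite -[X in is_derive X]zfK.
have -> : qf (sf z) / npol (sf z ^+ 2) = (dzf (sf z))^-1 by rewrite /dzf invf_div.
apply: (@is_derive_inverse _ zf sf).
- by near=> s; exact: sfK.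
- by near=> s; exact: continuous_zf.
- exact: is_derive_zf.
- by rewrite gt_eqF// dzf_gt0.
Unshelve. all: by end_near.
Qed.

Definition mf z : R := sf z * qf (sf z).
(** It is defined and concave on the whole line, and negative beyond the poles [zf 1] and [- zf 1],
    where its derivative does not vanish. The body is thus a sublevel set of a function that is
    convex on the whole space, and the poles need no separate treatment. *)
Definition Rf z : R := (1 - sf z ^+ 2) * wpol (sf z ^+ 2).

Lemma RfN z : Rf (- z) = Rf z. Proof. by rewrite /Rf sfN sqrrN. Qed.

Lemma mfN z : mf (- z) = - mf z. Proof. by rewrite /mf sfN qfN mulNr. Qed.

Lemma Rf0 : Rf 0 = 31. Proof. by rewrite /Rf /wpol sf0; ring. Qed.

Lemma is_derive_qsf z : is_derive z (1 : R) (qf \o sf)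
  (sf z * (- 28 + 224 * sf z ^+ 2) / npol (sf z ^+ 2)).
Proof.
have d1 := is_derive_qf (sf z); have d2 := is_derive_sf z.
apply: is_derive_eq.
have h1 := qf_neq0 (sf z); have h2 : npol (sf z ^+ 2) != 0 by rewrite gt_eqF ?npol_gt0.
by field; rewrite h1 h2.
Qed.

(** The numerator is [w + x w'] at [x = s^2]; its positivity makes [mf] increasing, hence [Rf]
    concave. *)
Lemma is_derive_mf z : is_derive z (1 : R) mf
  ((31 - 56 * sf z ^+ 2 + 336 * (sf z ^+ 2) ^+ 2) / npol (sf z ^+ 2)).
Proof.
have d1 := is_derive_qsf z; have d2 := is_derive_sf z.
have -> : mf = sf * (qf \o sf) by apply/funext.
apply: is_derive_eq; rewrite /GRing.scale/=.
have h2 : npol (sf z ^+ 2) != 0 by rewrite gt_eqF ?npol_gt0.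
have hq := qf_sqr (sf z); rewrite /wpol in hq.
apply: (mulIf h2); rewrite mulfVK//.
have -> : (sf z * (sf z * (-28 + 224 * sf z ^+ 2) / npol (sf z ^+ 2)) +
  qf (sf z) * (qf (sf z) / npol (sf z ^+ 2))) * npol (sf z ^+ 2) =
  sf z ^+ 2 * (-28 + 224 * sf z ^+ 2) + qf (sf z) ^+ 2 by field.
by rewrite hq; ring.
Qed.

Lemma is_derive_Rf z : is_derive z (1 : R) Rf (- 2 * mf z).
Proof.
have d2 := is_derive_sf z.
have dw : is_derive (sf z) (1 : R) (fun s => (1 - s ^+ 2) * wpol (s ^+ 2))
    (- 2 * sf z * npol (sf z ^+ 2)).
  rewrite /wpol; apply: is_derive_eq.
  by rewrite /npol /GRing.scale/=; ring.
apply: (is_derive_eq (@is_derive1_comp _ (fun s => (1 - s ^+ 2) * wpol (s ^+ 2)) sf z _ _ dw d2)).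
have h2 : npol (sf z ^+ 2) != 0 by rewrite gt_eqF ?npol_gt0.
by rewrite /mf; field.
Qed.

Lemma continuous_Rf : continuous Rf.
Proof. exact: is_derive1_continuous is_derive_Rf. Qed.

Lemma mf_mono : {mono mf : s t / s <= t}.
Proof.
apply: le_mono => s t st; apply: (gt_derive_gt st is_derive_mf) => x.
by rewrite divr_gt0 ?wxpol_gt0 ?npol_gt0.
Qed.

(** The gap between the two sides has derivative [2 (mf r - mf z)], of the sign of [r - z].
    Convexity of the body, the gradient of its gauge and its projections all rest on this
    first-order form of concavity. *)
Lemma Rf_tangent z z' : Rf z' <= Rf z - 2 * mf z * (z' - z).
Proof.
have d (a r : R) : is_derive r (1 : R) (fun r => Rf z - 2 * mf z * (r - z) - Rf r) (2 * (mf r - mf z)).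
  have dR := is_derive_Rf r; apply: is_derive_eq.
  by rewrite /GRing.scale/=; ring.
have [h|h] := leP z z'.
  have := ge_derive_ge h (d 0); rewrite /= subrr mulr0 subr0 subrr subr_ge0.
  apply => x /andP[zx _]; rewrite mulr_ge0// subr_ge0 mf_mono ltW//.
have d' (r : R) : is_derive r (1 : R) (fun r => - (Rf z - 2 * mf z * (r - z) - Rf r)) (- (2 * (mf r - mf z))).
  by have := d 0 r => ?; apply: is_derive_eq.
have := ge_derive_ge (ltW h) d'; rewrite /= subrr mulr0 subr0 subrr oppr0 oppr_le0 subr_ge0.
apply => x /andP[_ zx]; rewrite oppr_ge0 mulr_ge0_le0// subr_le0 mf_mono ltW//.
Qed.

Lemma mf_ge0 z : 0 <= mf z * z.
Proof.
have mf0 : mf 0 = 0 by rewrite /mf sf0 mul0r.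
have [h|h] := leP 0 z; first by rewrite mulr_ge0// -mf0 mf_mono.
by rewrite mulr_le0 ?(ltW h)// -mf0 mf_mono ltW.
Qed.

Lemma mf_gt0 z : z != 0 -> 0 < mf z * z.
Proof.
move=> z0; rewrite lt_def mf_ge0 andbT mulf_neq0// /mf mulf_neq0 ?qf_neq0//.
by apply: contra z0 => /eqP h; rewrite -(zfK z) h zf0.
Qed.

Lemma Rf_le z : Rf z <= 31.
Proof.
have := Rf_tangent 0 z; rewrite Rf0 /mf sf0 mul0r mulr0 mul0r subr0; exact.
Qed.

Lemma Rf_ge0 z : (0 <= Rf z) = (sf z ^+ 2 <= 1).
Proof. by rewrite /Rf pmulr_lge0 ?wpol_gt0// subr_ge0. Qed.

Lemma Rf_ge0_le z : 0 <= Rf z -> `|z| <= zf 1.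
Proof.
rewrite Rf_ge0 -[X in `|X|](zfK z) => h.
have : `|sf z| <= 1 by rewrite -(@ler_pXn2r _ 2)// ?nnegrE// real_normK ?num_real// expr1n.
by rewrite !ler_norml -zfN !zf_mono.
Qed.

End Profile.

(** * Differentiability from a first-order estimate *)

Lemma differentiable_linear_approx (K : numFieldType) (V W : normedModType K)
    (f : V -> W) (L : {linear V -> W}) (x : V) : continuous L ->
  (forall e : K, 0 < e -> \forall h \near (0 : V),
     `|f (h + x) - f x - L h| <= e * `|h|) ->
  differentiable f x /\ 'd f x = L :> (V -> W).
Proof.
move=> Lc fx.
have E : f \o shift x = cst (f x) + L +o_ 0 id.
  apply/eqaddoP => e e0; have := fx e e0; apply: filterS => h.
  by rewrite -[((f \o shift x - (cst (f x) + L)) h)]/(f (h + x) - (f x + L h)) opprD addrA.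
have dE := diff_unique Lc E.
by split=> //; apply/diff_locallyP; rewrite dE.
Qed.

Lemma near_eq_differentiable (K : numFieldType) (V W : normedModType K)
    (f g : V -> W) (x : V) :
  (\near x, f x = g x) -> differentiable f x -> differentiable g x.
Proof.
move=> fg df.
have fgx : f x = g x by exact: nbhs_singleton fg.
apply: (proj1 (@differentiable_linear_approx _ _ _ g ('d f x) x (diff_continuous df) _)).
move=> e e0; have /eqaddoP h := diff_locally df; have := h e e0; apply: filter_app.
have : \forall h \near (0 : V), f (h + x) = g (h + x).
  have := fg; rewrite (near_shift 0 x)/= subr0.
  by apply: filterS.
apply: filterS => k fgk.
by rewrite -[((f \o shift x - (cst (f x) + 'd f x)) k)]/(f (k + x) - (f x + 'd f x k)) fgk fgx opprD addrA.
Qed.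

(** * The body and its gauge *)

Section Rn.
Context {R : realType}.
Notation vec := 'rV[R]_4.

Definition i0 : 'I_4 := @Ordinal 4 0 isT.
Definition i1 : 'I_4 := @Ordinal 4 1 isT.
Definition i2 : 'I_4 := @Ordinal 4 2 isT.
Definition i3 : 'I_4 := @Ordinal 4 3 isT.

Lemma sum4 (V : nmodType) (F : 'I_4 -> V) :
  \sum_i F i = F i0 + F i1 + F i2 + F i3.
Proof.
rewrite !big_ord_recl big_ord0 addr0 !addrA.
by congr (_ + _ + _ + _); congr F; apply/val_inj.
Qed.

Lemma all4 (P : 'I_4 -> Prop) : P i0 -> P i1 -> P i2 -> P i3 -> forall i, P i.
Proof.
move=> p0 p1 p2 p3 [[|[|[|[|//]]]] h].
- by rewrite (_ : Ordinal h = i0)//; apply/val_inj.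
- by rewrite (_ : Ordinal h = i1)//; apply/val_inj.
- by rewrite (_ : Ordinal h = i2)//; apply/val_inj.
- by rewrite (_ : Ordinal h = i3)//; apply/val_inj.
Qed.

Lemma dotpE (x y : vec) :
  dotp x y = x 0 i0 * y 0 i0 + x 0 i1 * y 0 i1 + x 0 i2 * y 0 i2 + x 0 i3 * y 0 i3.
Proof. by rewrite /dotp mxE sum4 !mxE. Qed.

Lemma norm_coord_le (x : vec) i : `|x 0 i| <= `|x|.
Proof.
have /mapP[j Hj ->] : `|x ord0 i| \in [seq `|x y.1 y.2| | y : 'I_1 * 'I_4].
  by apply/mapP; exists (ord0, i) => //=; rewrite mem_enum.
by rewrite [leRHS]/Num.norm /= mx_normrE; apply/bigmax_geP; right => /=; exists j.
Qed.

Lemma norm_coord_ub (x : vec) (c : R) : 0 <= c -> (forall i, `|x 0 i| <= c) -> `|x| <= c.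
Proof.
move=> c0 h; rewrite [leLHS]/Num.norm /= mx_normrE.
by apply/bigmax_leP; split=> // -[i j] _ /=; rewrite (ord1 i).
Qed.

Lemma norm_dotp_le (x y : vec) : `|dotp x y| <= 4 * `|x| * `|y|.
Proof.
have h i : `|x 0 i * y 0 i| <= `|x| * `|y|.
  by rewrite normrM ler_pM ?norm_coord_le.
rewrite dotpE; have := h i0; have := h i1; have := h i2; have := h i3.
move=> a3 a2 a1 a0.
rewrite (le_trans (ler_normD _ _))// (le_trans (lerD (ler_normD _ _) (lexx _)))//.
rewrite (le_trans (lerD (lerD (ler_normD _ _) (lexx _)) (lexx _)))//.
lra.
Qed.

Lemma dotp_linear (g : vec) : linear (fun h => dotp h g : R).
Proof. by move=> a u v; rewrite !dotpE !mxE /GRing.scale/=; ring. Qed.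

Section ContinuousAt.
Context {T : topologicalType}.
Implicit Types (f g : T -> R) (x : T).

Lemma ctsD f g x : {for x, continuous f} -> {for x, continuous g} ->
  {for x, continuous (fun y => f y + g y)}.
Proof. by move=> fx gx; exact: (cvgD fx gx). Qed.

Lemma ctsM f g x : {for x, continuous f} -> {for x, continuous g} ->
  {for x, continuous (fun y => f y * g y)}.
Proof. by move=> fx gx; exact: (cvgM fx gx). Qed.

Lemma ctsN f x : {for x, continuous f} -> {for x, continuous (fun y => - f y)}.
Proof. by move=> fx; exact: (cvgN fx). Qed.

Lemma ctsV f x : f x != 0 -> {for x, continuous f} ->
  {for x, continuous (fun y => (f y)^-1)}.
Proof. by move=> f0 fx; exact: (cvgV f0 fx). Qed.

Lemma cts_cst (c : R) x : {for x, continuous (fun=> c)}.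
Proof. exact: cvg_cst. Qed.

Lemma ctsX f n x : {for x, continuous f} -> {for x, continuous (fun y => f y ^+ n)}.
Proof.
move=> fx; elim: n => [|n IH]; first exact: cts_cst.
have -> : (fun y => f y ^+ n.+1) = (fun y => f y * f y ^+ n).
  by apply/funext => y; rewrite exprS.
exact: ctsM.
Qed.

Lemma cts_comp (h : R -> R) f x : continuous h -> {for x, continuous f} ->
  {for x, continuous (fun y => h (f y))}.
Proof. by move=> hc fx; exact: (continuous_comp fx (hc _)). Qed.

Lemma ctsP f x : {for x, continuous f} <->
  forall e : R, 0 < e -> \forall y \near x, `|f x - f y| <= e.
Proof.
split=> [fx e e0|h].
  have fx' : f y @[y --> x] --> f x := fx.
  by move/cvgrPdist_le : fx' => /(_ e e0).
by have : f y @[y --> x] --> f x by apply/cvgrPdist_le.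
Qed.

End ContinuousAt.

Lemma cts_coord (i : 'I_4) (x : vec) : {for x, continuous (fun y : vec => y 0 i)}.
Proof. exact: coord_continuous. Qed.

Lemma continuous_dotp (g : vec) : continuous (fun h => dotp h g : R).
Proof.
move=> x; apply: (_ : {for x, continuous (fun h => dotp h g : R)}).
have -> : (fun h => dotp h g : R) =
    (fun h => h 0 i0 * g 0 i0 + h 0 i1 * g 0 i1 + h 0 i2 * g 0 i2 + h 0 i3 * g 0 i3).
  by apply/funext => h; rewrite dotpE.
by do ![apply: ctsD]; (apply: ctsM; [exact: cts_coord | exact: cts_cst]).
Qed.

Lemma differentiable_gradient (f : vec -> R) (g x : vec) :
  (forall e : R, 0 < e -> \forall h \near (0 : vec),
     `|f (h + x) - f x - dotp h g| <= e * `|h|) ->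
  differentiable f x /\ forall v, 'D_v f x = dotp v g.
Proof.
move=> fx.
pose L : {linear vec -> R} := HB.pack (fun h => dotp h g : R)
  (GRing.isLinear.Build R vec R _ (fun h => dotp h g : R) (dotp_linear g)).
have [df dE] := @differentiable_linear_approx _ _ _ f L x (@continuous_dotp g) fx.
by split=> // v; rewrite deriveE// dE.
Qed.

End Rn.

Section Body.
Context {R : realType}.
Notation vec := 'rV[R]_4.
Implicit Types x y v : vec.

Definition phi x : R :=
  x 0 i1 ^+ 2 + x 0 i2 ^+ 2 + x 0 i3 ^+ 2 - Rf (x 0 i0).
(* half the gradient of [phi] *)
Definition hgrad x : vec := \row_i (if i == i0 then mf (x 0 i0) else x 0 i).
Definition Kbody : set vec := [set x | phi x <= 0].

Lemma hgradE x v : dotp v (hgrad x) =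
  v 0 i0 * mf (x 0 i0) + v 0 i1 * x 0 i1 + v 0 i2 * x 0 i2 + v 0 i3 * x 0 i3.
Proof. by rewrite dotpE !mxE. Qed.

(** The difference is a sum of three squares [(y_i - x_i)^2] and the gap in [Rf_tangent]. *)
Lemma phi_tangent x y : phi x + 2 * dotp (y - x) (hgrad x) <= phi y.
Proof.
rewrite hgradE /phi !mxE.
have := Rf_tangent (x 0 i0) (y 0 i0).
have := sqr_ge0 (y 0 i1 - x 0 i1); have := sqr_ge0 (y 0 i2 - x 0 i2).
have := sqr_ge0 (y 0 i3 - x 0 i3).
rewrite !sqrrB; nra.
Qed.

Lemma phi0 : phi 0 = - 31.
Proof. by rewrite /phi !mxE Rf0; ring. Qed.

Lemma dotpBl x y v : dotp (x - y) v = dotp x v - dotp y v.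
Proof. by rewrite !dotpE !mxE; ring. Qed.

Lemma dotpZl (a : R) x v : dotp (a *: x) v = a * dotp x v.
Proof. by rewrite !dotpE !mxE; ring. Qed.

Lemma dotp0l v : dotp 0 v = 0.
Proof. by rewrite !dotpE !mxE; ring. Qed.

Lemma vec_neq0 x : x != 0 -> exists i, x 0 i != 0.
Proof.
move=> x0; apply/existsP; apply: contraNT x0; rewrite negb_exists => /forallP h.
by apply/eqP/rowP => i; rewrite mxE; apply/eqP; have := h i; rewrite negbK.
Qed.

Lemma hgrad_self_gt0 x : x != 0 -> 0 < dotp x (hgrad x).
Proof.
move=> x0; rewrite hgradE.
have h0 := mf_ge0 (x 0 i0); rewrite mulrC in h0.
have h1 := sqr_ge0 (x 0 i1); have h2 := sqr_ge0 (x 0 i2); have h3 := sqr_ge0 (x 0 i3).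
rewrite !expr2 in h1 h2 h3.
have pos i : x 0 i != 0 -> 0 < x 0 i * x 0 i.
  by move=> h; rewrite -expr2 exprn_even_gt0.
have [i] := vec_neq0 x0.
elim/all4: i => [/mf_gt0|/pos|/pos|/pos]; rewrite ?[mf _ * _]mulrC; lra.
Qed.

Lemma continuous_phi : continuous phi.
Proof.
move=> x; apply: (_ : {for x, continuous phi}).
apply: ctsD; last first.
  by apply: ctsN; apply: cts_comp; [exact: continuous_Rf | exact: cts_coord].
by do ![apply: ctsD]; apply: ctsX; exact: cts_coord.
Qed.

Lemma Kbody_convex : Defs.convex_set Kbody.
Proof.
move=> x y t; rewrite /Kbody /= => Kx Ky /andP[t0 t1].
set p := t *: x + (1 - t) *: y.
(* Both tangent bounds are taken at the combination [p], so that their slopes cancel in the weighted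
   sum. *)
have := phi_tangent p x; have := phi_tangent p y.
set gx := dotp (x - p) _; set gy := dotp (y - p) _.
have : t * gx + (1 - t) * gy = 0.
  by rewrite /gx /gy !dotpE !mxE; ring.
move: (phi x) (phi y) (phi p) gx gy Kx Ky => a b c gx gy Kx Ky h ha hb.
have : t * (c + 2 * gx) <= t * 0 by apply: ler_wpM2l => //; exact: le_trans Kx.
have : (1 - t) * (c + 2 * gy) <= (1 - t) * 0.
  by apply: ler_wpM2l; [rewrite subr_ge0|exact: le_trans Ky].
by nra.
Qed.

Lemma Kbody_norm x : Kbody x -> `|x| <= zf 1 + 31.
Proof.
rewrite /Kbody/= /phi => h.
have h1 := sqr_ge0 (x 0 i1); have h2 := sqr_ge0 (x 0 i2); have h3 := sqr_ge0 (x 0 i3).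
have R0 : 0 <= Rf (x 0 i0) by lra.
have R31 := Rf_le (x 0 i0).
have z0 := Rf_ge0_le R0.
have z1 : 0 <= zf (1 : R) by rewrite -zf0 zf_mono ler01.
have sq (a : R) : a ^+ 2 <= 31 -> `|a| <= zf 1 + 31.
  move=> a31; rewrite (le_trans (_ : _ <= 31)) ?lerDr//.
  rewrite -(@ler_pXn2r _ 2)// ?nnegrE// real_normK ?num_real//.
  by rewrite (le_trans a31)//; lra.
apply: norm_coord_ub; first by lra.
apply: all4; [by lra|apply: sq; lra..].
Qed.

Lemma Kbody_closed : closed Kbody.
Proof.
have -> : Kbody = phi @^-1` [set r | r <= 0] by [].
apply: closed_comp => [x _|]; [exact: continuous_phi | exact: closed_le].
Qed.

Lemma Kbody_osym : osym_body Kbody.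
Proof.
split.
- apply: bounded_closed_compact; last exact: Kbody_closed.
  exists (zf 1 + 31); split; first exact: num_real.
  by move=> M hM x /Kbody_norm h; exact: le_trans h (ltW hM).
- exact: Kbody_convex.
- exists 0; apply: (@filterS _ _ _ (phi @^-1` [set r | r < 0])).
    by move=> x /= /ltW.
  apply: open_nbhs_nbhs; split; last by rewrite /= phi0 oppr_lt0.
  by apply: open_comp => [x _|]; [exact: continuous_phi | exact: open_lt].
- by move=> x; rewrite /Kbody/= /phi !mxE !sqrrN RfN.
Qed.

Lemma ysqE x : x 0 i1 ^+ 2 + x 0 i2 ^+ 2 + x 0 i3 ^+ 2 = dotp x x - x 0 i0 ^+ 2.
Proof. by rewrite dotpE; ring. Qed.

Definition axis : vec := delta_mx 0 i0.

Lemma phi_orthogonal (Q : 'M[R]_4) x : Q *m Q^T = 1%:M ->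
  axis *m Q = axis -> phi (x *m Q) = phi x.
Proof.
move=> QQ uQ.
have dQ : dotp (x *m Q) (x *m Q) = dotp x x.
  by rewrite /dotp trmx_mul mulmxA -(mulmxA x) QQ mulmx1.
have c0 y : y 0 i0 = dotp y axis by rewrite dotpE /axis !mxE/=; ring.
have xQ : (x *m Q) 0 i0 = x 0 i0.
  by rewrite !c0 -[in LHS]uQ /dotp trmx_mul mulmxA -(mulmxA x) QQ mulmx1.
by rewrite /phi !ysqE dQ xQ.
Qed.

Lemma Kbody_revolution : body_of_revolution Kbody.
Proof.
exists axis.
  apply/eqP => /rowP/(_ i0); rewrite /axis !mxE/= => /eqP; rewrite oner_eq0//.
move=> Q QQ _ uQ.
have QQ' : Q^T *m Q = 1%:M by exact: mulmx1C.
have uQ' : axis *m Q^T = axis.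
  by rewrite -[in LHS]uQ -mulmxA QQ mulmx1.
apply/seteqP; split=> [_ [x Kx <-]|x Kx].
  by rewrite /Kbody/= phi_orthogonal.
exists (x *m Q^T); last by rewrite -mulmxA QQ' mulmx1.
by rewrite /Kbody/= phi_orthogonal// trmxK.
Qed.

End Body.

(** * The gauge and its gradient *)

Section Gauge.
Context {R : realType}.
Notation vec := 'rV[R]_4.
Notation gam := (gauge (@Kbody R)).
Implicit Types x y v : vec.

Lemma gauge_ray x : x != 0 -> exists2 t, 0 < t & phi (t^-1 *: x) = 0.
Proof.
move=> x0.
have g0 := hgrad_self_gt0 x0.
(* By [phi_tangent], [phi (L x) >= phi x + 2 (L - 1) dotp x (hgrad x)], and this [L] turns the right
   side into [phi x + 2 |phi x|]. Since [phi 0 < 0], the ray crosses the boundary before [L]. *)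
pose L := 1 + `|phi x| / dotp x (hgrad x).
have L1 : 1 <= L by rewrite lerDl divr_ge0// ltW.
have pL : 0 <= phi (L *: x).
  have := phi_tangent x (L *: x).
  have -> : L *: x - x = (L - 1) *: x by rewrite scalerBl scale1r.
  have -> : L - 1 = `|phi x| / dotp x (hgrad x) by rewrite /L; ring.
  rewrite dotpZl divfK ?gt_eqF//.
  have := ler_norm (- phi x); rewrite normrN; have := normr_ge0 (phi x); lra.
have [|||c /[!in_itv]/= /andP[c0 cL] pc] := @IVT R (fun l => phi (l *: x)) 0 L 0.
- by lra.
- apply: continuous_subspaceT => l.
  apply: (@continuous_comp _ _ _ (fun l : R => l *: x) phi); last exact: continuous_phi.
  exact: scalel_continuous.
- rewrite scale0r phi0 min_l ?max_r; [|lra|lra]; rewrite pL andbT; lra.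
have c_gt0 : 0 < c.
  rewrite lt_def c0 andbT; apply/eqP => cE; move: pc; rewrite cE scale0r phi0.
  by move/eqP; rewrite oppr_eq0 pnatr_eq0.
by exists c^-1; rewrite ?invr_gt0// invrK.
Qed.

Lemma gaugeE x (t : R) : 0 < t -> phi (t^-1 *: x) = 0 -> gam x = t.
Proof.
move=> t0 pt.
have p0 : t^-1 *: x != 0.
  by apply/eqP => h; move: pt; rewrite h phi0 => /eqP; rewrite oppr_eq0 pnatr_eq0.
pose S := [set s : R | 0 < s /\ exists2 y, (@Kbody R) y & x = s *: y].
have tS : S t.
  split=> //; exists (t^-1 *: x); first by rewrite /Kbody/= pt.
  by rewrite scalerA divff ?gt_eqF// scale1r.
(* If [s < t], then [y] is the boundary point stretched by [t / s > 1], and the tangent bound forces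
   [phi y > 0]. *)
have lbS s : S s -> t <= s.
  move=> [s0 [y Ky xE]]; rewrite leNgt; apply/negP => st.
  have := phi_tangent (t^-1 *: x) y.
  have -> : y - t^-1 *: x = (t / s - 1) *: (t^-1 *: x).
    by apply/rowP => i; rewrite xE !mxE; field; rewrite !gt_eqF.
  rewrite pt dotpZl add0r.
  have h : 0 < (t / s - 1) * dotp (t^-1 *: x) (hgrad (t^-1 *: x)).
    by rewrite mulr_gt0 ?hgrad_self_gt0// subr_gt0 ltr_pdivlMr// mul1r.
  by rewrite /Kbody/= in Ky; lra.
apply/eqP; rewrite eq_le /gauge; apply/andP; split.
  by apply: ge_inf => //; exists t => s /lbS.
by apply: lb_le_inf; [exists t | move=> s /lbS].
Qed.

Lemma gauge_gt0 x : x != 0 -> 0 < gam x.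
Proof. by move=> x0; have [t t0 pt] := gauge_ray x0; rewrite (gaugeE t0 pt). Qed.

Definition bdpt x : vec := (gam x)^-1 *: x.

Lemma phi_bdpt x : x != 0 -> phi (bdpt x) = 0.
Proof. by move=> x0; have [t t0 pt] := gauge_ray x0; rewrite /bdpt (gaugeE t0 pt). Qed.

Lemma bdptK x : x != 0 -> gam x *: bdpt x = x.
Proof. by move=> x0; rewrite /bdpt scalerA divff ?scale1r// gt_eqF// gauge_gt0. Qed.

Definition gden x : R := dotp (bdpt x) (hgrad (bdpt x)).

(** This is the tangent inequality at the boundary point, read at the origin where [phi] is -31. *)
Lemma gden_ge x : x != 0 -> 31 / 2 <= gden x.
Proof.
move=> x0; have := phi_tangent (bdpt x) 0.
by rewrite phi_bdpt// phi0 add0r dotpBl dotp0l -/(gden x); lra.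
Qed.

Lemma gden_gt0 x : x != 0 -> 0 < gden x.
Proof. by move=> /gden_ge; lra. Qed.

(** The gradient of the gauge: normal to the boundary at [bdpt x], with the length imposed by
    Euler's relation [dotp x (ggrad x) = gam x]. *)
Definition ggrad x : vec := (gden x)^-1 *: hgrad (bdpt x).

Lemma dotpZr (a : R) x v : dotp x (a *: v) = a * dotp x v.
Proof. by rewrite !dotpE !mxE; ring. Qed.

Lemma dotp_bdpt x v : x != 0 -> dotp x v = gam x * dotp (bdpt x) v.
Proof. by move=> x0; rewrite -dotpZl bdptK. Qed.

Lemma ggrad_self x : x != 0 -> dotp x (ggrad x) = gam x.
Proof.
move=> x0; rewrite /ggrad dotpZr dotp_bdpt// -/(gden x).
by rewrite mulrCA mulVf ?mulr1// gt_eqF// gden_gt0.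
Qed.

Lemma ggrad_le x y : x != 0 -> y != 0 -> dotp y (ggrad x) <= gam y.
Proof.
move=> x0 y0; have := phi_tangent (bdpt x) (bdpt y).
rewrite !phi_bdpt// add0r dotpBl -/(gden x) => h.
rewrite /ggrad dotpZr dotp_bdpt// mulrCA.
rewrite ler_piMr ?(ltW (gauge_gt0 y0))// mulrC ler_pdivrMr ?gden_gt0// mul1r; lra.
Qed.

(** The supporting functionals at [x] and at [y] bound the increment from both sides.
    Differentiability then needs only the continuity of [ggrad], and no implicit function
    theorem. *)
Lemma gauge_sub x y : x != 0 -> y != 0 ->
  dotp (y - x) (ggrad x) <= gam y - gam x <= dotp (y - x) (ggrad y).
Proof.
move=> x0 y0; rewrite !dotpBl !ggrad_self//.
by have := ggrad_le x0 y0; have := ggrad_le y0 x0 => h1 h2; apply/andP; lra.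
Qed.

Lemma mf_bounded (z M : R) : `|z| <= M -> `|mf z| <= mf M.
Proof. by rewrite !ler_norml -mfN !mf_mono. Qed.

Definition gradbound : R := mf (zf 1 + 31) + zf 1 + 31.

(** With [gauge_sub], a bound on [ggrad] gives the continuity of the gauge; the continuity of [bdpt]
    and of [ggrad] itself follows from that. *)
Lemma ggrad_bound x : x != 0 -> `|ggrad x| <= gradbound.
Proof.
move=> x0.
have Kp : (@Kbody R) (bdpt x) by rewrite /Kbody/= phi_bdpt.
have np := Kbody_norm Kp.
have z1 : 0 <= zf (1 : R) by rewrite -zf0 zf_mono ler01.
have m0 : 0 <= mf (zf 1 + 31 : R) by have := @mf_bounded 0 (zf 1 + 31); rewrite normr0 => /(_ ltac:(lra)); apply: le_trans.
rewrite /ggrad normrZ ger0_norm; last by rewrite invr_ge0 ltW// gden_gt0.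
rewrite ler_pdivrMl ?gden_gt0//.
have hb : `|hgrad (bdpt x)| <= gradbound.
  apply: norm_coord_ub; first by rewrite /gradbound; lra.
  move=> i; rewrite mxE; have ni := le_trans (norm_coord_le (bdpt x) i) np.
  case: ifPn => [_|_]; last by rewrite (le_trans ni)// /gradbound; lra.
  apply: le_trans (mf_bounded (le_trans (norm_coord_le (bdpt x) i0) np)) _.
  by rewrite /gradbound; lra.
apply: (le_trans hb); rewrite ler_peMl//; first by rewrite /gradbound; lra.
by have := gden_ge x0; lra.
Qed.

Lemma near_neq0 x : x != 0 -> \forall y \near x, y != 0.
Proof.
move=> x0.
have o : open (~` [set (0 : vec)]).
  exact/closed_openC/accessible_closed_set1/hausdorff_accessible/norm_hausdorff.
have : nbhs x (~` [set (0 : vec)]) by apply: open_nbhs_nbhs; split=> //; exact/eqP.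
by apply: filterS => y /eqP.
Qed.

Lemma cts_gauge x : x != 0 -> {for x, continuous gam}.
Proof.
move=> x0; apply/ctsP => e e0.
have gb0 : 0 <= gradbound by exact: le_trans (ggrad_bound x0).
have d0 : 0 < e / (4 * gradbound + 1) by rewrite divr_gt0//; lra.
near=> y.
have y0 : y != 0 by near: y; exact: near_neq0.
have yx : `|x - y| <= e / (4 * gradbound + 1).
  by near: y; apply: cvgr_dist_le => //; exact: cvg_id.
have /andP[h1 h2] := gauge_sub x0 y0.
have b v (u : vec) : `|v| <= gradbound -> `|dotp (y - u) v| <= 4 * `|u - y| * gradbound.
  by move=> hv; rewrite (le_trans (norm_dotp_le _ _))// distrC ler_wpM2l// mulr_ge0.
have := b _ x (ggrad_bound x0); have := b _ x (ggrad_bound y0).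
rewrite !ler_norml => /andP[b1 b2] /andP[b3 b4].
have : 4 * `|x - y| * gradbound <= e.
  apply: (@le_trans _ _ (`|x - y| * (4 * gradbound + 1))).
    by have := normr_ge0 (x - y); lra.
  by rewrite -ler_pdivlMr//; lra.
by move=> ?; apply/andP; lra.
Unshelve. all: by end_near.
Qed.

Lemma cts_bdpt x i : x != 0 -> {for x, continuous (fun y => bdpt y 0 i)}.
Proof.
move=> x0; have -> : (fun y => bdpt y 0 i) = (fun y => (gam y)^-1 * y 0 i).
  by apply/funext => y; rewrite mxE.
apply: ctsM; last exact: cts_coord.
by apply: ctsV; [rewrite gt_eqF// gauge_gt0 | exact: cts_gauge].
Qed.

Lemma cts_hgrad x i : x != 0 -> {for x, continuous (fun y => hgrad (bdpt y) 0 i)}.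
Proof.
move=> x0; have [->|ii] := eqVneq i i0.
  have -> : (fun y => hgrad (bdpt y) 0 i0) = (fun y => mf (bdpt y 0 i0)).
    by apply/funext => y; rewrite mxE eqxx.
  by apply: cts_comp; [exact: is_derive1_continuous is_derive_mf | exact: cts_bdpt].
have -> : (fun y => hgrad (bdpt y) 0 i) = (fun y => bdpt y 0 i).
  by apply/funext => y; rewrite mxE (negbTE ii).
exact: cts_bdpt.
Qed.

Lemma cts_ggrad x i : x != 0 -> {for x, continuous (fun y => ggrad y 0 i)}.
Proof.
move=> x0; have -> : (fun y => ggrad y 0 i) = (fun y => (gden y)^-1 * hgrad (bdpt y) 0 i).
  by apply/funext => y; rewrite mxE.
apply: ctsM; last exact: cts_hgrad.
apply: ctsV; first by rewrite gt_eqF// gden_gt0.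
have -> : gden = (fun y => bdpt y 0 i0 * hgrad (bdpt y) 0 i0 + bdpt y 0 i1 * hgrad (bdpt y) 0 i1
   + bdpt y 0 i2 * hgrad (bdpt y) 0 i2 + bdpt y 0 i3 * hgrad (bdpt y) 0 i3).
  by apply/funext => y; rewrite /gden dotpE.
by do ![apply: ctsD]; (apply: ctsM; [exact: cts_bdpt | exact: cts_hgrad]).
Qed.

Lemma gauge_differentiable x : x != 0 ->
  differentiable gam x /\ forall v, 'D_v gam x = dotp v (ggrad x).
Proof.
move=> x0; apply: differentiable_gradient => e e0.
(* The 4 compensates the factor in [norm_dotp_le]. *)
have near_g : \forall y \near x, `|ggrad x - ggrad y| <= e / 4.
  have h i : \forall y \near x, `|ggrad x 0 i - ggrad y 0 i| <= e / 4.
    by move: (@cts_ggrad x i x0) => /ctsP/(_ (e / 4)); apply; lra.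
  have E y i : (ggrad x - ggrad y) 0 i = ggrad x 0 i - ggrad y 0 i by rewrite !mxE.
  near=> y; apply: norm_coord_ub; first by lra.
  by apply: all4; rewrite E; near: y; exact: h.
have near_s : \forall y \near x, y != 0 /\ `|ggrad x - ggrad y| <= e / 4.
  by near=> y; split; near: y => //; exact: near_neq0.
have : \forall h \near (0 : vec), h + x != 0 /\ `|ggrad x - ggrad (h + x)| <= e / 4.
  have := near_s; rewrite (near_shift 0 x)/= subr0.
  by apply: filterS.
apply: filterS => h [hx0 hg].
have := gauge_sub x0 hx0; rewrite addrK => /andP[h1 h2].
have dB a b : dotp h (a - b) = dotp h a - dotp h b by rewrite !dotpE !mxE; ring.
rewrite ger0_norm ?subr_ge0//.
apply: (@le_trans _ _ (dotp h (ggrad (h + x) - ggrad x))); first by rewrite dB; lra.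
apply: (le_trans (ler_norm _)); apply: (le_trans (norm_dotp_le _ _)).
rewrite [X in _ * X]distrC -mulrA mulrCA -[leRHS]mulrC ler_wpM2l//; lra.
Unshelve. all: by end_near.
Qed.

(* A class of functions, containing the gauge, that is closed under directional derivatives. *)
Inductive sm : (vec -> R) -> Prop :=
| sm_cst c : sm (fun=> c)
| sm_coord i : sm (fun x => x 0 i)
| sm_gauge : sm gam
| sm_add f g : sm f -> sm g -> sm (fun x => f x + g x)
| sm_mul f g : sm f -> sm g -> sm (fun x => f x * g x)
| sm_inv f : sm f -> (forall x, x != 0 -> f x != 0) -> sm (fun x => (f x)^-1)
| sm_sf f : sm f -> sm (fun x => sf (f x))
| sm_qf f : sm f -> sm (fun x => qf (f x)).

Lemma sm_sqr f : sm f -> sm (fun x => f x ^+ 2).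
Proof. by move=> h; under eq_fun do rewrite expr2; exact: sm_mul. Qed.

Lemma sm_bdpt i : sm (fun x => bdpt x 0 i).
Proof.
under eq_fun do rewrite mxE; apply: sm_mul; last exact: sm_coord.
by apply: sm_inv; [exact: sm_gauge | move=> x x0; rewrite gt_eqF// gauge_gt0].
Qed.

Lemma sm_hgrad i : sm (fun x => hgrad (bdpt x) 0 i).
Proof.
have [->|ii] := eqVneq i i0.
  under eq_fun do rewrite mxE eqxx.
  by apply: sm_mul; [|apply: sm_qf]; apply: sm_sf; exact: sm_bdpt.
by under eq_fun do rewrite mxE (negbTE ii); exact: sm_bdpt.
Qed.

Lemma sm_dgauge v : sm (fun x => dotp v (ggrad x)).
Proof.
under eq_fun do rewrite /ggrad dotpZr.
apply: sm_mul.
  apply: sm_inv; last by move=> x x0; rewrite gt_eqF// gden_gt0.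
  rewrite /gden; under eq_fun do rewrite dotpE.
  by do ![apply: sm_add]; (apply: sm_mul; [exact: sm_bdpt | exact: sm_hgrad]).
under eq_fun do rewrite dotpE.
by do ![apply: sm_add]; (apply: sm_mul; [exact: sm_cst | exact: sm_hgrad]).
Qed.

End Gauge.

(** * Smoothness of the gauge *)

Section Smooth.
Context {R : realType}.
Notation vec := 'rV[R]_4.
Notation gam := (gauge (@Kbody R)).
Implicit Types (x y v : vec) (f g : vec -> R).

Definition sm_diff f := (forall x, x != 0 -> differentiable f x) /\
  (forall v, exists2 g, sm g & forall x, x != 0 -> 'D_v f x = g x).

Lemma derive_comp1 (h : R -> R) f x v (dh : R) : differentiable f x ->
  is_derive (f x) (1 : R) h dh ->
  differentiable (fun y => h (f y)) x /\ 'D_v (fun y => h (f y)) x = dh * 'D_v f x.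
Proof.
move=> df [dh1 dhE].
have dh2 : differentiable h (f x) by exact/derivable1_diffP.
have d : differentiable (h \o f) x by exact: differentiable_comp.
split; first exact: d.
rewrite (_ : (fun y => h (f y)) = h \o f)// deriveE// diff_comp//= (deriv1E dh1).
by rewrite derive1E dhE mulrC deriveE.
Qed.

(** The class closes up because [sf' = qf(sf) / npol(sf^2)] and [qf' = s (224 s^2 - 28) / qf] are
    again rational in [sf] and [qf], and [sm_dgauge] expresses the derivative of the gauge through
    the gauge. One differentiation step within the class thus gives all orders. *)
Lemma sm_diffP f : sm f -> sm_diff f.
Proof.
elim=> {f}.
- move=> c; split=> [x _|v]; first exact: differentiable_cst.
  by exists (fun=> 0); [exact: sm_cst | move=> x _; exact: derive_cst].
- move=> i; split=> [x _|v]; first exact: differentiable_coord.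
  exists (fun=> v 0 i); first exact: sm_cst.
  move=> x _.
  have [|d ->] := @differentiable_gradient R (fun x => x 0 i) (delta_mx 0 i) x; last first.
    by rewrite /dotp trmx_delta -colE mxE.
  move=> e e0; near=> h.
  by rewrite /dotp trmx_delta -colE !mxE addrK subrr normr0 mulr_ge0// ltW.
- split=> [x x0|v]; first by have [] := gauge_differentiable x0.
  exists (fun x => dotp v (ggrad x)); first exact: sm_dgauge.
  by move=> x x0; have [_ ->] := gauge_differentiable x0.
- move=> f g sf [df Df] sg [dg Dg]; split=> [x x0|v].
    by apply: differentiableD; [exact: df | exact: dg].
  have [f' sf' f'E] := Df v; have [g' sg' g'E] := Dg v.
  exists (fun x => f' x + g' x); first exact: sm_add.
  move=> x x0; rewrite -f'E// -g'E// -deriveD//; apply: diff_derivable; [exact: df | exact: dg].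
- move=> f g sf [df Df] sg [dg Dg]; split=> [x x0|v].
    by apply: differentiableM; [exact: df | exact: dg].
  have [f' sf' f'E] := Df v; have [g' sg' g'E] := Dg v.
  exists (fun x => f x * g' x + g x * f' x); first by apply: sm_add; exact: sm_mul.
  move=> x x0; rewrite -f'E// -g'E//.
  by rewrite (deriveM (@diff_derivable _ _ _ f x v (df x x0)) (@diff_derivable _ _ _ g x v (dg x x0))).
- move=> f sf [df Df] f0; split=> [x x0|v].
    by apply: differentiableV; [exact: df | exact: f0].
  have [f' sf' f'E] := Df v.
  exists (fun x => (-1) * ((f x)^-1 * (f x)^-1) * f' x).
    by do ![apply: sm_mul] => //; [exact: sm_cst|apply: sm_inv..].
  move=> x x0; rewrite -f'E//.
  rewrite (deriveV (f0 x x0) (@diff_derivable _ _ _ f x v (df x x0))) /GRing.scale/=.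
  by rewrite expr2 invfM mulN1r.
- move=> f smf [df Df].
  have D x v (x0 : x != 0) := derive_comp1 v (df x x0) (is_derive_sf (f x)).
  split=> [x x0|v]; first by have [] := D x 0 x0.
  have [f' sf' f'E] := Df v.
  exists (fun x => qf (sf (f x)) * (npol (sf (f x) ^+ 2))^-1 * f' x); last first.
    by move=> x x0; rewrite -f'E//; have [_ ->] := D x v x0.
  have sq : sm (fun x => sf (f x) ^+ 2) by apply/sm_sqr/sm_sf.
  do ![apply: sm_mul] => //; first by apply/sm_qf/sm_sf.
  apply: sm_inv; last by move=> x _; rewrite gt_eqF// npol_gt0.
  have -> : (fun x => npol (sf (f x) ^+ 2)) =
    (fun x => 59 + (-280) * (sf (f x) ^+ 2) + 336 * (sf (f x) ^+ 2) ^+ 2).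
    by apply/funext => x; rewrite /npol; ring.
  apply: sm_add; last by apply: sm_mul; [exact: sm_cst | exact: sm_sqr].
  by apply: sm_add; [exact: sm_cst | apply: sm_mul => //; exact: sm_cst].
- move=> f smf [df Df].
  have D x v (x0 : x != 0) := derive_comp1 v (df x x0) (is_derive_qf (f x)).
  split=> [x x0|v]; first by have [] := D x 0 x0.
  have [f' sf' f'E] := Df v.
  exists (fun x => f x * (- 28 + 224 * f x ^+ 2) * (qf (f x))^-1 * f' x); last first.
    by move=> x x0; rewrite -f'E//; have [_ ->] := D x v x0.
  apply: sm_mul => //; apply: sm_mul; last first.
    by apply: sm_inv; [exact: sm_qf | move=> x _; exact: qf_neq0].
  apply: sm_mul => //; apply: sm_add; first exact: sm_cst.
  by apply: sm_mul; [exact: sm_cst | exact: sm_sqr].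
Unshelve. all: by end_near.
Qed.

Lemma sm_iter vs f : sm f ->
  exists2 g, sm g & forall x, x != 0 -> iter_dir_deriv vs f x = g x.
Proof.
move=> smf; elim: vs => [|v vs [g smg gE]]; first by exists f.
have [_ /(_ v) [g' smg' g'E]] := sm_diffP smg.
exists g' => // x x0; rewrite -g'E//=.
(* The two functions agree only off the origin, but that is an open set, so their derivatives at [x]
   agree. *)
by apply: near_eq_derive; near=> y; apply: gE; near: y; exact: near_neq0.
Unshelve. all: by end_near.
Qed.

Lemma Kbody_smooth : smooth_body (@Kbody R).
Proof.
move=> vs x x0.
have [g smg gE] := sm_iter vs sm_gauge.
apply: (@near_eq_differentiable _ _ _ g); last by have [h _] := sm_diffP smg; exact: h.
by near=> y; rewrite gE//; near: y; exact: near_neq0.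
Unshelve. all: by end_near.
Qed.

End Smooth.

(** * Areas of projections *)

Section OrthonormalBases.
Context {R : realType}.
Notation vec := 'rV[R]_4.

Lemma dotpC (x y : vec) : dotp x y = dotp y x.
Proof. by rewrite !dotpE; ring. Qed.

Lemma dotp_gt0 (x : vec) : x != 0 -> 0 < dotp x x.
Proof.
move=> x0; rewrite dotpE.
have h i := sqr_ge0 (x 0 i).
have := h i0; have := h i1; have := h i2; have := h i3; rewrite !expr2 => h3 h2 h1 h0.
have pos i : x 0 i != 0 -> 0 < x 0 i * x 0 i.
  by move=> xi; rewrite -expr2 exprn_even_gt0.
have [i] := vec_neq0 x0.
by elim/all4: i => /pos; lra.
Qed.

Lemma mulmx_trE (x y : vec) : x *m y^T = (dotp x y)%:M.
Proof. by rewrite [LHS]mx11_scalar. Qed.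

(** A normalised non-zero row of [P] is fixed by [P]; subtracting its rank-one projection leaves a
    projection of smaller rank. This step yields both orthonormal bases and the equality of trace
    and rank. *)
Lemma symmetric_idempotent_split (P : 'M[R]_4) : P^T = P -> P *m P = P -> P != 0 ->
  exists f : vec, [/\ dotp f f = 1, f *m P = f,
    (P - f^T *m f)^T = P - f^T *m f,
    (P - f^T *m f) *m (P - f^T *m f) = P - f^T *m f &
    (\rank (P - f^T *m f)%R < \rank P)%N].
Proof.
move=> PT PP P0.
have [i ri] : exists i, row i P != 0.
  apply/existsP; apply: contraNT P0; rewrite negb_exists => /forallP h.
  by apply/eqP/row_matrixP => i; apply/eqP; have := h i; rewrite negbK row0.
pose r := row i P; pose n := Num.sqrt (dotp r r).
have n0 : 0 < n by rewrite sqrtr_gt0 dotp_gt0.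
pose f : vec := n^-1 *: r.
have ff : dotp f f = 1.
  rewrite /f /dotp linearZ -scalemxAl -scalemxAr 2!mxE -/(dotp r r) mulrA -expr2 exprVn.
  by rewrite sqr_sqrtr ?mulVf ?gt_eqF ?dotp_gt0// ltW// dotp_gt0.
have fP : f *m P = f by rewrite /f -scalemxAl /r -row_mul PP.
have ffm : f *m f^T = 1%:M by rewrite mulmx_trE ff.
have Pf : P *m f^T = f^T by rewrite -[in LHS]PT -trmx_mul fP.
set P' := P - f^T *m f.
have P'P' : P' *m P' = P'.
  rewrite /P' mulmxBl !mulmxBr PP mulmxA Pf -mulmxA fP.
  by rewrite -(mulmxA f^T f) (mulmxA f f^T) ffm mul1mx subrr subr0.
have fP' : f *m P' = 0 by rewrite /P' mulmxBr fP mulmxA ffm mul1mx subrr.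
exists f; split=> //.
  by rewrite /P' raddfB/= PT trmx_mul trmxK.
apply: rank_ltmx; rewrite ltmxE; apply/andP; split.
  by apply/submxP; exists P'; rewrite /P' mulmxBl PP -mulmxA fP.
apply/negP => PP'.
have /submxP[D fD] : (f <= P')%MS by rewrite -fP (submx_trans (submxMl _ _)).
have : f = 0 by rewrite fD -P'P' mulmxA -fD.
move=> f0; move: ff; rewrite f0 dotp0l => /eqP; rewrite eq_sym oner_eq0//.
Qed.

Lemma Gr24_onb (P : 'M[R]_4) : Gr24 P ->
  exists f1 f2 : vec, [/\ dotp f1 f1 = 1, dotp f2 f2 = 1, dotp f1 f2 = 0 &
    f1^T *m f1 + f2^T *m f2 = P].
Proof.
move=> [PT [PP rP]].
have P0 : P != 0 by rewrite -mxrank_eq0 rP.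
have [f1 [ff1 fP1 PT1 PP1 r1]] := symmetric_idempotent_split PT PP P0.
set P1 := P - f1^T *m f1 in PT1 PP1 r1.
have P10 : P1 != 0.
  apply/eqP => h; have : (\rank P <= 1)%N.
    have -> : P = f1^T *m f1 by apply/eqP; rewrite -subr_eq0 -/P1 h.
    by rewrite (leq_trans (mxrankM_maxr _ _))// rank_leq_row.
  by rewrite rP.
have [f2 [ff2 fP2 PT2 PP2 r2]] := symmetric_idempotent_split PT1 PP1 P10.
exists f1, f2; split=> //.
  have fP1' : f1 *m P1 = 0.
    by rewrite /P1 mulmxBr fP1 mulmxA mulmx_trE ff1 mul1mx subrr.
  by rewrite /dotp -fP2 trmx_mul PT1 mulmxA fP1' mul0mx mxE.
have : \rank (P1 - f2^T *m f2) = 0%N by move: r1 r2; rewrite rP; lia.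
move/eqP; rewrite mxrank_eq0 /P1 subr_eq0 => /eqP h.
by rewrite -h addrC subrK.
Qed.

Definition frame (f1 f2 : vec) : 'M[R]_(2, 4) := \matrix_(i, j) (if i == 0 then f1 0 j else f2 0 j).

Lemma ord2P (P : 'I_2 -> Prop) : P 0 -> P 1 -> forall i, P i.
Proof. by move=> p0 p1 [[|[|//]] h]; [rewrite (_ : Ordinal h = 0)|rewrite (_ : Ordinal h = 1)] => //; apply/val_inj. Qed.

Lemma frame_mulT (f1 f2 : vec) (U : 'M[R]_(2, 4)) : U = frame f1 f2 ->
  U *m U^T = 1%:M <-> [/\ dotp f1 f1 = 1, dotp f2 f2 = 1 & dotp f1 f2 = 0].
Proof.
move=> ->.
have E i j : (frame f1 f2 *m (frame f1 f2)^T) i j =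
    dotp (if i == 0 then f1 else f2) (if j == 0 then f1 else f2).
  by rewrite mxE sum4 dotpE !mxE; do 2 case: (_ == 0).
split=> [h|[h1 h2 h3]].
  by split; [rewrite -(E 0 0)|rewrite -(E 1 1)|rewrite -(E 0 1)]; rewrite h mxE.
apply/matrixP => i j; rewrite E mxE.
by elim/ord2P: i; elim/ord2P: j => /=; rewrite ?h1 ?h2 ?h3 ?(dotpC f2) ?h3.
Qed.

Lemma frame_Tmul (f1 f2 : vec) : (frame f1 f2)^T *m frame f1 f2 = f1^T *m f1 + f2^T *m f2.
Proof.
apply/matrixP => i j; rewrite !mxE !big_ord_recl !big_ord0/= !mxE/= !addr0.
by rewrite !(ord1 ord0).
Qed.

Lemma frame_rows (U : 'M[R]_(2, 4)) : U = frame (row 0 U) (row 1 U).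
Proof. by apply/matrixP => i j; rewrite !mxE; elim/ord2P: i. Qed.

Lemma onbP (P : 'M[R]_4) : Gr24 P ->
  onb P *m (onb P)^T = 1%:M /\ (onb P)^T *m onb P = P.
Proof.
move=> /Gr24_onb[f1 [f2 [h1 h2 h3 hP]]].
apply: (@xgetPex _ 0 [set U : 'M[R]_(2, 4) | U *m U^T = 1%:M /\ U^T *m U = P]).
exists (frame f1 f2); split; last by rewrite frame_Tmul.
by apply/(@frame_mulT f1 f2).
Qed.

Lemma onb_frame (P : 'M[R]_4) : Gr24 P -> exists f1 f2 : vec,
  [/\ onb P = frame f1 f2, [/\ dotp f1 f1 = 1, dotp f2 f2 = 1 & dotp f1 f2 = 0] &
     P = f1^T *m f1 + f2^T *m f2].
Proof.
move=> /onbP[h1 h2]; exists (row 0 (onb P)), (row 1 (onb P)).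
rewrite -frame_rows; split=> //; first by apply/frame_mulT; first exact: frame_rows.
by rewrite -frame_Tmul -frame_rows h2.
Qed.

Lemma frame_Gr24 (f1 f2 : vec) :
  dotp f1 f1 = 1 -> dotp f2 f2 = 1 -> dotp f1 f2 = 0 -> Gr24 (f1^T *m f1 + f2^T *m f2).
Proof.
move=> h1 h2 h3; set U := frame f1 f2.
have UU : U *m U^T = 1%:M by apply/(@frame_mulT f1 f2).
rewrite -frame_Tmul -/U; split; first by rewrite trmx_mul trmxK.
split; first by rewrite mulmxA -(mulmxA U^T) UU mulmx1.
apply/eqP; rewrite eqn_leq (leq_trans (mxrankM_maxr _ _)) ?rank_leq_row//=.
have r2 : \rank (U *m (U^T *m U) *m U^T) = 2%N.
  by rewrite mulmxA UU mul1mx UU mxrank1.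
have : (\rank (U *m (U^T *m U) *m U^T) <= \rank (U^T *m U))%N.
  by rewrite (leq_trans (mxrankM_maxl _ _))// mxrankM_maxr.
by rewrite r2.
Qed.

Lemma Gr24_compl (P : 'M[R]_4) : Gr24 P -> Gr24 (1%:M - P).
Proof.
move=> [PT [PP rP]]; split; first by rewrite raddfB/= trmx1 PT.
split; first by rewrite mulmxBl !mulmxBr PP !mul1mx mulmx1 subrr subr0.
have h1 : (\rank (1%:M : 'M[R]_4) <= \rank P + \rank (1%:M - P)%R)%N.
  have {1}-> : (1%:M : 'M[R]_4) = P + (1%:M - P) by rewrite addrC subrK.
  exact: mxrank_add.
have h2 : (\rank P + \rank (1%:M - P)%R <= 4)%N.
  by rewrite mulmx0_rank_max// mulmxBr mulmx1 PP subrr.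
by move: h1 h2; rewrite mxrank1 rP; lia.
Qed.

End OrthonormalBases.

(** * Planar Lebesgue measure: shears, rotations, subgraphs *)

Section PlaneMeasure.
Context {R : realType}.
Notation mu := (@lebesgue_measure R).
Notation R' := (measurableTypeR R).

Lemma measurable_shift (c : R) : measurable_fun setT (fun x : R' => x + c : R').
Proof. exact: measurable_funD. Qed.

Lemma lebesgue_measure_shift (c : R) (A : set R') : measurable A ->
  mu ((fun x : R' => x + c) @^-1` A) = mu A.
Proof.
move=> mA.
pose f : {mfun R' >-> R'} := HB.pack (fun x : R' => x + c : R')
  (isMeasurableFun.Build _ _ _ _ _ (measurable_shift c)).
suff : mu A = pushforward mu f A by move=> ->.
apply: (@lebesgue_measure_unique R (pushforward mu f)) => //.
move=> X [[a b] _ <-]; rewrite /pushforward [X in _ = mu X](_ : _ = `]a - c, b - c]%classic); last first.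
  apply/seteqP; split=> x; rewrite /= !in_itv/= => /andP[? ?]; apply/andP; split;
    rewrite -?ltrBlDr -?lerBrDr ?ltrBlDr ?lerBrDr//; lra.
rewrite !lebesgue_measure_itv/= !lte_fin ltrD2r.
by case: ifPn => // ab; rewrite -!EFinB; congr EFin; ring.
Qed.

Lemma lebesgue2E (A : set (R' * R')) : measurable A ->
  lebesgue2 A = (\int[mu]_x mu (xsection A x))%E.
Proof. by []. Qed.

Lemma lebesgue2E' (A : set (R' * R')) : measurable A ->
  lebesgue2 A = (\int[mu]_y mu (ysection A y))%E.
Proof.
move=> mA; rewrite lebesgue2E//.
have := @indic_fubini_tonelli _ _ R' R' R mu mu A mA.
by rewrite (indic_fubini_tonelli_FE _ mA) (indic_fubini_tonelli_GE _ mA).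
Qed.

Definition shear1 (k : R) (p : R' * R') : R' * R' := (p.1 + k * p.2, p.2).
Definition shear2 (k : R) (p : R' * R') : R' * R' := (p.1, p.2 + k * p.1).

Lemma measurable_shear1 k : measurable_fun setT (shear1 k).
Proof.
apply/measurable_fun_pairP; split => /=; last exact: measurable_snd.
apply: measurable_funD; first exact: measurable_fst.
by apply: measurable_funM; [exact: measurable_cst|exact: measurable_snd].
Qed.

Lemma measurable_shear2 k : measurable_fun setT (shear2 k).
Proof.
apply/measurable_fun_pairP; split => /=; first exact: measurable_fst.
apply: measurable_funD; first exact: measurable_snd.
by apply: measurable_funM; [exact: measurable_cst|exact: measurable_fst].
Qed.

Lemma lebesgue2_shear1 k (A : set (R' * R')) : measurable A ->
  lebesgue2 (shear1 k @^-1` A) = lebesgue2 A.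
Proof.
move=> mA.
have mS : measurable (shear1 k @^-1` A).
  by rewrite -[X in measurable X]setTI; exact: measurable_shear1.
rewrite !lebesgue2E'//; apply: eq_integral => y _.
rewrite -(lebesgue_measure_shift (k * y) (measurable_ysection y mA)).
by congr (mu _); apply/seteqP; split=> x; rewrite /ysection/= !inE.
Qed.

Lemma lebesgue2_shear2 k (A : set (R' * R')) : measurable A ->
  lebesgue2 (shear2 k @^-1` A) = lebesgue2 A.
Proof.
move=> mA.
have mS : measurable (shear2 k @^-1` A).
  by rewrite -[X in measurable X]setTI; exact: measurable_shear2.
rewrite !lebesgue2E//; apply: eq_integral => x _.
rewrite -(lebesgue_measure_shift (k * x) (measurable_xsection x mA)).
by congr (mu _); apply/seteqP; split=> y; rewrite /xsection/= !inE.
Qed.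

Definition rot2 (c s : R) (p : R' * R') : R' * R' :=
  (c * p.1 - s * p.2, s * p.1 + c * p.2).

(* Three shears make a rotation; the middle one has slope [s] and the outer
   ones slope [(c - 1) / s] (the half-angle tangent, up to sign). *)
Lemma lebesgue2_rot (c s : R) (A : set (R' * R')) : measurable A ->
  c ^+ 2 + s ^+ 2 = 1 -> 0 <= c -> lebesgue2 (rot2 c s @^-1` A) = lebesgue2 A.
Proof.
move=> mA cs c0.
(* The slope [(c - 1) / s] degenerates here, and [0 <= c] leaves only the identity. *)
have [s0|s0] := eqVneq s 0.
  have -> : c = 1.
    by move: cs; rewrite s0 expr0n/= addr0 => /eqP; rewrite sqrf_eq1 => /orP[/eqP//|/eqP]; lra.
  by congr lebesgue2; apply/seteqP; split=> -[x y]; rewrite /rot2/= s0 !mul1r !mul0r subr0 add0r.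
pose k := (c - 1) / s.
have -> : rot2 c s @^-1` A = shear1 k @^-1` (shear2 s @^-1` (shear1 k @^-1` A)).
  suff E p : rot2 c s p = shear1 k (shear2 s (shear1 k p)).
    by apply/seteqP; split=> p /=; rewrite E.
  case: p => x y; rewrite /rot2 /shear1 /shear2/=; congr pair.
    have -> : s * y = (1 - c ^+ 2) / s * y.
      by congr (_ * _); apply: (mulIf s0); rewrite divfK// -cs; ring.
    by rewrite /k; field.
  by rewrite /k; field.
rewrite lebesgue2_shear1 ?lebesgue2_shear2 ?lebesgue2_shear1//.
- by rewrite -[X in measurable X]setTI; exact: measurable_shear1.
- rewrite -[X in measurable X]setTI; apply: measurable_shear2 => //.
  by rewrite -[X in measurable X]setTI; exact: measurable_shear1.
Qed.

Lemma measurable_subgraph (G : R' -> R) : measurable_fun setT G ->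
  measurable [set p : R' * R' | p.2 ^+ 2 <= G p.1].
Proof.
move=> mG.
have -> : [set p : R' * R' | p.2 ^+ 2 <= G p.1] =
  (fun p : R' * R' => G p.1 - p.2 ^+ 2) @^-1` `[0, +oo[.
  by apply/seteqP; split=> p; rewrite /= in_itv/= andbT subr_ge0.
rewrite -[X in measurable X]setTI.
suff : measurable_fun setT (fun p : R' * R' => G p.1 - p.2 ^+ 2) by apply => //; exact: measurable_itv.
apply: measurable_funB; first by apply: measurableT_comp => //; exact: measurable_fst.
by apply: measurable_funX; exact: measurable_snd.
Qed.

(** Where [G] is negative the section is empty, and [Num.sqrt] returns 0 there, so the integral can
    run over the whole line. *)
Lemma lebesgue2_subgraph (G : R' -> R) : measurable_fun setT G ->
  lebesgue2 [set p | p.2 ^+ 2 <= G p.1] = (\int[mu]_x (2 * Num.sqrt (G x))%:E)%E.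
Proof.
move=> mG.
have mA := measurable_subgraph mG.
rewrite lebesgue2E//; apply: eq_integral => x _.
have [G0|G0] := leP 0 (G x).
  have -> : xsection [set p : R' * R' | p.2 ^+ 2 <= G p.1] x =
      `[- Num.sqrt (G x), Num.sqrt (G x)]%classic.
    apply/seteqP; split=> y; rewrite /xsection/= inE/= in_itv/= -ler_norml.
      by rewrite -sqrtr_sqr => h; apply: ler_wsqrtr.
    by rewrite -sqrtr_sqr ler_sqrt// sqr_ge0.
  rewrite lebesgue_measure_itv/= lte_fin.
  case: ifPn => [_|]; first by rewrite -EFinB; congr EFin; ring.
  by rewrite -leNgt => h; congr EFin; have := sqrtr_ge0 (G x); lra.
have -> : xsection [set p : R' * R' | p.2 ^+ 2 <= G p.1] x = set0.
  apply/seteqP; split=> y //; rewrite /xsection/= inE/= => h.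
  by have := sqr_ge0 y; lra.
by rewrite measure0 ltr0_sqrtr// mulr0.
Qed.

End PlaneMeasure.

(** * The shadow on a plane at a given angle to the axis *)

Section Area.
Context {R : realType}.
Notation vec := 'rV[R]_4.
Notation mu := (@lebesgue_measure R).
Notation R' := (measurableTypeR R).
Variable C : R.
Hypothesis C1 : C ^+ 2 <= 1.

(* [C] is the cosine of the angle between the plane and the axis. The boundary point
   [s = C p] of the profile projects to the abscissa [af p]. *)
Definition af (p : R) : R := C * zf (C * p) + (1 - C ^+ 2) * (p * qf (C * p)).
(** Equal to [w - C^2 (1 - p^2) w'] at [(C p)^2], but written as a convex combination of the
    positive polynomials [npol] and [w + x w'], which shows its sign. *)
Definition gpol (p : R) : R := C ^+ 2 * npol ((C * p) ^+ 2) +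
  (1 - C ^+ 2) * (31 - 56 * (C * p) ^+ 2 + 336 * ((C * p) ^+ 2) ^+ 2).
Definition daf (p : R) : R := gpol p / qf (C * p).

Lemma is_derive_af p : is_derive p (1 : R) af (daf p).
Proof.
have dC : is_derive p (1 : R) (fun p => C * p) C.
  by apply: is_derive_eq; rewrite /GRing.scale/= mulr1.
have d1 := is_derive1_comp (is_derive_zf (C * p)) dC.
have d2 := is_derive1_comp (is_derive_qf (C * p)) dC.
have -> : af = (fun p => C * (zf \o (fun p => C * p)) p +
   (1 - C ^+ 2) * (p * (qf \o (fun p => C * p)) p)) by [].
apply: is_derive_eq; rewrite /GRing.scale/= /daf /gpol /dzf.
have q0 := qf_neq0 (C * p); have hq := qf_sqr (C * p); rewrite /wpol in hq.
apply: (mulIf q0); rewrite [RHS]divfK//.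
set q := qf (C * p) in q0 hq *.
transitivity (C ^+ 2 * npol ((C * p) ^+ 2) + (1 - C ^+ 2) * (q ^+ 2 +
  (C * p) ^+ 2 * (- 28 + 224 * (C * p) ^+ 2))); first by field.
by rewrite hq; ring.
Qed.

Lemma gpol_lb p : qf (C * p) <= 100 * gpol p.
Proof.
have h := sqr_ge0 (qf (C * p) - 1); have hw := qf_sqr (C * p).
rewrite /gpol; move: (qf (C * p)) h hw => q h hw.
have h2 : 2 * q <= wpol ((C * p) ^+ 2) + 1 by rewrite -hw; lra.
set x := (C * p) ^+ 2 in h2 *.
have a1 : q <= 100 * npol x.
  by move: h2; rewrite /wpol /npol; have := sqr_ge0 (x - 5 / 12); nra.
have a2 : q <= 100 * (31 - 56 * x + 336 * x ^+ 2).
  by move: h2; rewrite /wpol /npol; have := sqr_ge0 (x - 1 / 12); nra.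
move: (npol x) (31 - _ + _) a1 a2 => n m a1 a2.
have b1 : C ^+ 2 * q <= C ^+ 2 * (100 * n) by apply: ler_wpM2l => //; exact: sqr_ge0.
have b2 : (1 - C ^+ 2) * q <= (1 - C ^+ 2) * (100 * m) by apply: ler_wpM2l => //; rewrite subr_ge0.
by lra.
Qed.

Lemma daf_lb p : 1 / 100 <= daf p.
Proof. by rewrite /daf ler_pdivlMr ?qf_gt0//; have := gpol_lb p; lra. Qed.

Definition pf : R -> R :=
  s2val (derive_ge_bijective (ltac:(lra) : 0 < 1 / 100) is_derive_af daf_lb).

Lemma afK : cancel af pf.
Proof. exact: (s2valP (derive_ge_bijective (ltac:(lra) : 0 < 1 / 100) is_derive_af daf_lb)). Qed.

Lemma pfK : cancel pf af.
Proof. exact: (s2valP' (derive_ge_bijective (ltac:(lra) : 0 < 1 / 100) is_derive_af daf_lb)). Qed.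

Lemma daf_gt0 p : 0 < daf p. Proof. by have := daf_lb p; lra. Qed.

Lemma af_lt p p' : p < p' -> af p < af p'.
Proof. by move=> h; apply: (gt_derive_gt h is_derive_af daf_gt0). Qed.

Lemma continuous_pf : continuous pf.
Proof.
have d a : is_derive a (1 : R) pf (daf (pf a))^-1.
  rewrite -[X in is_derive X]pfK; apply: (@is_derive_inverse _ af pf).
  - by near=> s; exact: afK.
  - by near=> s; exact: (is_derive1_continuous is_derive_af).
  - exact: is_derive_af.
  - by rewrite gt_eqF// daf_gt0.
exact: is_derive1_continuous d.
Unshelve. all: by end_near.
Qed.

(** For [C^2 < 1] this is the maximum over [z] of [R(z) - (a - C z)^2 / (1 - C^2)], attained at
    [z = zf (C p)] with [p = pf a]. The parametrization of the profile is made for this: the maximum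
    keeps the form [(1 - p^2) w] for every [C]. *)
Definition Gf (a : R) : R := (1 - pf a ^+ 2) * wpol ((C * pf a) ^+ 2).

Lemma continuous_Gf : continuous Gf.
Proof.
move=> a; apply: (_ : {for a, continuous Gf}).
apply: (@cts_comp _ _ (fun p => (1 - p ^+ 2) * wpol ((C * p) ^+ 2)) pf); last exact: continuous_pf.
by apply: derivable_continuous => p; rewrite /wpol; apply: ex_derive.
Qed.

(** The upper bound on [b^2] adds the tangent to [R] at [zf (C p)] and a sum of squares, without
    dividing by [1 - C^2], so planes containing the axis are covered too. *)
Lemma projection_subgraph (g1 g2 : vec) : dotp g1 g1 = 1 -> dotp g2 g2 = 1 ->
  dotp g1 g2 = 0 -> g1 0 i0 = C -> g2 0 i0 = 0 ->
  (fun x => (dotp x g1, dotp x g2)) @` (@Kbody R) = [set p : R' * R' | p.2 ^+ 2 <= Gf p.1].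
Proof.
move=> h1 h2 h3 hC h0.
rewrite !dotpE h0 hC in h1 h2 h3.
have e1 : g1 0 i1 * g1 0 i1 + g1 0 i2 * g1 0 i2 + g1 0 i3 * g1 0 i3 = 1 - C ^+ 2 by rewrite -h1; ring.
have e2 : g2 0 i1 * g2 0 i1 + g2 0 i2 * g2 0 i2 + g2 0 i3 * g2 0 i3 = 1 by rewrite -h2; ring.
have e3 : g1 0 i1 * g2 0 i1 + g1 0 i2 * g2 0 i2 + g1 0 i3 * g2 0 i3 = 0 by rewrite -h3; ring.
apply/seteqP; split=> [_ [x Kx <-]|[a b]] /=.
  set a := dotp x g1; set b := dotp x g2.
  rewrite /Gf; set p := pf a; set q := qf (C * p).
  have aE : a = C * zf (C * p) + (1 - C ^+ 2) * (p * q) by rewrite -[LHS]pfK.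
  rewrite -qf_sqr -/q.
  have tan := Rf_tangent (zf (C * p)) (x 0 i0).
  have RE : Rf (zf (C * p)) = (1 - (C * p) ^+ 2) * q ^+ 2 by rewrite /Rf sfK qf_sqr.
  have mE : mf (zf (C * p)) = C * p * q by rewrite /mf sfK.
  rewrite RE mE in tan.
  move: Kx; rewrite /Kbody/= /phi => Kx.
  have aE2 : a = x 0 i0 * C + (x 0 i1 * g1 0 i1 + x 0 i2 * g1 0 i2 + x 0 i3 * g1 0 i3).
    by rewrite /a dotpE hC; ring.
  have bE2 : b = x 0 i1 * g2 0 i1 + x 0 i2 * g2 0 i2 + x 0 i3 * g2 0 i3.
    by rewrite /b dotpE h0; ring.
  (* the component of the base point orthogonal to [g2] is compared with the optimal one *)
  pose d i := x 0 i - b * g2 0 i - p * q * g1 0 i.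
  have := sqr_ge0 (d i1); have := sqr_ge0 (d i2); have := sqr_ge0 (d i3).
  move=> s3 s2 s1; have s : 0 <= d i1 ^+ 2 + d i2 ^+ 2 + d i3 ^+ 2 by lra.
  have dE : d i1 ^+ 2 + d i2 ^+ 2 + d i3 ^+ 2 =
    (x 0 i1 ^+ 2 + x 0 i2 ^+ 2 + x 0 i3 ^+ 2) - b ^+ 2
    - 2 * (p * q) * (a - x 0 i0 * C) + (p * q) ^+ 2 * (1 - C ^+ 2).
    transitivity ((x 0 i1 ^+ 2 + x 0 i2 ^+ 2 + x 0 i3 ^+ 2)
      - 2 * b * (x 0 i1 * g2 0 i1 + x 0 i2 * g2 0 i2 + x 0 i3 * g2 0 i3)
      + b ^+ 2 * (g2 0 i1 * g2 0 i1 + g2 0 i2 * g2 0 i2 + g2 0 i3 * g2 0 i3)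
      - 2 * (p * q) * (x 0 i1 * g1 0 i1 + x 0 i2 * g1 0 i2 + x 0 i3 * g1 0 i3)
      + 2 * (b * p * q) * (g1 0 i1 * g2 0 i1 + g1 0 i2 * g2 0 i2 + g1 0 i3 * g2 0 i3)
      + (p * q) ^+ 2 * (g1 0 i1 * g1 0 i1 + g1 0 i2 * g1 0 i2 + g1 0 i3 * g1 0 i3)).
      by rewrite /d; ring.
    by rewrite -bE2 e1 e2 e3 [in X in _ = _ - _ * (X - _) + _]aE2; ring.
  rewrite dE in s.
  have key : b ^+ 2 <= (1 - (C * p) ^+ 2) * q ^+ 2 - 2 * (C * p * q) * (x 0 i0 - zf (C * p))
     - 2 * (p * q) * (a - x 0 i0 * C) + (p * q) ^+ 2 * (1 - C ^+ 2) by lra.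
  apply: (le_trans key); rewrite le_eqVlt; apply/orP; left; apply/eqP.
  by rewrite aE; ring.
rewrite /Gf; set p := pf a; set q := qf (C * p); rewrite -qf_sqr -/q => hb.
have aE : a = C * zf (C * p) + (1 - C ^+ 2) * (p * q) by rewrite -[LHS]pfK.
(* The point where the upper bound is tight: height [zf (C p)], and the base point that makes all
   the squares [d i] vanish. *)
pose x : vec := \row_i (if i == i0 then zf (C * p) else p * q * g1 0 i + b * g2 0 i).
exists x.
  rewrite /Kbody/= /phi !mxE/= /Rf sfK -qf_sqr -/q subr_le0.
  have -> : (p * q * g1 0 i1 + b * g2 0 i1) ^+ 2 + (p * q * g1 0 i2 + b * g2 0 i2) ^+ 2
    + (p * q * g1 0 i3 + b * g2 0 i3) ^+ 2 = (p * q) ^+ 2 *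
    (g1 0 i1 * g1 0 i1 + g1 0 i2 * g1 0 i2 + g1 0 i3 * g1 0 i3)
    + 2 * (b * p * q) * (g1 0 i1 * g2 0 i1 + g1 0 i2 * g2 0 i2 + g1 0 i3 * g2 0 i3)
    + b ^+ 2 * (g2 0 i1 * g2 0 i1 + g2 0 i2 * g2 0 i2 + g2 0 i3 * g2 0 i3) by ring.
  by rewrite e1 e2 e3; lra.
congr pair; rewrite dotpE !mxE/= ?h0 ?hC.
  rewrite aE; transitivity (C * zf (C * p) + (p * q) *
    (g1 0 i1 * g1 0 i1 + g1 0 i2 * g1 0 i2 + g1 0 i3 * g1 0 i3)
    + b * (g1 0 i1 * g2 0 i1 + g1 0 i2 * g2 0 i2 + g1 0 i3 * g2 0 i3)); first by ring.
  by rewrite e1 e3; ring.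
transitivity (p * q * (g1 0 i1 * g2 0 i1 + g1 0 i2 * g2 0 i2 + g1 0 i3 * g2 0 i3)
  + b * (g2 0 i1 * g2 0 i1 + g2 0 i2 * g2 0 i2 + g2 0 i3 * g2 0 i3)); first by ring.
by rewrite e2 e3; ring.
Qed.

End Area.

(** * The area integral *)

Section AreaFormula.
Context {R : realType}.
Notation vec := 'rV[R]_4.
Notation mu := (@lebesgue_measure R).
Notation R' := (measurableTypeR R).

Definition csq (p : R) : R := Num.sqrt (1 - p ^+ 2).

Lemma continuous_csq : continuous csq.
Proof.
move=> p; apply: (@continuous_comp _ _ _ (fun p : R => 1 - p ^+ 2) Num.sqrt).
  by apply: derivable_continuous => {}p; apply: ex_derive.
exact: sqrt_continuous.
Qed.

Definition I0 : R := (\int[mu]_(p in `[-1, 1]) csq p)%R.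

Lemma I0_gt0 : 0 < I0.
Proof.
have i1 : mu.-integrable `[-1, 1] (EFin \o csq).
  by apply: continuous_integrable_itv; exact: continuous_csq.
have i2 : mu.-integrable `[-1, 1] (EFin \o (fun p : R => 1 - p ^+ 2)).
  by apply: continuous_integrable_itv; apply: derivable_continuous => p; apply: ex_derive.
(* On this interval [csq p >= 1 - p^2], whose integral is 4/3. *)
apply: (@lt_le_trans _ _ (\int[mu]_(p in `[-1, 1]) (1 - p ^+ 2))%R); last first.
  apply: le_Rintegral => // p; rewrite /= in_itv/= => /andP[p1 p2].
  have h0 : 0 <= 1 - p ^+ 2 by nra.
  have h1 : 1 - p ^+ 2 <= 1 by have := sqr_ge0 p; lra.
  rewrite /csq -{1}(sqr_sqrtr h0) expr2 ler_piMr ?sqrtr_ge0//.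
  by rewrite -[leRHS]sqrtr1; exact: ler_wsqrtr.
rewrite /Rintegral (@continuous_FTC2 _ _ (fun p : R => p - p ^+ 3 / 3)) /=; first by lra.
- by lra.
- by apply: continuous_subspaceT; apply: derivable_continuous => p; apply: ex_derive.
- have d (p : R) : derivable (fun p : R => p - p ^+ 3 / 3) p 1 by apply: ex_derive.
  split=> [p _||]; first exact: d.
  + by apply: cvg_at_right_filter; exact: derivable_continuous d _.
  + by apply: cvg_at_left_filter; exact: derivable_continuous d _.
- move=> p _; rewrite derive1E; apply: derive_val.
  by apply: is_derive_eq; rewrite /GRing.scale/=; field.
Qed.

(** The primitive [(A p + B p^3) (1 - p^2)^(3/2)] vanishes at both ends. These two polynomials of
    mean zero for the semicircle weight reduce the area to a multiple of [I0], without evaluating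
    [I0]. *)
Lemma csq_moment (A B : R) :
  (\int[mu]_(p in `[(-1)%R, 1%R]) (csq p * (A * (1 - 4 * p ^+ 2) + B * (3 * p ^+ 2 - 6 * p ^+ 4)))%R%:E = 0)%E.
Proof.
pose F (p : R) : R := (A * p + B * p ^+ 3) * csq p ^+ 3.
have cF : continuous F.
  move=> p; apply: (_ : {for p, continuous F}); apply: ctsM; last first.
    by apply: ctsX; exact: continuous_csq.
  by apply: derivable_continuous => {}p; apply: ex_derive.
have F1 (p : R) : p ^+ 2 = 1 -> F p = 0 by move=> h; rewrite /F /csq h subrr sqrtr0 expr0n/= mulr0.
have dF (p : R) : -1 < p < 1 -> is_derive p (1 : R) F
    (csq p * (A * (1 - 4 * p ^+ 2) + B * (3 * p ^+ 2 - 6 * p ^+ 4))).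
  move=> /andP[p1 p2].
  have h0 : 0 < 1 - p ^+ 2 by nra.
  have dc : is_derive p (1 : R) csq (- p / csq p).
    have d1 : is_derive p (1 : R) (fun p : R => 1 - p ^+ 2) (- 2 * p).
      by apply: is_derive_eq; rewrite /GRing.scale/=; ring.
    have := @is_derive1_comp _ Num.sqrt (fun p : R => 1 - p ^+ 2) p _ _ (is_derive1_sqrt h0) d1.
    move=> d2; apply: (is_derive_eq d2); rewrite -/(csq p).
    have c0 : csq p != 0 by rewrite gt_eqF// sqrtr_gt0.
    by field.
  have c0 : csq p != 0 by rewrite gt_eqF// sqrtr_gt0.
  have c2 : csq p ^+ 2 = 1 - p ^+ 2 by rewrite sqr_sqrtr// ltW.
  rewrite /F; apply: is_derive_eq; rewrite /GRing.scale/=.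
  transitivity (csq p * ((A + 3 * B * p ^+ 2) * csq p ^+ 2 - 3 * p * (A * p + B * p ^+ 3))); first by field.
  by rewrite c2; ring.
rewrite (@continuous_FTC2 _ _ F); first by rewrite !F1 ?subee// ?expr1n// sqrrN expr1n.
- by lra.
- apply: continuous_subspaceT => p.
  apply: (_ : {for p, continuous (fun p : R => csq p * (A * (1 - 4 * p ^+ 2) + B * (3 * p ^+ 2 - 6 * p ^+ 4)))}).
  apply: ctsM; first exact: continuous_csq.
  by apply: derivable_continuous => {}p; apply: ex_derive.
- split=> [p||].
  + by rewrite in_itv/= => /dF d; exact: ex_derive.
  + by apply: cvg_at_right_filter; exact: cF.
  + by apply: cvg_at_left_filter; exact: cF.
- by move=> p; rewrite in_itv/= => /dF d; rewrite derive1E; exact: derive_val.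
Qed.

Definition kap (t : R) : R := 31 + 14 * t - 14 * t ^+ 2.

(** Under [x = af p] the square root becomes [csq p * qf (C p)] and [dx = gpol C p / qf (C p) dp];
    the factors [qf] cancel, leaving [csq] times a polynomial. *)
Lemma subgraph_area (C : R) (C1 : C ^+ 2 <= 1) :
  (\int[mu]_x (2 * Num.sqrt (Gf C1 x))%R%:E = (2 * I0 * kap (C ^+ 2))%R%:E)%E.
Proof.
have af_le (p p' : R) : p <= p' -> af C p <= af C p'.
  by rewrite le_eqVlt => /predU1P[->//|/(af_lt C1)/ltW].
(* Outside this interval [|p| > 1], so [Gf] is negative and its square root is 0. *)
transitivity (\int[mu]_(x in `[af C (-1)%R, af C 1%R]) (2 * Num.sqrt (Gf C1 x))%R%:E)%E.
  rewrite [RHS]integral_mkcond; apply: eq_integral => x _.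
  rewrite patchE; case: ifPn => // /negP xI; congr EFin.
  rewrite ler0_sqrtr ?mulr0// /Gf pmulr_lle0 ?wpol_gt0// subr_le0 leNgt; apply/negP => h.
  apply: xI; rewrite inE/= in_itv/= -[x](pfK C1).
  have /andP[h1 h2] : -1 <= pf C1 x <= 1.
    rewrite -ler_norml -(@ler_pXn2r _ 2)// ?nnegrE// real_normK ?num_real// expr1n.
    exact: ltW.
  by rewrite !af_le.
have dafE : (af C)^`() = daf C.
  by apply/funext => p; rewrite derive1E; exact: (derive_val (is_derive := is_derive_af C p)).
have cdaf : continuous (daf C).
  move=> p; apply: (_ : {for p, continuous (daf C)}); apply: ctsM.
    by apply: derivable_continuous => {}p; rewrite /gpol /npol; apply: ex_derive.
  apply: ctsV; first exact: qf_neq0.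
  apply: (@cts_comp _ _ qf (fun p : R => C * p)); first exact: continuous_qf.
  by apply: derivable_continuous => {}p; apply: ex_derive.
have caf := is_derive1_continuous (is_derive_af C).
rewrite (@integration_by_substitution_increasing _ (af C) (fun x => 2 * Num.sqrt (Gf C1 x))); last first.
- apply: continuous_subspaceT => x.
  apply: (_ : {for x, continuous (fun x => 2 * Num.sqrt (Gf C1 x))}).
  apply: ctsM; first exact: cts_cst.
  by apply: (@cts_comp _ _ Num.sqrt (Gf C1)); [exact: sqrt_continuous | exact: continuous_Gf].
- split=> [p _||].
  + exact: (ex_derive (is_derive := is_derive_af C p)).
  + by apply: cvg_at_right_filter; exact: caf.
  + by apply: cvg_at_left_filter; exact: caf.
- by rewrite dafE; apply/cvg_ex; exists (daf C 1); apply: cvg_at_left_filter; exact: cdaf.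
- by rewrite dafE; apply/cvg_ex; exists (daf C (-1)); apply: cvg_at_right_filter; exact: cdaf.
- by rewrite dafE => p _; exact: cdaf.
- by move=> p p' _ _; exact: af_lt.
- by lra.
set t := C ^+ 2.
(* This is [csq p * (gpol C p - kap t)], decomposed along the two polynomials of mean zero. *)
pose M (p : R) := csq p * ((14 * t + 14 * t ^+ 2) * (1 - 4 * p ^+ 2) + (- 56 * t ^+ 2) * (3 * p ^+ 2 - 6 * p ^+ 4)).
have cM : continuous M.
  move=> p; apply: (_ : {for p, continuous M}); apply: ctsM; first exact: continuous_csq.
  by apply: derivable_continuous => {}p; apply: ex_derive.
transitivity (\int[mu]_(p in `[(-1)%R, 1%R]) ((2 * kap t)%R%:E * (csq p)%:E + 2%:E * (M p)%:E))%E.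
  apply: eq_integral => p; rewrite inE/= in_itv/= => /andP[p1 p2].
  rewrite -!EFinM -EFinD; congr EFin.
  rewrite -[LHS]/(2 * Num.sqrt (Gf C1 (af C p)) * derive1 (af C) p) dafE /Gf (afK C1).
  rewrite sqrtrM; last by nra.
  rewrite -/(csq p) -/(qf (C * p)) /daf.
  have q0 := qf_neq0 (C * p).
  have -> : 2 * (csq p * qf (C * p)) * (gpol C p / qf (C * p)) = 2 * csq p * gpol C p by field.
  by rewrite /M /gpol /kap /npol /t; ring.
have i1 : mu.-integrable `[-1, 1] (EFin \o csq).
  by apply: continuous_integrable_itv; exact: continuous_csq.
have i2 : mu.-integrable `[-1, 1] (EFin \o M) by exact: continuous_integrable_itv.
rewrite integralD//=; [|exact: integrableZl|exact: integrableZl].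
rewrite !integralZl// csq_moment mule0 adde0.
have -> : (\int[mu]_(x in `[(-1)%R, 1%R]) (csq x)%:E = I0%:E)%E.
  by rewrite /I0 /Rintegral fineK//; exact: integrable_fin_num.
by rewrite -EFinM; congr EFin; ring.
Qed.

End AreaFormula.

(** * Projection areas and self-duality *)

Section ProjectionArea.
Context {R : realType}.
Notation vec := 'rV[R]_4.
Notation R' := (measurableTypeR R).

Lemma coords_frame (P : 'M[R]_4) (f1 f2 x : vec) : onb P = frame f1 f2 ->
  coords P x = (dotp x f1, dotp x f2).
Proof. by move=> E; rewrite /coords E; congr pair; rewrite dotpE mxE sum4 !mxE. Qed.

Lemma projmx00 (f1 f2 : vec) :
  (f1^T *m f1 + f2^T *m f2) i0 i0 = f1 0 i0 ^+ 2 + f2 0 i0 ^+ 2.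
Proof. by rewrite !mxE !big_ord_recl !big_ord0 !mxE !addr0 !expr2. Qed.

Lemma align_axis (a b : R) : exists c s : R,
  [/\ c ^+ 2 + s ^+ 2 = 1, 0 <= c, c * b - s * a = 0 & (c * a + s * b) ^+ 2 = a ^+ 2 + b ^+ 2].
Proof.
(* The cosine [a / r] must be non-negative for [lebesgue2_rot]. Changing the sign of [(a, b)]
   affects neither the orthogonality nor the squared cosine. *)
wlog a0 : a b / 0 <= a => [h|].
  have [/h//|a0] := leP 0 a.
  have [|c [s [h1 h2 h3 h4]]] := h (- a) (- b); first by lra.
  exists c, s; split=> //; first by lra.
  by move: h4; rewrite !mulrN -opprD !sqrrN.
have [r0|r0] := eqVneq (a ^+ 2 + b ^+ 2) 0.
  have a20 : a = 0 by have := sqr_ge0 a; have := sqr_ge0 b => ? ?; apply/eqP; rewrite -sqrf_eq0; apply/eqP; lra.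
  have b20 : b = 0 by have := sqr_ge0 a; have := sqr_ge0 b => ? ?; apply/eqP; rewrite -sqrf_eq0; apply/eqP; lra.
  by exists 1, 0; rewrite a20 b20; split; try ring; rewrite ler01.
have rp : 0 < a ^+ 2 + b ^+ 2 by rewrite lt_def r0 addr_ge0// sqr_ge0.
pose r := Num.sqrt (a ^+ 2 + b ^+ 2).
have rr : 0 < r by rewrite sqrtr_gt0.
have r2 : r ^+ 2 = a ^+ 2 + b ^+ 2 by rewrite sqr_sqrtr// ltW.
have rn : r != 0 by rewrite gt_eqF.
exists (a / r), (b / r); split.
- by rewrite !expr_div_n -mulrDl -r2 divff// expf_neq0.
- by rewrite divr_ge0// ltW.
- by field.
- have -> : a / r * a + b / r * b = (a ^+ 2 + b ^+ 2) / r by field.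
  by rewrite -r2; field.
Qed.

Lemma vol2proj_Kbody (F : 'M[R]_4) : Gr24 F ->
  vol2proj F (@Kbody R) = (2 * I0 * kap (F i0 i0))%:E.
Proof.
move=> GF; have [f1 [f2 [oE [h1 h2 h3] FE]]] := onb_frame GF.
rewrite [in RHS]FE projmx00.
(* The basis [onb F] is an arbitrary choice; it is rotated within [F] until its second vector is
   orthogonal to the axis. *)
have [c [s [cs c0 b0 C2]]] := align_axis (f1 0 i0) (f2 0 i0).
pose g1 := c *: f1 + s *: f2; pose g2 := c *: f2 - s *: f1.
have bil (a b a' b' : R) : dotp (a *: f1 + b *: f2) (a' *: f1 + b' *: f2) = a * a' + b * b'.
  transitivity (a * a' * dotp f1 f1 + b * b' * dotp f2 f2 + (a * b' + b * a') * dotp f1 f2).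
    by rewrite !dotpE !mxE; ring.
  by rewrite h1 h2 h3; ring.
have g2E : g2 = - s *: f1 + c *: f2 by rewrite /g2 addrC scaleNr.
have k1 : dotp g1 g1 = 1 by rewrite bil -cs; ring.
have k2 : dotp g2 g2 = 1 by rewrite g2E bil -cs; ring.
have k3 : dotp g1 g2 = 0 by rewrite g2E bil; ring.
pose C := c * f1 0 i0 + s * f2 0 i0.
have g1C : g1 0 i0 = C by rewrite !mxE.
have g20 : g2 0 i0 = 0 by rewrite !mxE -[RHS]b0; ring.
have C1 : C ^+ 2 <= 1.
  rewrite -k1 dotpE g1C -!expr2.
  by have := sqr_ge0 (g1 0 i1); have := sqr_ge0 (g1 0 i2); have := sqr_ge0 (g1 0 i3); lra.
have S := projection_subgraph C1 k1 k2 k3 g1C g20.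
have mS : measurable ([set p : R' * R' | p.2 ^+ 2 <= Gf C1 p.1]).
  by apply: measurable_subgraph; apply: continuous_measurable_fun; exact: continuous_Gf.
rewrite /vol2proj.
have -> : coords F @` (@Kbody R) = rot2 c (- s) @^-1` [set p : R' * R' | p.2 ^+ 2 <= Gf C1 p.1].
  rewrite -S; apply/seteqP; split=> [_ [x Kx <-]|[a b] [x Kx]] /=.
    exists x => //; rewrite (coords_frame x oE) /rot2/=; congr pair.
      by rewrite /g1 !dotpE !mxE; ring.
    by rewrite /g2 !dotpE !mxE; ring.
  rewrite /rot2/= => -[e1 e2]; exists x => //; rewrite (coords_frame x oE).
  have d1 : dotp x g1 = c * dotp x f1 + s * dotp x f2 by rewrite /g1 !dotpE !mxE; ring.
  have d2 : dotp x g2 = c * dotp x f2 - s * dotp x f1 by rewrite /g2 !dotpE !mxE; ring.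
  rewrite d1 d2 in e1 e2.
  congr pair.
    transitivity ((c ^+ 2 + s ^+ 2) * dotp x f1); first by rewrite cs mul1r.
    transitivity (c * (c * dotp x f1 + s * dotp x f2) - s * (c * dotp x f2 - s * dotp x f1)); first by ring.
    by rewrite e1 e2; transitivity ((c ^+ 2 + s ^+ 2) * a); [ring | rewrite cs mul1r].
  transitivity ((c ^+ 2 + s ^+ 2) * dotp x f2); first by rewrite cs mul1r.
  transitivity (s * (c * dotp x f1 + s * dotp x f2) + c * (c * dotp x f2 - s * dotp x f1)); first by ring.
  by rewrite e1 e2; transitivity ((c ^+ 2 + s ^+ 2) * b); [ring | rewrite cs mul1r].
rewrite lebesgue2_rot ?sqrrN// lebesgue2_subgraph; last by apply: continuous_measurable_fun; exact: continuous_Gf.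
by rewrite subgraph_area C2.
Qed.

Lemma Kbody_proj_body2 : proj_body2 (@Kbody R) (@Kbody R).
Proof.
split; first exact: Kbody_osym.
split; first exact: Kbody_osym.
move=> E GE; rewrite !vol2proj_Kbody//; last exact: Gr24_compl.
by congr (_ * _)%:E; rewrite !mxE/= /kap; ring.
Qed.

Lemma Kbody_in_P4s2 : in_P4s2 (@Kbody R).
Proof.
move=> e e0; exists (@Kbody R), (@Kbody R); split; first exact: Kbody_proj_body2.
have h (x : vec) : enorm (x - x) <= e by rewrite subrr /enorm dotp0l sqrtr0 ltW.
by split=> x Kx; exists x.
Qed.

End ProjectionArea.

(** * Averages over the sphere *)

Section Expectation.
Context {d : measure_display} {T : measurableType d} {R : realType}.
Variable P : probability T R.
Implicit Types (f g : T -> R) (c : R).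

(** Bounded measurable functions are integrable for every probability and closed under products, so
    [Ex] can be handled as a real linear functional. *)
Definition bmf g := measurable_fun setT g /\ exists M, forall x, `|g x| <= M.

Lemma bmf_cst c : bmf (fun=> c).
Proof. by split; [exact: measurable_cst | exists `|c|]. Qed.

Lemma bmfD f g : bmf f -> bmf g -> bmf (fun x => f x + g x).
Proof.
move=> [mf [M fM]] [mg [N gN]]; split; first exact: measurable_funD.
by exists (M + N) => x; rewrite (le_trans (ler_normD _ _))// lerD.
Qed.

Lemma bmfM f g : bmf f -> bmf g -> bmf (fun x => f x * g x).
Proof.
move=> [mf [M fM]] [mg [N gN]]; split; first exact: measurable_funM.
by exists (M * N) => x; rewrite normrM ler_pM.
Qed.

Lemma bmfZ c f : bmf f -> bmf (fun x => c * f x).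
Proof. by move=> bf; apply: bmfM => //; exact: bmf_cst. Qed.

Lemma bmfX f n : bmf f -> bmf (fun x => f x ^+ n).
Proof.
move=> bf; elim: n => [|n IH]; first exact: bmf_cst.
have -> : (fun x => f x ^+ n.+1) = (fun x => f x * f x ^+ n).
  by apply/funext => x; rewrite exprS.
exact: bmfM.
Qed.

Lemma bmf_norm f : bmf f -> bmf (fun x => `|f x|).
Proof.
move=> [mf [M fM]]; split; first exact: measurableT_comp.
by exists M => x; rewrite normr_id.
Qed.

Lemma bmf_sum n (F : 'I_n -> T -> R) : (forall i, bmf (F i)) -> bmf (fun x => \sum_i F i x).
Proof.
elim: n F => [|n IH] F bF.
  have -> : (fun x => \sum_i F i x) = (fun=> 0) by apply/funext => x; rewrite big_ord0.
  exact: bmf_cst.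
have -> : (fun x => \sum_i F i x) = (fun x => F ord0 x + \sum_i F (lift ord0 i) x).
  by apply/funext => x; rewrite big_ord_recl.
by apply: bmfD => //; exact: IH.
Qed.

Lemma bmf_horner (p : {poly R}) f : bmf f -> bmf (fun x => p.[f x]).
Proof.
move=> bf; have -> : (fun x => p.[f x]) = (fun x => \sum_(i < size p) p`_i * f x ^+ i).
  by apply/funext => x; rewrite horner_coef.
by apply: bmf_sum => i; apply: bmfZ; exact: bmfX.
Qed.

Lemma bmf_integrable f : bmf f -> P.-integrable setT (EFin \o f).
Proof.
move=> [mf [M fM]]; apply: measurable_bounded_integrable => //.
  exact: (fin_num_fun_lty (fin_num_measure P)).
by exists M; split; [exact: num_real | move=> N MN x _; exact: le_trans (fM x) (ltW MN)].
Qed.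

Definition Ex f : R := fine (\int[P]_x (f x)%:E)%E.

Lemma EFin_Ex f : bmf f -> (Ex f)%:E = (\int[P]_x (f x)%:E)%E.
Proof. by move=> bf; rewrite fineK//; apply: integrable_fin_num => //; exact: bmf_integrable. Qed.

Lemma eq_Ex f g : f =1 g -> Ex f = Ex g.
Proof. by move=> fg; congr Ex; apply/funext. Qed.

Lemma Ex_cst c : Ex (fun=> c) = c.
Proof.
rewrite /Ex integral_cst//= [X in (_ * X)%E](_ : _ = 1%E) ?mule1//.
exact: (@probability_setT _ _ _ P).
Qed.

Lemma ExD f g : bmf f -> bmf g -> Ex (fun x => f x + g x) = Ex f + Ex g.
Proof.
move=> bf bg; apply: EFin_inj; rewrite EFinD !EFin_Ex//; last exact: bmfD.
rewrite -integralD//; exact: bmf_integrable.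
Qed.

Lemma ExZ c f : bmf f -> Ex (fun x => c * f x) = c * Ex f.
Proof.
move=> bf; apply: EFin_inj; rewrite EFinM !EFin_Ex//; last exact: bmfZ.
rewrite -integralZl//; exact: bmf_integrable.
Qed.

Lemma Ex_lin5 c0 c1 c2 c3 c4 f0 f1 f2 f3 f4 : bmf f0 -> bmf f1 -> bmf f2 -> bmf f3 -> bmf f4 ->
  Ex (fun z => c0 * f0 z + c1 * f1 z + c2 * f2 z + c3 * f3 z + c4 * f4 z) =
  c0 * Ex f0 + c1 * Ex f1 + c2 * Ex f2 + c3 * Ex f3 + c4 * Ex f4.
Proof.
move=> b0 b1 b2 b3 b4.
by rewrite !ExD ?ExZ//; do ![apply: bmfD | apply: bmfZ | done].
Qed.

Lemma Ex_sum n (F : 'I_n -> T -> R) : (forall i, bmf (F i)) ->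
  Ex (fun x => \sum_i F i x) = \sum_i Ex (F i).
Proof.
elim: n F => [|n IH] F bF.
  rewrite big_ord0; rewrite -[RHS](Ex_cst 0); apply: eq_Ex => x; rewrite big_ord0//.
rewrite big_ord_recl -IH// -ExD//; last exact: bmf_sum.
by apply: eq_Ex => x; rewrite big_ord_recl.
Qed.

Lemma Ex_ge0 f : (forall x, 0 <= f x) -> 0 <= Ex f.
Proof. by move=> f0; apply/fine_ge0/integral_ge0 => x _; rewrite lee_fin. Qed.

Lemma Ex_dist f g c : bmf f -> bmf g -> (forall x, `|f x - g x| <= c) ->
  `|Ex f - Ex g| <= c.
Proof.
move=> bf bg fg.
have h f1 g1 : bmf f1 -> bmf g1 -> (forall x, `|f1 x - g1 x| <= c) -> Ex f1 - Ex g1 <= c.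
  move=> b1 b2 h; rewrite -subr_ge0.
  have -> : c - (Ex f1 - Ex g1) = Ex (fun x => g1 x + (-1 * f1 x + c)).
    rewrite ExD ?ExD ?ExZ ?Ex_cst//; [ring|exact: bmfZ|exact: bmf_cst|].
    by apply: bmfD; [exact: bmfZ|exact: bmf_cst].
  apply: Ex_ge0 => x.
  by have := h x; rewrite ler_norml => /andP[]; lra.
have := h f g bf bg fg.
have := h g f bg bf (fun x => ltac:(rewrite distrC; exact: fg)).
by rewrite ler_norml => ? ?; apply/andP; lra.
Qed.

End Expectation.

Section ProductExpectation.
Context {d1 d2 : measure_display} {T1 : measurableType d1} {T2 : measurableType d2} {R : realType}.
Variables (P1 : probability T1 R) (P2 : probability T2 R).

Lemma bmf_fst (f : T1 -> R) : bmf f -> bmf (fun z : T1 * T2 => f z.1).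
Proof. by move=> [mf [M fM]]; split; [exact: measurableT_comp | exists M]. Qed.

Lemma bmf_snd (f : T2 -> R) : bmf f -> bmf (fun z : T1 * T2 => f z.2).
Proof. by move=> [mf [M fM]]; split; [exact: measurableT_comp | exists M]. Qed.

Lemma Ex_prod (f : T1 -> R) (g : T2 -> R) : bmf f -> bmf g ->
  Ex (P1 \x P2)%E (fun z => f z.1 * g z.2) = Ex P1 f * Ex P2 g.
Proof.
move=> bf bg.
have b12 : bmf (fun z : T1 * T2 => f z.1 * g z.2).
  by apply: bmfM; [exact: bmf_fst | exact: bmf_snd].
have i12 : (P1 \x P2)%E.-integrable setT (EFin \o (fun z : T1 * T2 => f z.1 * g z.2)).
  exact: bmf_integrable.
apply: EFin_inj; rewrite EFin_Ex// -(integral12_prod_meas1 i12) /fubini_F/=.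
under eq_integral do under eq_integral do rewrite EFinM.
under eq_integral => x _ do rewrite integralZl ?bmf_integrable// -EFin_Ex// muleC.
by rewrite integralZl ?bmf_integrable// -EFin_Ex// -EFinM mulrC.
Qed.

End ProductExpectation.

(** * Uniform laws on an interval and on the circle *)

Section Uniform.
Context {R : realType}.
Notation mu := (@lebesgue_measure R).
Notation R' := (measurableTypeR R).

Lemma Ex_uniform (a b : R) (ab : a < b) (g : R' -> R) : bmf g ->
  Ex (uniform_prob ab) g = (b - a)^-1 * (\int[mu]_(x in `[a, b]) g x)%R.
Proof.
move=> bg; have [mg [M gM]] := bg.
have lab : (mu `[a, b]%classic < +oo)%E.
  by rewrite lebesgue_measure_itv/= lte_fin ab -EFinB ltry.
have iab (f : R' -> R) : bmf f -> mu.-integrable `[a, b] (EFin \o f).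
  move=> [mf [N fN]]; apply: measurable_bounded_integrable => //.
  - exact: measurable_funTS.
  - exists N; split; [exact: num_real | move=> K NK x _; exact: le_trans (fN x) (ltW NK)].
have fE (f : R' -> R) : bmf f -> (forall x, 0 <= f x) ->
    Ex (uniform_prob ab) f = (b - a)^-1 * (\int[mu]_(x in `[a, b]) f x)%R.
  move=> bf f0; apply: EFin_inj; rewrite EFin_Ex// integral_uniform; last 2 first.
  - by apply/measurable_EFinP; case: bf.
  - by move=> x; rewrite lee_fin.
  by rewrite EFinM /Rintegral fineK//; apply: integrable_fin_num => //; exact: iab.
(* The formula [fE] holds for non-negative functions; it is applied to [g + M] and to the constant
   [M], and the results are subtracted. *)
have M0 : 0 <= M := le_trans (normr_ge0 _) (gM 0).
have bM := @bmf_cst _ R' R M.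
have := fE (fun x => g x + M) (bmfD bg bM) (fun x => ltac:(have := gM x; rewrite ler_norml => /andP[]; lra)).
rewrite ExD// RintegralD//; [|exact: iab|exact: iab].
have := fE (fun=> M) bM (fun=> M0).
by rewrite mulrDr => -> /addIr.
Qed.

Lemma Rintegral_FTC (f F : R -> R) (a b : R) : a < b -> continuous f ->
  (forall x, is_derive x (1 : R) F (f x)) ->
  (\int[mu]_(x in `[a, b]) f x)%R = F b - F a.
Proof.
move=> ab cf dF; have cF := is_derive1_continuous dF.
rewrite /Rintegral (@continuous_FTC2 _ _ F)//.
- exact: continuous_subspaceT.
- split=> [x _||].
  + exact: (ex_derive (is_derive := dF x)).
  + by apply: cvg_at_right_filter; exact: cF.
  + by apply: cvg_at_left_filter; exact: cF.
- by move=> x _; rewrite derive1E; exact: (derive_val (is_derive := dF x)).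
Qed.

Lemma Ex_uniform_FTC (a b : R) (ab : a < b) (g : R' -> R) (f F : R -> R) : bmf g ->
  (forall x, a <= x <= b -> g x = f x) -> continuous f ->
  (forall x, is_derive x (1 : R) F (f x)) ->
  Ex (uniform_prob ab) g = (b - a)^-1 * (F b - F a).
Proof.
move=> bg gf cf dF; rewrite Ex_uniform//; congr (_ * _).
rewrite -(Rintegral_FTC ab cf dF); apply: eq_Rintegral => x.
by rewrite inE/= in_itv/=; exact: gf.
Qed.

Lemma ltN11 : -1 < 1 :> R. Proof. lra. Qed.
Lemma lt02pi : 0 < pi *+ 2 :> R. Proof. by rewrite pmulrn_lgt0// pi_gt0. Qed.

Definition UA : probability R' R := uniform_prob ltN11.
Definition UC : probability R' R := uniform_prob lt02pi.

(* Truncation makes the coordinate bounded on the whole line, where [UA] lives. *)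
Definition clip (a : R') : R := Num.max (-1) (Num.min a 1).

Lemma clip_id a : -1 <= a <= 1 -> clip a = a.
Proof. by move=> /andP[h1 h2]; rewrite /clip min_l// max_r. Qed.

Lemma clip_itv a : -1 <= clip a <= 1.
Proof. by rewrite /clip le_max lexx/= ge_max ge_min lexx orbT andbT; lra. Qed.

Lemma bmf_clip : bmf clip.
Proof.
split; last by exists 1 => a; rewrite ler_norml clip_itv.
apply: measurable_maxr; first exact: measurable_cst.
by apply: measurable_minr; [exact: measurable_id | exact: measurable_cst].
Qed.

Lemma bmf_clip_cts (g : R -> R) : continuous g -> bmf (fun a => g (clip a)).
Proof.
move=> cg; split.
  apply: (@measurableT_comp _ _ _ R' R' R' g); first exact: continuous_measurable_fun.
  by case: bmf_clip.
have [M [_ hM]] := compact_bounded (continuous_compact (continuous_subspaceT cg) (@segment_compact R (-1) 1)).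
exists (M + 1) => a; apply: hM; first by rewrite ltrDl.
by exists (clip a) => //=; rewrite in_itv/= clip_itv.
Qed.

Lemma bmf_cos : bmf (@cos R : R' -> R).
Proof.
split; first by apply: continuous_measurable_fun; exact: continuous_cos.
by exists 1 => x; rewrite ler_norml cos_geN1 cos_le1.
Qed.

Lemma bmf_sin : bmf (@sin R : R' -> R).
Proof.
split; first by apply: continuous_measurable_fun; exact: continuous_sin.
by exists 1 => x; rewrite ler_norml sin_geN1 sin_le1.
Qed.

Definition wave (v1 v2 x : R) : R := v1 * cos x + v2 * sin x.

Lemma bmf_wave v1 v2 : bmf (wave v1 v2 : R' -> R).
Proof. by apply: bmfD; apply: bmfZ; [exact: bmf_cos | exact: bmf_sin]. Qed.

Lemma wave2 v1 v2 x : wave v1 v2 x ^+ 2 + wave v2 (- v1) x ^+ 2 = v1 ^+ 2 + v2 ^+ 2.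
Proof.
transitivity ((v1 ^+ 2 + v2 ^+ 2) * (cos x ^+ 2 + sin x ^+ 2)); first by rewrite /wave; ring.
by rewrite cos2Dsin2 mulr1.
Qed.

Lemma is_derive_wave v1 v2 (x : R) : is_derive x (1 : R) (wave v1 v2) (wave v2 (- v1) x).
Proof. by rewrite /wave; apply: is_derive_eq; rewrite /GRing.scale/=; ring. Qed.

(** The derivative of [wave^(n+1) wave'] integrates to 0 over a period, and
    [wave'^2 = v1^2 + v2^2 - wave^2]. *)
Lemma wave_moment v1 v2 n :
  n.+2%:R * Ex UC (fun x => wave v1 v2 x ^+ n.+2) =
  n.+1%:R * (v1 ^+ 2 + v2 ^+ 2) * Ex UC (fun x => wave v1 v2 x ^+ n).
Proof.
pose r := v1 ^+ 2 + v2 ^+ 2.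
pose f (x : R) := n.+1%:R * r * wave v1 v2 x ^+ n + - n.+2%:R * wave v1 v2 x ^+ n.+2.
have b k := bmfX k (bmf_wave v1 v2).
have bf : bmf (f : R' -> R) by apply: bmfD; apply: bmfZ.
have dF (x : R) : is_derive x (1 : R) (fun x => wave v1 v2 x ^+ n.+1 * wave v2 (- v1) x) (f x).
  have d1 := is_derive_wave v1 v2 x; have d2 := is_derive_wave v2 (- v1) x.
  have d3 := is_deriveM (is_derive_pow n.+1 d1) d2.
  apply: (is_derive_eq d3); rewrite /GRing.scale/= /f /r -(wave2 v1 v2 x).
  have -> : wave (- v1) (- v2) x = - wave v1 v2 x by rewrite /wave; ring.
  by rewrite !exprS -!natr1; ring.
have cf : continuous f.
  apply: derivable_continuous => x.
  have d1 := is_derive_pow n (is_derive_wave v1 v2 x).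
  have d2 := is_derive_pow n.+2 (is_derive_wave v1 v2 x).
  exact: (ex_derive (is_derive := is_deriveD (is_deriveZ _ d1) (is_deriveZ _ d2))).
have := Ex_uniform_FTC lt02pi bf (fun x _ => erefl) cf dF.
rewrite -/UC ExD; [|exact: bmfZ|exact: bmfZ].
rewrite !ExZ//.
have -> : wave v1 v2 (pi *+ 2) = wave v1 v2 0 by rewrite /wave cos2pi sin2pi cos0 sin0.
have -> : wave v2 (- v1) (pi *+ 2) = wave v2 (- v1) 0 by rewrite /wave cos2pi sin2pi cos0 sin0.
rewrite subrr mulr0 -/r; lra.
Qed.

Lemma wave_moment0 v1 v2 : Ex UC (fun x => wave v1 v2 x ^+ 0) = 1.
Proof. by rewrite -[RHS](Ex_cst UC 1); apply: eq_Ex => x; rewrite expr0. Qed.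

Lemma wave_moment1 v1 v2 : Ex UC (fun x => wave v1 v2 x ^+ 1) = 0.
Proof.
have b := bmf_wave v1 v2.
have cf : continuous (wave v1 v2).
  by apply: derivable_continuous => x; have := is_derive_wave v1 v2 x => ?; apply: ex_derive.
have dF (x : R) : is_derive x (1 : R) (wave (- v2) v1) (wave v1 v2 x).
  by rewrite -[v2 in wave v1 v2 x]opprK; exact: is_derive_wave.
rewrite (@Ex_uniform_FTC _ _ lt02pi _ _ _ (bmfX 1 b) (fun x _ => expr1 _) cf dF).
by rewrite /wave cos2pi sin2pi cos0 sin0 subrr mulr0.
Qed.

(** The Wallis ratio: the mean of [cos^(2n)] over the circle. *)
Fixpoint cmom (n : nat) : R := if n is n'.+1 then (2 * n'%:R + 1) / (2 * n'%:R + 2) * cmom n' else 1.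

Lemma wave_moment_even v1 v2 n :
  Ex UC (fun x => wave v1 v2 x ^+ n.*2) = cmom n * (v1 ^+ 2 + v2 ^+ 2) ^+ n.
Proof.
elim: n => [|n IH]; first by rewrite double0 wave_moment0 !mul1r.
have := wave_moment v1 v2 n.*2; rewrite doubleS IH => h.
have n0 : n.*2.+2%:R != 0 :> R by rewrite pnatr_eq0.
have e : n.*2%:R = 2 * n%:R :> R by rewrite -muln2 natrM mulrC.
have e1 : n.*2.+1%:R = 2 * n%:R + 1 :> R by rewrite -addn1 natrD e.
have e2 : n.*2.+2%:R = 2 * n%:R + 2 :> R by rewrite -addn2 natrD e.
apply: (mulfI n0); rewrite h /= [(_ + _) ^+ n.+1]exprS e1 e2.
move: (cmom n) (_ ^+ n) => c w.
have n1 : 2 * n%:R + 2 != 0 :> R by rewrite gt_eqF// ltr_wpDl// mulr_ge0.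
by field; rewrite n1.
Qed.

Lemma wave_moment_odd v1 v2 n : Ex UC (fun x => wave v1 v2 x ^+ n.*2.+1) = 0.
Proof.
elim: n => [|n IH]; first exact: wave_moment1.
have := wave_moment v1 v2 n.*2.+1; rewrite doubleS IH mulr0 => /eqP.
by rewrite mulf_eq0 pnatr_eq0 => /eqP.
Qed.

End Uniform.

(** * The uniform law on the sphere and its moments *)

Section Sphere.
Context {R : realType}.
Notation R' := (measurableTypeR R).
Notation R3 := (R * R * R)%type.

Definition d3 (u v : R3) : R := u.1.1 * v.1.1 + u.1.2 * v.1.2 + u.2 * v.2.

(* Archimedes: height and longitude are independent and uniform. *)
Definition sphP : probability (R' * R')%type R := (@UA R \x @UC R)%E.

Definition srad (a : R') : R := Num.sqrt (1 - clip a ^+ 2).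
Definition sphX (z : R' * R') : R3 := (srad z.1 * cos z.2, srad z.1 * sin z.2, clip z.1).

Lemma clip_sqr_le1 (a : R) : 0 <= 1 - clip a ^+ 2.
Proof. by have /andP[] := clip_itv a; nra. Qed.

Lemma srad_sqr (a : R) : srad a ^+ 2 = 1 - clip a ^+ 2.
Proof. by rewrite sqr_sqrtr// clip_sqr_le1. Qed.

Lemma bmf_srad : bmf srad.
Proof.
apply: (@bmf_clip_cts _ (fun x => Num.sqrt (1 - x ^+ 2))) => x.
apply: (@continuous_comp _ _ _ (fun p : R => 1 - p ^+ 2) Num.sqrt).
  by apply: derivable_continuous => p; apply: ex_derive.
exact: sqrt_continuous.
Qed.

Lemma sphX1 z : d3 (sphX z) (sphX z) = 1.
Proof.
rewrite /d3/=; transitivity (srad z.1 ^+ 2 * (cos z.2 ^+ 2 + sin z.2 ^+ 2) + clip z.1 ^+ 2); first by ring.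
by rewrite cos2Dsin2 srad_sqr; ring.
Qed.

Lemma linE v z : d3 v (sphX z) = v.2 * clip z.1 + srad z.1 * wave v.1.1 v.1.2 z.2.
Proof. by rewrite /d3/= /wave; ring. Qed.

Lemma bmf_lin v : bmf (fun z => d3 v (sphX z)).
Proof.
have -> : (fun z => d3 v (sphX z)) = (fun z => v.2 * clip z.1 + srad z.1 * wave v.1.1 v.1.2 z.2).
  by apply/funext => z; rewrite linE.
apply: bmfD; first by apply: bmfZ; apply: bmf_fst; exact: bmf_clip.
by apply: bmfM; [apply: bmf_fst; exact: bmf_srad | apply: bmf_snd; exact: bmf_wave].
Qed.

Definition amom (n i : nat) : R := Ex UA (fun a => clip a ^+ n * (1 - clip a ^+ 2) ^+ i).

Lemma bmf_amom n i : bmf (fun a : R' => clip a ^+ n * (1 - clip a ^+ 2) ^+ i : R).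
Proof.
apply: bmfM; apply: bmfX; first exact: bmf_clip.
apply: (@bmf_clip_cts _ (fun x => 1 - x ^+ 2)).
by apply: derivable_continuous => p; apply: ex_derive.
Qed.

Lemma is_derive_amom n i (x : R) : is_derive x (1 : R) (fun x => x ^+ n * (1 - x ^+ 2) ^+ i)
  (x ^+ n * (i%:R * (1 - x ^+ 2) ^+ i.-1 * (- 2 * x)) + (1 - x ^+ 2) ^+ i * (n%:R * x ^+ n.-1)).
Proof.
have d1 : is_derive x (1 : R) (fun x : R => 1 - x ^+ 2) (- 2 * x).
  by apply: is_derive_eq; rewrite /GRing.scale/=; ring.
have d := is_deriveM (is_derive_pow n (is_derive_id x 1)) (is_derive_pow i d1).
by apply: (is_derive_eq d); rewrite /GRing.scale/= mulr1.
Qed.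

(** The function [x^(n+1) (1 - x^2)^(i+1)] vanishes at both ends, so its derivative has mean 0. *)
Lemma amom_rec n i : n.+1%:R * amom n i.+1 = 2 * i.+1%:R * amom n.+2 i.
Proof.
have b1 := bmf_amom n i.+1; have b2 := bmf_amom n.+2 i.
have bf : bmf (fun a : R' => n.+1%:R * (clip a ^+ n * (1 - clip a ^+ 2) ^+ i.+1)
   + - (2 * i.+1%:R) * (clip a ^+ n.+2 * (1 - clip a ^+ 2) ^+ i) : R).
  by apply: bmfD; apply: bmfZ.
pose f (x : R) := x ^+ n.+1 * (i.+1%:R * (1 - x ^+ 2) ^+ i * (- 2 * x)) + (1 - x ^+ 2) ^+ i.+1 * (n.+1%:R * x ^+ n).
have dF (x : R) := is_derive_amom n.+1 i.+1 x.
have cf : continuous f.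
  have -> : f = (fun x => n.+1%:R * (x ^+ n * (1 - x ^+ 2) ^+ i.+1)
    + - (2 * i.+1%:R) * (x ^+ n.+2 * (1 - x ^+ 2) ^+ i)).
    by apply/funext => x; rewrite /f [x ^+ n.+2]exprS [x ^+ n.+1]exprS; ring.
  apply: derivable_continuous => x.
  exact: (ex_derive (is_derive := is_deriveD (is_deriveZ _ (is_derive_amom n i.+1 x)) (is_deriveZ _ (is_derive_amom n.+2 i x)))).
have gf (x : R) : -1 <= x <= 1 -> n.+1%:R * (clip x ^+ n * (1 - clip x ^+ 2) ^+ i.+1)
   + - (2 * i.+1%:R) * (clip x ^+ n.+2 * (1 - clip x ^+ 2) ^+ i) = f x.
  by move=> hx; rewrite clip_id// /f [x ^+ n.+2]exprS [x ^+ n.+1]exprS; ring.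
have := Ex_uniform_FTC ltN11 bf gf cf dF.
rewrite -/UA ExD ?ExZ//; [|exact: bmfZ|exact: bmfZ].
rewrite -/(amom n i.+1) -/(amom n.+2 i) => h.
apply/eqP; rewrite -subr_eq0 -mulNr h.
by rewrite sqrrN !expr1n subrr expr0n/= !mulr0 subrr mulr0.
Qed.

Lemma amom0 n : amom n 0 = (~~ odd n)%:R / n.+1%:R.
Proof.
have b := bmf_amom n 0.
have n0 : n.+1%:R != 0 :> R by rewrite pnatr_eq0.
have dF (x : R) : is_derive x (1 : R) (fun x => n.+1%:R^-1 * x ^+ n.+1) (x ^+ n).
  apply: (is_derive_eq (is_deriveZ n.+1%:R^-1 (is_derive_pow n.+1 (is_derive_id x 1)))).
  by rewrite /GRing.scale/= mulr1 mulKf.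
have cf : continuous (fun x : R => x ^+ n).
  apply: derivable_continuous => x.
  exact: (ex_derive (is_derive := is_derive_pow n (is_derive_id x 1))).
have gf (x : R) : -1 <= x <= 1 -> clip x ^+ n * (1 - clip x ^+ 2) ^+ 0 = x ^+ n.
  by move=> hx; rewrite clip_id// expr0 mulr1.
rewrite /amom (Ex_uniform_FTC ltN11 b gf cf dF) expr1n exprS -signr_odd.
by case: (odd n); rewrite ?expr0 ?expr1/=; field.
Qed.

Lemma amom_odd n i : odd n -> amom n i = 0.
Proof.
elim: i n => [|i IH] n on; first by rewrite amom0 on mul0r.
have := amom_rec n i; rewrite IH//= ?negbK// mulr0 => /eqP.
by rewrite mulf_eq0 pnatr_eq0 => /eqP.
Qed.

(** By this identity the moment of order [2m] of [v.X] reassembles as the binomial expansion of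
    [(v_3^2 + (v_1^2 + v_2^2))^m / (2m + 1)], and so depends only on the length of [v]. *)
Lemma binomial_amom m i : (i <= m)%N ->
  'C(m.*2, i.*2)%:R * cmom i * amom (m - i).*2 i = 'C(m, i)%:R / (2 * m%:R + 1) :> R.
Proof.
elim: i => [|i IH] im.
  rewrite double0 !bin0 subn0 amom0 odd_double/= !mul1r.
  by congr (_^-1); rewrite -addn1 natrD -muln2 natrM mulrC.
have {}IH := IH (ltnW im).
pose k := (m - i.+1)%N.
have mi : (m - i = k.+1)%N by rewrite /k; lia.
rewrite mi doubleS in IH; rewrite -/k.
have rec := amom_rec k.*2 i.
have b1 : (2 * i%:R + 1) * (2 * i%:R + 2) * 'C(m.*2, i.+1.*2)%:R =
    (2 * k%:R + 2) * (2 * k%:R + 1) * 'C(m.*2, i.*2)%:R :> R.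
  have h1 := mul_bin_left m.*2 i.*2; have h2 := mul_bin_left m.*2 i.*2.+1.
  have e1 : (m.*2 - i.*2 = (k.*2).+2)%N by rewrite /k; lia.
  have e2 : (m.*2 - i.*2.+1 = (k.*2).+1)%N by rewrite /k; lia.
  rewrite e1 in h1; rewrite e2 in h2.
  have c1 n : n.*2.+1%:R = 2 * n%:R + 1 :> R by rewrite -addn1 natrD -muln2 natrM mulrC.
  have c2 n : n.*2.+2%:R = 2 * n%:R + 2 :> R by rewrite -addn2 natrD -muln2 natrM mulrC.
  have g1 : (2 * i%:R + 1) * 'C(m.*2, i.*2.+1)%:R = (2 * k%:R + 2) * 'C(m.*2, i.*2)%:R :> R.
    by have := congr1 (fun n : nat => n%:R : R) h1; rewrite !natrM c1 c2.
  have g2 : (2 * i%:R + 2) * 'C(m.*2, i.*2.+2)%:R = (2 * k%:R + 1) * 'C(m.*2, i.*2.+1)%:R :> R.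
    by have := congr1 (fun n : nat => n%:R : R) h2; rewrite !natrM c1 c2.
  rewrite doubleS -mulrA g2 mulrCA g1; ring.
have b2 : (i%:R + 1) * 'C(m, i.+1)%:R = (k%:R + 1) * 'C(m, i)%:R :> R.
  have := congr1 (fun n : nat => n%:R : R) (mul_bin_left m i).
  by rewrite mi !natrM -!natr1.
have k1 : 2 * k%:R + 1 != 0 :> R by rewrite gt_eqF// ltr_wpDl// mulr_ge0.
have ii1 : i%:R + 1 != 0 :> R by rewrite gt_eqF// ltr_wpDl.
have i1 : 2 * i%:R + 1 != 0 :> R by rewrite gt_eqF// ltr_wpDl// mulr_ge0.
have i2 : 2 * i%:R + 2 != 0 :> R by rewrite gt_eqF// ltr_wpDl// mulr_ge0.
have ek : k.*2.+1%:R = 2 * k%:R + 1 :> R by rewrite -addn1 natrD -muln2 natrM mulrC.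
rewrite ek -natr1 in rec.
have aE : amom k.*2 i.+1 = 2 * (i%:R + 1) / (2 * k%:R + 1) * amom k.*2.+2 i.
  by apply: (mulfI k1); rewrite rec; field.
have cE : 'C(m.*2, i.+1.*2)%:R = (2 * k%:R + 2) * (2 * k%:R + 1) / ((2 * i%:R + 1) * (2 * i%:R + 2)) * 'C(m.*2, i.*2)%:R :> R.
  by apply: (mulfI (mulf_neq0 i1 i2)); rewrite b1; field; rewrite i1 i2.
have dE : 'C(m, i.+1)%:R = (k%:R + 1) / (i%:R + 1) * 'C(m, i)%:R :> R.
  by apply: (mulfI ii1); rewrite b2; field.
rewrite dE -[RHS]mulrA -IH aE cE /=.
by move: ('C(_, _)%:R) (cmom i) (amom _ _) => A B D; field; rewrite ii1 i1 i2 k1.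
Qed.

End Sphere.

Section SphereMoments.
Context {R : realType}.
Notation R' := (measurableTypeR R).
Notation R3 := (R * R * R)%type.
Implicit Types v : R3.

Lemma srad_pow_even (a : R) i : srad a ^+ i.*2 = (1 - clip a ^+ 2) ^+ i.
Proof. by rewrite -mul2n exprM srad_sqr. Qed.

Lemma Ex_lin_pow v N : Ex sphP (fun z => d3 v (sphX z) ^+ N) =
  \sum_(j < N.+1) 'C(N, j)%:R * v.2 ^+ (N - j) *
    (Ex UA (fun a => clip a ^+ (N - j) * srad a ^+ j) * Ex UC (fun x => wave v.1.1 v.1.2 x ^+ j)).
Proof.
have bA j : bmf (fun a : R' => clip a ^+ (N - j) * srad a ^+ j : R).
  by apply: bmfM; apply: bmfX; [exact: bmf_clip | exact: bmf_srad].
have bC j : bmf (fun x : R' => wave v.1.1 v.1.2 x ^+ j : R) by apply: bmfX; exact: bmf_wave.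
pose F (j : 'I_N.+1) (z : R' * R') : R := 'C(N, j)%:R * v.2 ^+ (N - j) *
  ((clip z.1 ^+ (N - j) * srad z.1 ^+ j) * wave v.1.1 v.1.2 z.2 ^+ j).
have bP j : bmf (fun z : R' * R' => (clip z.1 ^+ (N - j) * srad z.1 ^+ j) * wave v.1.1 v.1.2 z.2 ^+ j : R).
  by apply: bmfM; [exact: (bmf_fst (bA j)) | exact: (bmf_snd (bC j))].
have bF j : bmf (F j) by apply: bmfZ; exact: bP.
transitivity (Ex sphP (fun z => \sum_j F j z)).
  apply: eq_Ex => z; rewrite linE exprDn; apply: eq_bigr => j _.
  by rewrite /F -mulr_natl !exprMn; ring.
rewrite Ex_sum//; apply: eq_bigr => j _.
rewrite /F ExZ//; congr (_ * _).
exact: (Ex_prod UA UC (bA j) (bC j)).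
Qed.

Lemma sum_even (F : nat -> R) m : (forall i, F i.*2.+1 = 0) ->
  \sum_(j < m.*2.+1) F j = \sum_(i < m.+1) F i.*2.
Proof.
move=> F0; elim: m => [|m IH]; first by rewrite !big_ord1.
by rewrite doubleS 2!big_ord_recr IH [in RHS]big_ord_recr/= F0 addr0.
Qed.

Lemma sphere_moment_even v m :
  Ex sphP (fun z => d3 v (sphX z) ^+ m.*2) = d3 v v ^+ m / (2 * m%:R + 1).
Proof.
rewrite Ex_lin_pow (@sum_even (fun j => 'C(m.*2, j)%:R * v.2 ^+ (m.*2 - j) *
    (Ex UA (fun a => clip a ^+ (m.*2 - j) * srad a ^+ j) * Ex UC (fun x => wave v.1.1 v.1.2 x ^+ j)))); last first.
  by move=> i; rewrite wave_moment_odd !mulr0.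
have -> : d3 v v = v.2 ^+ 2 + (v.1.1 ^+ 2 + v.1.2 ^+ 2) by rewrite /d3; ring.
rewrite exprDn mulr_suml; apply: eq_bigr => i _.
have im : (i <= m)%N by rewrite -ltnS.
rewrite wave_moment_even -doubleB.
have -> : Ex UA (fun a => clip a ^+ (m - i).*2 * srad a ^+ i.*2) = amom (m - i).*2 i :> R.
  by rewrite /amom; congr Ex; apply/funext => a; rewrite srad_pow_even.
have := @binomial_amom R _ _ im => h.
rewrite -mulr_natl -exprM mul2n.
transitivity ('C(m.*2, i.*2)%:R * cmom i * amom (m - i).*2 i *
  (v.2 ^+ (m - i).*2 * (v.1.1 ^+ 2 + v.1.2 ^+ 2) ^+ i)); first by ring.
by rewrite h; ring.
Qed.

Lemma sphere_moment_odd v m : Ex sphP (fun z => d3 v (sphX z) ^+ m.*2.+1) = 0.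
Proof.
rewrite Ex_lin_pow big1// => -[j jm] _ /=.
have [oj|ej] := boolP (odd j).
  by rewrite -(odd_double_half j) oj add1n wave_moment_odd !mulr0.
have -> : Ex UA (fun a => clip a ^+ (m.*2.+1 - j) * srad a ^+ j) = amom (m.*2.+1 - j) j./2 :> R.
  by rewrite /amom; congr Ex; apply/funext => a; rewrite -[in srad a ^+ j](even_halfK ej) srad_pow_even.
by rewrite amom_odd ?mul0r ?mulr0// oddB// /= odd_double (negbTE ej).
Qed.

(** The law [sphP] is defined in coordinates; its rotation invariance is only ever used through
    moments, starting from this one. *)
Lemma sphere_moment_inv v v' N : d3 v v = d3 v' v' ->
  Ex sphP (fun z => d3 v (sphX z) ^+ N) = Ex sphP (fun z => d3 v' (sphX z) ^+ N).
Proof.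
move=> vv; rewrite -(odd_double_half N); case: (odd N).
  by rewrite add1n !sphere_moment_odd.
by rewrite add0n !sphere_moment_even vv.
Qed.

Lemma poly_eq_horner (p q : {poly R}) : (forall x, p.[x] = q.[x]) -> p = q.
Proof.
move=> pq; apply/eqP; rewrite -subr_eq0; apply/eqP.
apply: (@roots_geq_poly_eq0 _ _ [seq i%:R | i <- iota 0 (size (p - q))]).
- by apply/allP => _ /mapP[i _ ->]; rewrite /root hornerD hornerN pq subrr.
- by rewrite map_inj_uniq ?iota_uniq// => i j /eqP; rewrite eqr_nat => /eqP.
- by rewrite size_map size_iota.
Qed.

(* Polarization: comparing the coefficients of [b ^+ m] in the moments of
   [x + b e] shows that mixed moments only depend on the angle of [x] and [e]. *)
Lemma sphere_mixed_inv (x e x' e' : R3) n m :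
  d3 x x = d3 x' x' -> d3 e e = d3 e' e' -> d3 x e = d3 x' e' ->
  Ex sphP (fun z => d3 x (sphX z) ^+ n * d3 e (sphX z) ^+ m) =
  Ex sphP (fun z => d3 x' (sphX z) ^+ n * d3 e' (sphX z) ^+ m).
Proof.
move=> xx ee xe.
pose N := (n + m)%N.
pose c (x e : R3) j := Ex sphP (fun z => d3 x (sphX z) ^+ (N - j) * d3 e (sphX z) ^+ j).
pose p x e := \poly_(j < N.+1) ('C(N, j)%:R * c x e j).
pose comb (x e : R3) b : R3 := (x.1.1 + b * e.1.1, x.1.2 + b * e.1.2, x.2 + b * e.2).
have pE x1 e1 b : (p x1 e1).[b] = Ex sphP (fun z => d3 (comb x1 e1 b) (sphX z) ^+ N).
  rewrite horner_poly.
  have bb j : bmf (fun z => d3 x1 (sphX z) ^+ (N - j) * d3 e1 (sphX z) ^+ j).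
    by apply: bmfM; apply: bmfX; exact: bmf_lin.
  transitivity (Ex sphP (fun z => \sum_(j < N.+1) ('C(N, j)%:R * b ^+ j) * (d3 x1 (sphX z) ^+ (N - j) * d3 e1 (sphX z) ^+ j))).
    rewrite Ex_sum; last by move=> j; exact: bmfZ.
    by apply: eq_bigr => j _; rewrite ExZ// /c; ring.
  apply: eq_Ex => z.
  have -> : d3 (comb x1 e1 b) (sphX z) = d3 x1 (sphX z) + b * d3 e1 (sphX z) by rewrite /d3/=; ring.
  by rewrite exprDn; apply: eq_bigr => j _; rewrite -mulr_natl exprMn; ring.
have pp : p x e = p x' e'.
  apply: poly_eq_horner => b; rewrite !pE; apply: sphere_moment_inv.
  have cc x1 e1 : d3 (comb x1 e1 b) (comb x1 e1 b) = d3 x1 x1 + 2 * b * d3 x1 e1 + b ^+ 2 * d3 e1 e1.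
    by rewrite /d3/=; ring.
  by rewrite !cc xx ee xe.
have := congr1 (fun q : {poly R} => q`_m) pp.
rewrite !coef_poly ltnS leq_addl => /mulfI; rewrite /c /N addnK; apply.
by rewrite pnatr_eq0 -lt0n bin_gt0 leq_addl.
Qed.

End SphereMoments.

(** * The cosine transform of Legendre polynomials *)

Section FunkHecke.
Context {R : realType}.
Notation R' := (measurableTypeR R).
Notation R3 := (R * R * R)%type.

(** The iteration [p + (x^2 - p^2) / 2] increases to [|x|] on [[-1, 1]]. It is rescaled to radius 2
    because it will be used at [x.X + s] with both terms at most 1 in absolute value. *)
Lemma weierstrass_abs (e : R) : 0 < e ->
  exists Q : {poly R}, forall v, `|v| <= 2 -> `| `|v| - Q.[v] | <= e.
Proof.
move=> e0.
pose fix p (n : nat) : {poly R} := if n is n'.+1 then p n' + 2^-1 *: ('X ^+ 2 - p n' ^+ 2) else 0.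
have pS n x : (p n.+1).[x] = (p n).[x] + 2^-1 * (x ^+ 2 - (p n).[x] ^+ 2).
  by rewrite /= !hornerE.
(* Each step multiplies the error by [1 - (|x| + p) / 2]. The product form of the bound amounts to
   an error of at most [2 / n], uniformly in [x], and avoids a division at [x = 0]. *)
have key (x : R) n : `|x| <= 1 -> 0 <= `|x| - (p n).[x] /\ 0 <= (p n).[x] /\
    (`|x| - (p n).[x]) * (1 + n%:R * `|x| / 2) <= `|x|.
  move=> x1; elim: n => [|n [d0 [p0 IH]]].
    by rewrite horner0 subr0 mul0r mul0r addr0 mulr1; split=> //; split.
  rewrite pS; move: ((p n).[x]) d0 p0 IH => q d0 p0 IH.
  have t0 : 0 <= `|x| by [].
  have -> : x ^+ 2 = `|x| ^+ 2 by rewrite real_normK ?num_real.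
  move: (`|x|) t0 x1 d0 IH => t t0 x1 d0 IH.
  have n0 : 0 <= n%:R :> R by [].
  rewrite -[n.+1%:R]natr1; move: (n%:R) n0 IH => N N0 IH.
  have dE : t - (q + 2^-1 * (t ^+ 2 - q ^+ 2)) = (t - q) * (1 - (t + q) / 2) by field.
  have f0 : 0 <= 1 - (t + q) / 2 by lra.
  split; first by rewrite dE mulr_ge0.
  split; first by rewrite addr_ge0// mulr_ge0// subr_ge0; nra.
  rewrite dE.
  apply: (@le_trans _ _ ((t - q) * (1 + N * t / 2))) => //.
  rewrite -mulrA ler_wpM2l//.
  have Nt : 0 <= N * t by rewrite mulr_ge0.
  have tq : 0 <= t * q by rewrite mulr_ge0.
  have h1 : 0 <= N * t * t by rewrite mulr_ge0.
  have h2 : 0 <= N * t * q by rewrite mulr_ge0.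
  have h3 : 0 <= t * t by rewrite mulr_ge0.
  rewrite -subr_ge0.
  have -> : 1 + N * t / 2 - (1 - (t + q) / 2) * (1 + (N + 1) * t / 2) =
    q / 2 + (N * t * t + N * t * q + t * t + t * q) / 4 by field.
  by lra.
have [n nE] : exists n : nat, 4 / e <= n%:R.
  exists (Num.Def.truncn (4 / e)).+1; apply/ltW/truncnS_gt.
have n0 : 0 < n%:R :> R by rewrite (lt_le_trans _ nE)// divr_gt0.
exists (2 *: (p n \Po (2^-1 *: 'X))) => v v2.
rewrite hornerZ horner_comp hornerZ hornerX.
have -> : 2^-1 * v = v / 2 by rewrite mulrC.
set x := v / 2.
have vE : `|v| = 2 * `|x| by rewrite /x normrM [`|2^-1|]ger0_norm ?invr_ge0// mulrC divfK.
have x1 : `|x| <= 1 by move: v2; rewrite vE; lra.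
have [d0 [_ h]] := key x n x1.
rewrite vE -mulrBr normrM (ger0_norm d0) ger0_norm//.
have [x0|x0] := eqVneq `|x| 0.
  have dx : `|x| - (p n).[x] <= 0 by move: h; rewrite x0 mulr0 mul0r addr0 mulr1.
  by lra.
have xp : 0 < `|x| by rewrite lt_def x0 normr_ge0.
have h2 : (`|x| - (p n).[x]) * (n%:R / 2) <= 1.
  rewrite -(ler_pM2r xp) mul1r (le_trans _ h)//.
  rewrite -[leLHS]mulrA ler_wpM2l//; lra.
have : (`|x| - (p n).[x]) * (2 / e) <= 1.
  by rewrite (le_trans _ h2)// ler_wpM2l//; move: nE; lra.
by rewrite mulrA ler_pdivrMr// mul1r mulrC.
Qed.

(* The average over the rotations about [x] of [(e.X)^(2h)], where [xi = x.e] and [a = x.X]. *)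
Definition zon (h : nat) (xi a : R) : R := \sum_(i < h.+1)
  'C(h.*2, i.*2)%:R * (xi * a) ^+ (h - i).*2 * (cmom i * ((1 - xi ^+ 2) * (1 - a ^+ 2)) ^+ i).

Lemma zonal_mono (g : {poly R}) (x e : R3) h : d3 x x = 1 -> d3 e e = 1 ->
  Ex sphP (fun z => g.[d3 x (sphX z)] * d3 e (sphX z) ^+ h.*2) =
  Ex UA (fun a => g.[clip a] * zon h (d3 x e) (clip a)).
Proof.
move=> xx ee; set xi := d3 x e.
have xi1 : 0 <= 1 - xi ^+ 2.
  have : 0 <= d3 (x.1.1 - xi * e.1.1, x.1.2 - xi * e.1.2, x.2 - xi * e.2)
                 (x.1.1 - xi * e.1.1, x.1.2 - xi * e.1.2, x.2 - xi * e.2).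
    by rewrite /d3/= -!expr2 !addr_ge0// sqr_ge0.
  congr (_ <= _).
  transitivity (d3 x x - 2 * xi * d3 x e + xi ^+ 2 * d3 e e); first by rewrite /d3/=; ring.
  by rewrite xx ee -/xi; ring.
pose eta := Num.sqrt (1 - xi ^+ 2).
have eta2 : eta ^+ 2 = 1 - xi ^+ 2 by rewrite sqr_sqrtr.
pose x0 : R3 := (0, 0, 1); pose e0 : R3 := (eta, 0, xi).
have x00 : d3 x0 x0 = 1 by rewrite /d3/=; ring.
have e00 : d3 e0 e0 = 1 by rewrite /d3/=; transitivity (eta ^+ 2 + xi ^+ 2); [ring|rewrite eta2; ring].
have x0e0 : d3 x0 e0 = xi by rewrite /d3/=; ring.
transitivity (Ex sphP (fun z => g.[d3 x0 (sphX z)] * d3 e0 (sphX z) ^+ h.*2)).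
  have ex y f : Ex sphP (fun z => g.[d3 y (sphX z)] * d3 f (sphX z) ^+ h.*2) =
      \sum_(i < size g) g`_i * Ex sphP (fun z => d3 y (sphX z) ^+ i * d3 f (sphX z) ^+ h.*2).
    have bb (i : nat) : bmf (fun z => d3 y (sphX z) ^+ i * d3 f (sphX z) ^+ h.*2).
      by apply: bmfM; apply: bmfX; exact: bmf_lin.
    transitivity (Ex sphP (fun z => \sum_(i < size g) g`_i * (d3 y (sphX z) ^+ i * d3 f (sphX z) ^+ h.*2))).
      apply: eq_Ex => z; rewrite horner_coef mulr_suml.
      by apply: eq_bigr => i _; rewrite mulrA.
    rewrite Ex_sum; last by move=> i; exact: bmfZ.
    by apply: eq_bigr => i _; rewrite ExZ.
  rewrite !ex; apply: eq_bigr => i _; congr (_ * _).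
  by apply: sphere_mixed_inv; rewrite ?xx ?x00 ?ee ?e00 ?x0e0.
have bg : bmf (fun a : R' => g.[clip a] : R) by apply: bmf_horner; exact: bmf_clip.
have bA (j : nat) : bmf (fun a : R' => g.[clip a] * ((xi * clip a) ^+ (h.*2 - j) * srad a ^+ j) : R).
  apply: bmfM => //; apply: bmfM; apply: bmfX; last exact: bmf_srad.
  by apply: bmfZ; exact: bmf_clip.
have bC (j : nat) : bmf (fun x : R' => wave eta 0 x ^+ j : R) by apply: bmfX; exact: bmf_wave.
have bAC (j : nat) : bmf (fun z : R' * R' => g.[clip z.1] * ((xi * clip z.1) ^+ (h.*2 - j) * srad z.1 ^+ j) * wave eta 0 z.2 ^+ j : R).
  by apply: bmfM; [exact: (bmf_fst (bA j)) | exact: (bmf_snd (bC j))].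
transitivity (Ex sphP (fun z => \sum_(j < h.*2.+1) 'C(h.*2, j)%:R *
   (g.[clip z.1] * ((xi * clip z.1) ^+ (h.*2 - j) * srad z.1 ^+ j) * wave eta 0 z.2 ^+ j))).
  apply: eq_Ex => z; rewrite !linE/= /wave !mul0r addr0 mul1r mulr0 addr0 exprDn mulr_sumr.
  by apply: eq_bigr => j _; rewrite -mulr_natl !exprMn; ring.
rewrite Ex_sum; last by move=> j; exact: bmfZ.
transitivity (\sum_(j < h.*2.+1) 'C(h.*2, j)%:R * (Ex UA (fun a => g.[clip a] * ((xi * clip a) ^+ (h.*2 - j) * srad a ^+ j)) *
    Ex UC (fun x => wave eta 0 x ^+ j))).
  by apply: eq_bigr => j _; rewrite ExZ// (Ex_prod UA UC (bA j) (bC j)).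
rewrite (@sum_even _ (fun j => 'C(h.*2, j)%:R * (Ex UA (fun a => g.[clip a] * ((xi * clip a) ^+ (h.*2 - j) * srad a ^+ j)) *
    Ex UC (fun x => wave eta 0 x ^+ j)))); last by move=> i; rewrite wave_moment_odd !mulr0.
transitivity (Ex UA (fun a => \sum_(i < h.+1) ('C(h.*2, i.*2)%:R * (cmom i * (1 - xi ^+ 2) ^+ i)) *
   (g.[clip a] * ((xi * clip a) ^+ (h.*2 - i.*2) * srad a ^+ i.*2)))).
  rewrite Ex_sum; last by move=> i; apply: bmfZ; exact: (bA i.*2).
  apply: eq_bigr => i _; rewrite ExZ; last exact: (bA i.*2).
  by rewrite wave_moment_even expr0n/= addr0 eta2; ring.
apply: eq_Ex => a; rewrite /zon mulr_sumr; apply: eq_bigr => i _.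
by rewrite srad_pow_even -doubleB [((1 - xi ^+ 2) * _) ^+ i]exprMn; ring.
Qed.

Definition evp (c : R * R * R * R * R) (x : R) : R :=
  let: (c0, c1, c2, c3, c4) := c in
  c0 + c1 * x ^+ 2 + c2 * x ^+ 4 + c3 * x ^+ 6 + c4 * x ^+ 8.

(** The characteristic identity of a Legendre polynomial [P]: the average of [P(e.X)] over the
    rotations about [x] is [P(x.e) P(x.X)]. The degree-zero part of the addition theorem, it is
    checked on coefficients. *)
Definition zonal (c : R * R * R * R * R) := forall xi a : R,
  let: (c0, c1, c2, c3, c4) := c in
  c0 * zon 0 xi a + c1 * zon 1 xi a + c2 * zon 2 xi a + c3 * zon 3 xi a + c4 * zon 4 xi a
  = evp c a * evp c xi.

Lemma continuous_evp c : continuous (evp c).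
Proof.
by move: c => [[[[c0 c1] c2] c3] c4]; apply: derivable_continuous => x; rewrite /evp; apply: ex_derive.
Qed.

Lemma bmf_evp_gen d (T : measurableType d) (f : T -> R) c : bmf f -> bmf (fun z => evp c (f z)).
Proof.
move: c => [[[[c0 c1] c2] c3] c4] bf; rewrite /evp.
by do ![apply: bmfD]; first (exact: bmf_cst); apply: bmfZ; exact: bmfX.
Qed.

Lemma funk_hecke_poly (g : {poly R}) (x e : R3) c : zonal c -> d3 x x = 1 -> d3 e e = 1 ->
  Ex sphP (fun z => g.[d3 x (sphX z)] * evp c (d3 e (sphX z))) =
  evp c (d3 x e) * Ex UA (fun a => g.[clip a] * evp c (clip a)).
Proof.
move=> zc xx ee.
have bg : bmf (fun a : R' => g.[clip a] : R) by apply: bmf_horner; exact: bmf_clip.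
rewrite -ExZ; last by apply: bmfM => //; apply: bmf_evp_gen; exact: bmf_clip.
move: c zc => [[[[c0 c1] c2] c3] c4] zc.
have bX (h : nat) : bmf (fun z => g.[d3 x (sphX z)] * d3 e (sphX z) ^+ h.*2).
  by apply: bmfM; [apply: bmf_horner; exact: bmf_lin | apply: bmfX; exact: bmf_lin].
have bz (h : nat) : bmf (fun a : R' => g.[clip a] * zon h (d3 x e) (clip a) : R).
  apply: bmfM => //; rewrite /zon; apply: bmf_sum => i.
  have c0' : continuous (fun a : R => (1 - d3 x e ^+ 2) * (1 - a ^+ 2)).
    by apply: derivable_continuous => a; apply: ex_derive.
  apply: bmfM; apply: bmfZ; last by apply: bmfX; exact: (bmf_clip_cts c0').
  by apply: bmfX; apply: bmfZ; exact: bmf_clip.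
transitivity (Ex sphP (fun z => c0 * (g.[d3 x (sphX z)] * d3 e (sphX z) ^+ 0.*2)
  + c1 * (g.[d3 x (sphX z)] * d3 e (sphX z) ^+ 1.*2) + c2 * (g.[d3 x (sphX z)] * d3 e (sphX z) ^+ 2.*2)
  + c3 * (g.[d3 x (sphX z)] * d3 e (sphX z) ^+ 3.*2) + c4 * (g.[d3 x (sphX z)] * d3 e (sphX z) ^+ 4.*2))).
  by apply: eq_Ex => z; rewrite /evp/=; ring.
rewrite (Ex_lin5 _ _ _ _ _ _ (bX 0%N) (bX 1%N) (bX 2%N) (bX 3%N) (bX 4%N)) !zonal_mono//.
rewrite -(Ex_lin5 _ _ _ _ _ _ (bz 0%N) (bz 1%N) (bz 2%N) (bz 3%N) (bz 4%N)).
apply: eq_Ex => a; have := zc (d3 x e) (clip a).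
move: (evp _ (clip a)) (evp _ (d3 x e)) => A B /= h.
by transitivity (g.[clip a] * (A * B)); [rewrite -h; ring | ring].
Qed.

Lemma d3_sph_le (x : R3) z : d3 x x = 1 -> `|d3 x (sphX z)| <= 1.
Proof.
move=> xx; have h := sphX1 z; move: (sphX z) h => y yy.
have : 0 <= d3 (x.1.1 - d3 x y * y.1.1, x.1.2 - d3 x y * y.1.2, x.2 - d3 x y * y.2)
               (x.1.1 - d3 x y * y.1.1, x.1.2 - d3 x y * y.1.2, x.2 - d3 x y * y.2).
  by rewrite /d3/= -!expr2 !addr_ge0// sqr_ge0.
have -> : d3 (x.1.1 - d3 x y * y.1.1, x.1.2 - d3 x y * y.1.2, x.2 - d3 x y * y.2)
               (x.1.1 - d3 x y * y.1.1, x.1.2 - d3 x y * y.1.2, x.2 - d3 x y * y.2) = 1 - d3 x y ^+ 2.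
  transitivity (d3 x x - 2 * d3 x y * d3 x y + d3 x y ^+ 2 * d3 y y).
    by rewrite /d3/=; ring.
  by rewrite xx yy; ring.
rewrite subr_ge0 => h.
by rewrite -(@ler_pXn2r _ 2)// ?nnegrE// real_normK ?num_real// expr1n.
Qed.

(** Both sides are continuous in the kernel for the uniform norm, so the polynomial case passes to
    [|. + s|] by approximation. *)
Lemma funk_hecke_abs (s : R) (x e : R3) c : zonal c -> d3 x x = 1 -> d3 e e = 1 -> `|s| <= 1 ->
  Ex sphP (fun z => `|d3 x (sphX z) + s| * evp c (d3 e (sphX z))) =
  evp c (d3 x e) * Ex UA (fun a => `|clip a + s| * evp c (clip a)).
Proof.
move=> zc xx ee s1.
have bL : bmf (fun z => evp c (d3 e (sphX z))) by apply: bmf_evp_gen; exact: bmf_lin.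
have bLa : bmf (fun a : R' => evp c (clip a) : R) by apply: bmf_evp_gen; exact: bmf_clip.
have [_ [M1 hM1]] := bL; have [_ [M2 hM2]] := bLa.
have bax : bmf (fun z => `|d3 x (sphX z) + s|).
  by apply: bmf_norm; apply: bmfD; [exact: bmf_lin | exact: bmf_cst].
have baa : bmf (fun a : R' => `|clip a + s| : R).
  by apply: bmf_norm; apply: bmfD; [exact: bmf_clip | exact: bmf_cst].
have M10 : 0 <= M1 := le_trans (normr_ge0 _) (hM1 (0, 0)).
have M20 : 0 <= M2 := le_trans (normr_ge0 _) (hM2 0).
(* A uniform error [delta] in the kernel moves the two sides by at most [delta K] together; dividing
   by [K + 1] below keeps the denominator positive. *)
pose K := M1 + `|evp c (d3 x e)| * M2.
have K0 : 0 <= K by rewrite addr_ge0// mulr_ge0.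
apply/eqP; rewrite -subr_eq0 -normr_le0; apply/ler_addgt0Pl => eps eps0; rewrite addr0.
have e'0 : 0 < eps / (K + 1) by rewrite divr_gt0//; lra.
have [Q hQ] := weierstrass_abs e'0.
pose g := Q \Po ('X + s%:P).
have gE u : g.[u] = Q.[u + s] by rewrite horner_comp !hornerE.
have FH := funk_hecke_poly g zc xx ee.
have d1 : `|Ex sphP (fun z => `|d3 x (sphX z) + s| * evp c (d3 e (sphX z))) -
    Ex sphP (fun z => g.[d3 x (sphX z)] * evp c (d3 e (sphX z)))| <= eps / (K + 1) * M1.
  apply: Ex_dist; [exact: bmfM| |].
    by apply: bmfM => //; apply: bmf_horner; exact: bmf_lin.
  move=> z; rewrite -mulrBl normrM gE ler_pM//.
  by apply: hQ; rewrite (le_trans (ler_normD _ _))//; have := d3_sph_le z xx; lra.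
have d2 : `|Ex UA (fun a => `|clip a + s| * evp c (clip a)) -
    Ex UA (fun a => g.[clip a] * evp c (clip a))| <= eps / (K + 1) * M2.
  apply: Ex_dist; [exact: bmfM| |].
    by apply: bmfM => //; apply: bmf_horner; exact: bmf_clip.
  move=> z; rewrite -mulrBl normrM gE ler_pM//.
  by apply: hQ; rewrite (le_trans (ler_normD _ _))//; have := clip_itv z; rewrite -ler_norml; lra.
rewrite FH in d1.
set A := Ex sphP _ in d1 *; set C := Ex UA (fun a => g.[clip a] * _) in d1 d2.
set D := Ex UA _ in d2 *.
have -> : A - evp c (d3 x e) * D = (A - evp c (d3 x e) * C) - evp c (d3 x e) * (D - C) by ring.
rewrite (le_trans (ler_normB _ _))// normrM.
apply: (@le_trans _ _ (eps / (K + 1) * M1 + `|evp c (d3 x e)| * (eps / (K + 1) * M2))).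
  by rewrite lerD// ler_wpM2l.
have -> : eps / (K + 1) * M1 + `|evp c (d3 x e)| * (eps / (K + 1) * M2) = eps / (K + 1) * K by rewrite /K; ring.
rewrite mulrAC ler_pdivrMr; last by lra.
by rewrite ler_pM2l//; lra.
Qed.

End FunkHecke.

Ltac compute_nats :=
  repeat match goal with
  | |- context [binomial ?n ?m] =>
    let v := eval vm_compute in (binomial n m) in change (binomial n m) with v
  | |- context [double ?n] =>
    let v := eval vm_compute in (double n) in change (double n) with v
  end.

(** * Even Legendre polynomials up to degree 8 *)

Section Legendre.
Context {R : realType}.
Notation mu := (@lebesgue_measure R).
Notation R' := (measurableTypeR R).
Notation R3 := (R * R * R)%type.
Notation R5 := (R * R * R * R * R)%type.
Notation R6 := (R * R * R * R * R * R)%type.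

Lemma Rintegral_FTC_le (f F : R -> R) (a b : R) : a <= b -> continuous f ->
  (forall x, is_derive x (1 : R) F (f x)) ->
  (\int[mu]_(x in `[a, b]) f x)%R = F b - F a.
Proof.
rewrite le_eqVlt => /predU1P[->|ab] cf dF; last exact: Rintegral_FTC.
by rewrite set_itv1 Rintegral_set1 subrr.
Qed.

Definition ev6 (c : R6) (x : R) : R :=
  let: (c0, c1, c2, c3, c4, c5) := c in
  c0 + c1 * x ^+ 2 + c2 * x ^+ 4 + c3 * x ^+ 6 + c4 * x ^+ 8 + c5 * x ^+ 10.

Definition primitive1 (c : R5) (x : R) : R := let: (c0, c1, c2, c3, c4) := c in
  c0 * x + c1 / 3 * x ^+ 3 + c2 / 5 * x ^+ 5 + c3 / 7 * x ^+ 7 + c4 / 9 * x ^+ 9.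

Definition primitive2 (c : R5) (x : R) : R := let: (c0, c1, c2, c3, c4) := c in
  c0 / 2 * x ^+ 2 + c1 / 12 * x ^+ 4 + c2 / 30 * x ^+ 6 + c3 / 56 * x ^+ 8 + c4 / 90 * x ^+ 10.

Lemma is_derive_primitive1 c x : is_derive x (1 : R) (primitive1 c) (evp c x).
Proof.
move: c => [[[[c0 c1] c2] c3] c4]; rewrite /primitive1 /evp.
by apply: is_derive_eq; rewrite /GRing.scale/=; field.
Qed.

Lemma is_derive_primitive2 c x : is_derive x (1 : R) (primitive2 c) (primitive1 c x).
Proof.
move: c => [[[[c0 c1] c2] c3] c4]; rewrite /primitive1 /primitive2.
by apply: is_derive_eq; rewrite /GRing.scale/=; field.
Qed.

(** Split at the kink [a = - s] and integrate by parts on each side. As [primitive1] is odd and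
    [primitive2] even, the only dependence on [s] that remains is [primitive2 c s]. *)
Lemma abs_moment (s : R) c : `|s| <= 1 ->
  Ex UA (fun a => `|clip a + s| * evp c (clip a)) =
  primitive2 c s + primitive1 c 1 - primitive2 c 1.
Proof.
move=> s1; have /andP[sl sr] : -1 <= s <= 1 by rewrite -ler_norml.
have ce := @continuous_evp _ c.
have cl : continuous (fun a : R => a + s) by apply: derivable_continuous => a; apply: ex_derive.
have cf : continuous (fun a => `|a + s| * evp c a).
  move=> a; apply: cvgM; last exact: ce.
  by apply: (@continuous_comp _ _ _ (fun a : R => a + s) Num.norm); [exact: cl | exact: norm_continuous].
have bg : bmf (fun a : R' => `|clip a + s| * evp c (clip a) : R) by exact: (bmf_clip_cts cf).
rewrite (Ex_uniform ltN11 bg).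
have -> : (\int[mu]_(x in `[(-1)%R, 1%R]) (`|clip x + s| * evp c (clip x)))%R =
    (\int[mu]_(x in `[(-1)%R, 1%R]) (`|x + s| * evp c x))%R.
  by apply: eq_Rintegral => x; rewrite inE/= in_itv/= => /clip_id ->.
rewrite (@Rintegral_itv_split _ _ _ (- s)) //; [|lra|lra].
pose H (x : R) := (x + s) * primitive1 c x - primitive2 c x.
have dH x : is_derive x (1 : R) H ((x + s) * evp c x).
  have d1 := is_derive_primitive1 c x; have d2 := is_derive_primitive2 c x.
  have d0 : is_derive x (1 : R) (fun x : R => x + s) 1.
    by apply: is_derive_eq; rewrite addr0.
  apply: (is_derive_eq (is_deriveB (is_deriveM d0 d1) d2)).
  by rewrite /GRing.scale/=; ring.
have cH : continuous (fun x => (x + s) * evp c x) by move=> x; apply: cvgM; [exact: cl | exact: ce].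
have dHN x : is_derive x (1 : R) (fun x => - H x) (- ((x + s) * evp c x)).
  by apply: (is_derive_eq (is_deriveN (dH x))).
have cHN : continuous (fun x => - ((x + s) * evp c x)) by move=> x; apply: cvgN; exact: cH.
have -> : (\int[mu]_(x in `[(-1)%R, (- s)%R]) (`|x + s| * evp c x))%R = - H (- s) - - H (-1).
  rewrite -(Rintegral_FTC_le _ cHN dHN); last by lra.
  apply: eq_Rintegral => x; rewrite inE/= in_itv/= => /andP[_ xs].
  by rewrite ler0_norm ?mulNr//; lra.
have -> : (\int[mu]_(x in `[(- s)%R, 1%R]) (`|x + s| * evp c x))%R = H 1 - H (- s).
  rewrite -(Rintegral_FTC_le _ cH dH); last by lra.
  apply: eq_Rintegral => x; rewrite inE/= in_itv/= => /andP[xs _].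
  by rewrite ger0_norm//; lra.
rewrite /H /primitive1 /primitive2; move: c {ce cf bg H dH cH dHN cHN} => [[[[c0 c1] c2] c3] c4].
by field.
Qed.

Definition ev6poly (c : R6) : {poly R} := let: (c0, c1, c2, c3, c4, c5) := c in
  c0%:P + c1 *: 'X^2 + c2 *: 'X^4 + c3 *: 'X^6 + c4 *: 'X^8 + c5 *: 'X^10.

Lemma ev6polyE c x : (ev6poly c).[x] = ev6 c x.
Proof. by move: c => [[[[[c0 c1] c2] c3] c4] c5]; rewrite /ev6poly /ev6 !hornerE; ring. Qed.

Lemma amom_even n : amom n.*2 0 = (n.*2.+1%:R)^-1 :> R.
Proof. by rewrite amom0 odd_double/= mul1r. Qed.

Lemma Ex_clip_poly n (c : nat -> R) :
  Ex UA (fun a => \sum_(i < n) c i * clip a ^+ i.*2) = \sum_(i < n) c i / i.*2.+1%:R.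
Proof.
rewrite Ex_sum; last by move=> i; apply: bmfZ; apply: bmfX; exact: bmf_clip.
apply: eq_bigr => i _; rewrite ExZ; last by apply: bmfX; exact: bmf_clip.
rewrite -amom_even /amom; congr (_ * _); apply: eq_Ex => a.
by rewrite expr0 mulr1.
Qed.

(* [c], [F], [b]: the coefficients of an even Legendre polynomial, those of its cosine
   transform [s |-> 1/2 int |a + s| P(a) da], and their scalar product. *)
Definition cos_mode (c : R5) (F : R6) (b : R) :=
  [/\ zonal c,
      forall s, `|s| <= 1 -> Ex UA (fun a => `|clip a + s| * evp c (clip a)) = ev6 F s &
      Ex UA (fun a => ev6 F (clip a) * evp c (clip a)) = b].

Lemma cos_mode_criterion c F b (k : nat -> R) : zonal c ->
  (forall s, primitive2 c s + primitive1 c 1 - primitive2 c 1 = ev6 F s) ->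
  (forall a, ev6 F a * evp c a = \sum_(i < 10) k i * a ^+ i.*2) ->
  \sum_(i < 10) k i / i.*2.+1%:R = b -> cos_mode c F b.
Proof.
move=> zc hF hk hb; split=> // [s s1|]; first by rewrite abs_moment.
by rewrite -hb -Ex_clip_poly; apply: eq_Ex => a; rewrite hk.
Qed.

Definition leg0 : R5 := (1, 0, 0, 0, 0).
Definition leg2 : R5 := (- (1 / 2), 3 / 2, 0, 0, 0).
Definition leg4 : R5 := (3 / 8, - (15 / 4), 35 / 8, 0, 0).
Definition leg6 : R5 := (- (5 / 16), 105 / 16, - (315 / 16), 231 / 16, 0).
Definition leg8 : R5 := (35 / 128, - (315 / 32), 3465 / 64, - (3003 / 32), 6435 / 128).

Definition cos0p : R6 := (1 / 2, 1 / 2, 0, 0, 0, 0).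
Definition cos2p : R6 := (1 / 8, - (1 / 4), 1 / 8, 0, 0, 0).
Definition cos4p : R6 := (- (1 / 48), 3 / 16, - (5 / 16), 7 / 48, 0, 0).
Definition cos6p : R6 := (1 / 128, - (5 / 32), 35 / 64, - (21 / 32), 33 / 128, 0).
Definition cos8p : R6 := (- (1 / 256), 35 / 256, - (105 / 128), 231 / 128, - (429 / 256), 143 / 256).

Lemma zon0 (xi a : R) : zon 0 xi a = 1.
Proof. by rewrite /zon big_ord1/= bin0 !expr0; ring. Qed.

Lemma zon1 (xi a : R) : zon 1 xi a = (xi * a) ^+ 2 + ((1 - xi ^+ 2) * (1 - a ^+ 2)) / 2.
Proof. by rewrite /zon !big_ord_recr big_ord0/=; compute_nats; field. Qed.

Lemma zon2 (xi a : R) : zon 2 xi a = (xi * a) ^+ 4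
  + 3 * (xi * a) ^+ 2 * ((1 - xi ^+ 2) * (1 - a ^+ 2))
  + 3 / 8 * ((1 - xi ^+ 2) * (1 - a ^+ 2)) ^+ 2.
Proof. by rewrite /zon !big_ord_recr big_ord0/=; compute_nats; field. Qed.

Lemma zon3 (xi a : R) : zon 3 xi a = (xi * a) ^+ 6
  + 15 / 2 * (xi * a) ^+ 4 * ((1 - xi ^+ 2) * (1 - a ^+ 2))
  + 45 / 8 * (xi * a) ^+ 2 * ((1 - xi ^+ 2) * (1 - a ^+ 2)) ^+ 2
  + 5 / 16 * ((1 - xi ^+ 2) * (1 - a ^+ 2)) ^+ 3.
Proof. by rewrite /zon !big_ord_recr big_ord0/=; compute_nats; field. Qed.

Lemma zon4 (xi a : R) : zon 4 xi a = (xi * a) ^+ 8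
  + 14 * (xi * a) ^+ 6 * ((1 - xi ^+ 2) * (1 - a ^+ 2))
  + 105 / 4 * (xi * a) ^+ 4 * ((1 - xi ^+ 2) * (1 - a ^+ 2)) ^+ 2
  + 35 / 4 * (xi * a) ^+ 2 * ((1 - xi ^+ 2) * (1 - a ^+ 2)) ^+ 3
  + 35 / 128 * ((1 - xi ^+ 2) * (1 - a ^+ 2)) ^+ 4.
Proof. by rewrite /zon !big_ord_recr big_ord0/=; compute_nats; field. Qed.

Ltac zonal_tac := move=> xi a /=; rewrite zon0 zon1 zon2 zon3 zon4 /evp; field.

Lemma zonal_leg0 : zonal leg0. Proof. by zonal_tac. Qed.
Lemma zonal_leg2 : zonal leg2. Proof. by zonal_tac. Qed.
Lemma zonal_leg4 : zonal leg4. Proof. by zonal_tac. Qed.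
Lemma zonal_leg6 : zonal leg6. Proof. by zonal_tac. Qed.
Lemma zonal_leg8 : zonal leg8. Proof. by zonal_tac. Qed.

Definition even_conv (F : R6) (c : R5) (i : nat) : R :=
  let: (f0, f1, f2, f3, f4, f5) := F in let: (c0, c1, c2, c3, c4) := c in
  nth 0 [:: f0 * c0; f0 * c1 + f1 * c0; f0 * c2 + f1 * c1 + f2 * c0;
    f0 * c3 + f1 * c2 + f2 * c1 + f3 * c0;
    f0 * c4 + f1 * c3 + f2 * c2 + f3 * c1 + f4 * c0;
    f1 * c4 + f2 * c3 + f3 * c2 + f4 * c1 + f5 * c0;
    f2 * c4 + f3 * c3 + f4 * c2 + f5 * c1;
    f3 * c4 + f4 * c3 + f5 * c2; f4 * c4 + f5 * c3; f5 * c4] i.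

Lemma even_convE F c a : ev6 F a * evp c a = \sum_(i < 10) even_conv F c i * a ^+ i.*2.
Proof.
move: F c => [[[[[f0 f1] f2] f3] f4] f5] [[[[c0 c1] c2] c3] c4].
by rewrite /even_conv !big_ord_recr big_ord0/=; compute_nats; ring.
Qed.

Ltac mode_tac := apply: (cos_mode_criterion _ _ (even_convE _ _));
  [ | by move=> s; rewrite /primitive1 /primitive2 /=; field
    | by rewrite !big_ord_recr big_ord0/=; compute_nats; field].

Lemma cos_mode0 : cos_mode leg0 cos0p (2 / 3).
Proof. by mode_tac; exact: zonal_leg0. Qed.
Lemma cos_mode2 : cos_mode leg2 cos2p (- (2 / 105)).
Proof. by mode_tac; exact: zonal_leg2. Qed.
Lemma cos_mode4 : cos_mode leg4 cos4p (- (2 / 693)).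
Proof. by mode_tac; exact: zonal_leg4. Qed.
Lemma cos_mode6 : cos_mode leg6 cos6p (- (2 / 2145)).
Proof. by mode_tac; exact: zonal_leg6. Qed.
Lemma cos_mode8 : cos_mode leg8 cos8p (- (2 / 4845)).
Proof. by mode_tac; exact: zonal_leg8. Qed.

End Legendre.

(** * Averages over pairs of points of the sphere *)

Section DoubleAverage.
Context {R : realType}.
Notation R' := (measurableTypeR R).
Notation R3 := (R * R * R)%type.
Notation S2 := (R' * R')%type.

Lemma Ex_fubini d1 d2 (T1 : measurableType d1) (T2 : measurableType d2)
    (P1 : probability T1 R) (P2 : probability T2 R) (f : T1 * T2 -> R) : bmf f ->
  Ex (P1 \x P2)%E f = Ex P1 (fun a => Ex P2 (fun b => f (a, b))).
Proof.
move=> bf; have i12 : (P1 \x P2)%E.-integrable setT (EFin \o f) by exact: bmf_integrable.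
rewrite /Ex -(integral12_prod_meas1 i12) /fubini_F/=; congr fine.
apply: eq_integral => a _; rewrite -EFin_Ex//.
move: bf => [mf [M fM]]; split; last by exists M.
exact: (measurableT_comp mf (measurable_pair1 a)).
Qed.

Definition sph2P : probability (S2 * S2)%type R := (@sphP R \x @sphP R)%E.

Definition sphdot (z : S2 * S2) : R := d3 (sphX z.1) (sphX z.2).

Lemma bmf_sphdot : bmf sphdot.
Proof.
have b (v : R3) := @bmf_lin R v.
have b1 v : bmf (fun z : S2 * S2 => d3 v (sphX z.1)) by exact: (bmf_fst (b v)).
have b2 v : bmf (fun z : S2 * S2 => d3 v (sphX z.2)) by exact: (bmf_snd (b v)).
have -> : sphdot = (fun z => d3 (1, 0, 0) (sphX z.1) * d3 (1, 0, 0) (sphX z.2)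
    + d3 (0, 1, 0) (sphX z.1) * d3 (0, 1, 0) (sphX z.2)
    + d3 (0, 0, 1) (sphX z.1) * d3 (0, 0, 1) (sphX z.2)).
  by apply/funext => z; rewrite /sphdot /d3/=; ring.
by do ![apply: bmfD]; apply: bmfM.
Qed.

Lemma bmf_sphlin (x y : R3) : bmf (fun z => `|d3 x (sphX z.2) + d3 y (sphX z.1)|).
Proof.
by apply: bmf_norm; apply: bmfD; [exact: (bmf_snd (bmf_lin x)) | exact: (bmf_fst (bmf_lin y))].
Qed.

Lemma d3C (x y : R3) : d3 x y = d3 y x.
Proof. by rewrite /d3; ring. Qed.

(** Funk-Hecke is applied twice. Averaging the second point turns the kernel into [F(y.X) P(x.X)],
    with [X] the first point; averaging [X] then gives [P(x.y)] times the scalar product of [F] and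
    [P]. *)
Lemma cos_mode_average c F b (x y : R3) : cos_mode c F b -> d3 x x = 1 -> d3 y y = 1 ->
  Ex sph2P (fun z => evp c (sphdot z) * `|d3 x (sphX z.2) + d3 y (sphX z.1)|) =
  b * evp c (d3 x y).
Proof.
move=> [zc hF <-] xx yy; rewrite Ex_fubini; last first.
  by apply: bmfM; [apply: bmf_evp_gen; exact: bmf_sphdot | exact: bmf_sphlin].
transitivity (Ex sphP (fun a => (ev6poly F).[d3 y (sphX a)] * evp c (d3 x (sphX a)))).
  apply: eq_Ex => a /=; rewrite ev6polyE -hF; last exact: d3_sph_le.
  rewrite [RHS]mulrC -funk_hecke_abs//; [|exact: sphX1|exact: d3_sph_le].
  by apply: eq_Ex => w; rewrite mulrC.
rewrite funk_hecke_poly// d3C mulrC; congr (_ * _).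
by apply: eq_Ex => a; rewrite ev6polyE.
Qed.

(** The inner product of two independent uniform points is uniform on [[-1, 1]]: this is Funk-Hecke
    for [leg0], whose value is 1. *)
Lemma zonal_average c (K : R * R * R * R * R * R) : zonal c ->
  Ex sph2P (fun z => evp c (sphdot z) * ev6 K (sphdot z)) =
  \sum_(i < 10) even_conv K c i / i.*2.+1%:R.
Proof.
move=> zc.
have bz : bmf (fun z => evp c (sphdot z) * ev6 K (sphdot z)).
  apply: bmfM; first by apply: bmf_evp_gen; exact: bmf_sphdot.
  have -> : (fun z => ev6 K (sphdot z)) = (fun z => (ev6poly K).[sphdot z]).
    by apply/funext => z; rewrite ev6polyE.
  by apply: bmf_horner; exact: bmf_sphdot.
rewrite Ex_fubini//; pose b := Ex UA (fun a => ev6 K (clip a) * evp c (clip a)).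
pose g : {poly R} := ev6poly K * let: (c0, c1, c2, c3, c4) := c in ev6poly (c0, c1, c2, c3, c4, 0).
have gE u : g.[u] = ev6 K u * evp c u.
  rewrite /g hornerM ev6polyE; move: c {zc bz b g} => [[[[c0 c1] c2] c3] c4].
  by rewrite ev6polyE /ev6 /evp; congr (_ * _); ring.
have ev1 u : evp (@leg0 R) u = 1 by rewrite /evp/=; ring.
transitivity (Ex sphP (fun=> b)).
  apply: eq_Ex => w /=.
  have := funk_hecke_poly g (@zonal_leg0 R) (sphX1 w) (sphX1 w).
  rewrite ev1 mul1r => h; transitivity (Ex sphP (fun z => g.[d3 (sphX w) (sphX z)] * evp leg0 (d3 (sphX w) (sphX z)))).
    by apply: eq_Ex => z; rewrite gE ev1 mulr1 mulrC.
  by rewrite h; apply: eq_Ex => a; rewrite ev1 mulr1 gE.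
rewrite Ex_cst /b -Ex_clip_poly; apply: eq_Ex => a; exact: even_convE.
Qed.

(* The weight whose double cosine transform is the square in [weight_average]: its Legendre
   coefficients are those of the square divided by the multipliers of [cos_mode]. *)
Definition weight (u : R) : R := 79 / 525 * evp leg0 u + 120 / 11 * evp leg2 u
  + - (16 * 1319 / 325) * evp leg4 u + 832 / 7 * evp leg6 u + - (128 * 323 / 429) * evp leg8 u.

Lemma bmf_weight : bmf (fun z => weight (sphdot z)).
Proof.
by rewrite /weight; do ![apply: bmfD]; apply: bmfZ; apply: bmf_evp_gen; exact: bmf_sphdot.
Qed.

Lemma weight_average (x y : R3) : d3 x x = 1 -> d3 y y = 1 ->
  Ex sph2P (fun z => weight (sphdot z) * (2^-1 * `|d3 x (sphX z.2) + d3 y (sphX z.1)|)) =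
  (d3 x y ^+ 4 - 4 / 3 * d3 x y ^+ 2 + 2 / 5) ^+ 2.
Proof.
move=> xx yy.
have bm c : bmf (fun z => evp c (sphdot z) * `|d3 x (sphX z.2) + d3 y (sphX z.1)|).
  by apply: bmfM; [apply: bmf_evp_gen; exact: bmf_sphdot | exact: bmf_sphlin].
transitivity (2^-1 * Ex sph2P (fun z => weight (sphdot z) * `|d3 x (sphX z.2) + d3 y (sphX z.1)|)).
  rewrite -ExZ; last by apply: bmfM; [exact: bmf_weight | exact: bmf_sphlin].
  by apply: eq_Ex => z; rewrite mulrCA.
transitivity (2^-1 * (79 / 525 * (2 / 3 * evp leg0 (d3 x y)) + 120 / 11 * (- (2 / 105) * evp leg2 (d3 x y))
  + - (16 * 1319 / 325) * (- (2 / 693) * evp leg4 (d3 x y))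
  + 832 / 7 * (- (2 / 2145) * evp leg6 (d3 x y))
  + - (128 * 323 / 429) * (- (2 / 4845) * evp leg8 (d3 x y)))); last first.
  by rewrite /evp/=; field.
congr (_ * _).
rewrite -(cos_mode_average cos_mode0 xx yy) -(cos_mode_average cos_mode2 xx yy).
rewrite -(cos_mode_average cos_mode4 xx yy) -(cos_mode_average cos_mode6 xx yy).
rewrite -(cos_mode_average cos_mode8 xx yy) -Ex_lin5//.
by apply: eq_Ex => z; rewrite /weight; ring.
Qed.

(** The quadratic is [kap] at [(1 + u) / 2] and equals [100/3 - 7/3 P2(u)], so by orthogonality only
    the degrees 0 and 2 of the weight contribute. *)
Lemma weight_kappa_average :
  Ex sph2P (fun z => weight (sphdot z) * (69 / 2 - 7 / 2 * sphdot z ^+ 2)) = - (52 / 693).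
Proof.
pose K : R * R * R * R * R * R := (69 / 2, - (7 / 2), 0, 0, 0, 0).
have bm c : bmf (fun z => evp c (sphdot z) * ev6 K (sphdot z)).
  apply: bmfM; first by apply: bmf_evp_gen; exact: bmf_sphdot.
  have -> : (fun z => ev6 K (sphdot z)) = (fun z => (ev6poly K).[sphdot z]).
    by apply/funext => z; rewrite ev6polyE.
  by apply: bmf_horner; exact: bmf_sphdot.
have m0 : Ex sph2P (fun z => evp leg0 (sphdot z) * ev6 K (sphdot z)) = 100 / 3.
  by rewrite (zonal_average _ zonal_leg0) !big_ord_recr big_ord0/=; compute_nats; field.
have m2 : Ex sph2P (fun z => evp leg2 (sphdot z) * ev6 K (sphdot z)) = - (7 / 15).
  by rewrite (zonal_average _ zonal_leg2) !big_ord_recr big_ord0/=; compute_nats; field.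
have m4 : Ex sph2P (fun z => evp leg4 (sphdot z) * ev6 K (sphdot z)) = 0.
  by rewrite (zonal_average _ zonal_leg4) !big_ord_recr big_ord0/=; compute_nats; field.
have m6 : Ex sph2P (fun z => evp leg6 (sphdot z) * ev6 K (sphdot z)) = 0.
  by rewrite (zonal_average _ zonal_leg6) !big_ord_recr big_ord0/=; compute_nats; field.
have m8 : Ex sph2P (fun z => evp leg8 (sphdot z) * ev6 K (sphdot z)) = 0.
  by rewrite (zonal_average _ zonal_leg8) !big_ord_recr big_ord0/=; compute_nats; field.
transitivity (79 / 525 * (100 / 3) + 120 / 11 * (- (7 / 15)) + - (16 * 1319 / 325) * 0
  + 832 / 7 * 0 + - (128 * 323 / 429) * 0 : R); last by field.
rewrite -{1}m0 -m2 -{1}m4 -{1}m6 -m8 -Ex_lin5//.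
by apply: eq_Ex => z; rewrite /weight /ev6 /=; ring.
Qed.

End DoubleAverage.

(** * Planes as pairs of points of the sphere *)

Section Planes.
Context {R : realType}.
Notation vec := 'rV[R]_4.
Notation R3 := (R * R * R)%type.

(** It replaces the rank condition by a polynomial equation, both for recognising planes and for the
    measurability of [Gr24]. *)
Lemma trace_symmetric_idempotent (P : 'M[R]_4) :
  P^T = P -> P *m P = P -> \tr P = (\rank P)%:R.
Proof.
move: {2}(\rank P).+1 (ltnSn (\rank P)) => n.
elim: n P => // n IH P rn PT PP.
have [->|P0] := eqVneq P 0; first by rewrite mxtrace0 mxrank0.
have [f [ff fP PT' PP' r']] := symmetric_idempotent_split PT PP P0.
have trf : \tr (f^T *m f) = 1 by rewrite mxtrace_mulC mulmx_trE ff mxtrace1.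
have PE : P = P - f^T *m f + f^T *m f by rewrite subrK.
have rE : \rank P = (\rank (P - f^T *m f)%R).+1.
  apply/eqP; rewrite eqn_leq r' andbT {1}PE (leq_trans (mxrank_add _ _))// -[leqRHS]addn1 leq_add2l.
  by rewrite (leq_trans (mxrankM_maxr _ _))// rank_leq_row.
rewrite {1}PE mxtraceD trf IH//; last by move: rn r'; lia.
by rewrite rE natr1.
Qed.

Lemma det_mx2 (M : 'M[R]_2) : \det M = M 0 0 * M 1 1 - M 0 1 * M 1 0.
Proof.
rewrite (expand_det_row _ 0) (bigD1 0)//= (bigD1 1)//= big_pred0; last by elim/ord2P.
rewrite /cofactor !det_mx11 !mxE/=.
have -> : lift 0 0 = 1 :> 'I_2 by exact/val_inj.
have -> : lift 1 0 = 0 :> 'I_2 by exact/val_inj.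
by rewrite expr0 expr1; ring.
Qed.

Definition wedge (f1 f2 : vec) : 'M[R]_4 := f1^T *m f2 - f2^T *m f1.

Definition bilf (A : 'M[R]_4) (f g : vec) : R := (f *m A *m g^T) 0 0.

Lemma bilfC (A : 'M[R]_4) (f g : vec) : A^T = - A -> bilf A g f = - bilf A f g.
Proof.
move=> AT; rewrite /bilf; transitivity ((g *m A *m f^T)^T 0 0); first by rewrite [RHS]mxE.
by rewrite !trmx_mul trmxK AT mulNmx mulmxN mulmxA mxE.
Qed.

Lemma bilf_diag (A : 'M[R]_4) (f : vec) : A^T = - A -> bilf A f f = 0.
Proof. by move/(bilfC f f) => h; lra. Qed.

(** A plane carries only one bivector up to scale, so compressing [A] to it leaves a multiple of
    [wedge f1 f2]. *)
Lemma skew_compress (A : 'M[R]_4) (f1 f2 : vec) : A^T = - A ->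
  (f1^T *m f1 + f2^T *m f2) *m A *m (f1^T *m f1 + f2^T *m f2) = bilf A f1 f2 *: wedge f1 f2.
Proof.
move=> AT.
have E (f g : vec) : f^T *m f *m A *m (g^T *m g) = bilf A f g *: (f^T *m g).
  rewrite -!mulmxA (mulmxA f) (mulmxA (f *m A)) [f *m A *m g^T]mx11_scalar -/(bilf A f g).
  by rewrite mul_scalar_mx -scalemxAr.
rewrite mulmxDl mulmxDl !mulmxDr !E (bilfC f1 f2)// !bilf_diag// !scale0r add0r addr0.
by rewrite scaleNr /wedge scalerBr.
Qed.

Lemma bilf_wedge (f1 f2 g1 g2 : vec) :
  bilf (wedge g1 g2) f1 f2 = dotp f1 g1 * dotp g2 f2 - dotp f1 g2 * dotp g1 f2.
Proof.
rewrite /bilf /wedge mulmxBr mulmxBl !mulmxA -!(mulmxA (f1 *m _)) !mulmx_trE.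
by rewrite !mul_scalar_mx !mxE !eqxx !mulr1n.
Qed.

Lemma wedge_trace (f1 f2 : vec) : dotp f1 f1 = 1 -> dotp f2 f2 = 1 -> dotp f1 f2 = 0 ->
  \tr (wedge f1 f2 *m wedge f1 f2) = - 2.
Proof.
move=> h1 h2 h3.
have E (a b c d : vec) : \tr (a^T *m b *m (c^T *m d)) = dotp b c * dotp d a.
  by rewrite mulmxA -(mulmxA a^T) mulmx_trE mul_mx_scalar -scalemxAl mxtraceZ mxtrace_mulC mulmx_trE mxtrace_scalar.
rewrite /wedge mulmxBl !mulmxBr !(raddfB, mxtraceD) /= !E (dotpC f2 f1) h1 h2 h3; ring.
Qed.

(** The cubic equation makes [- (A *m A)] a projection [F] that fixes [A], and the trace gives it
    rank 2. Compressing to [F] shows [A] to be plus or minus its unit bivector, whose value on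
    [f1, f2] is the determinant defining the cosine. *)
Lemma abscos_skew (A E : 'M[R]_4) (f1 f2 : vec) :
  A^T = - A -> A *m A *m A = - A -> \tr (A *m A) = - 2 ->
  onb E = frame f1 f2 ->
  Gr24 (- (A *m A)) /\ abscos E (- (A *m A)) = `|bilf A f1 f2|.
Proof.
move=> AT A3 trA oE; set F := - (A *m A).
have FT : F^T = F by rewrite /F raddfN/= trmx_mul AT mulmxN mulNmx opprK.
have FA : F *m A = A by rewrite /F mulNmx A3 opprK.
have AF : A *m F = A by rewrite /F mulmxN mulmxA A3 opprK.
have FF : F *m F = F by rewrite {2}/F mulmxN mulmxA FA.
have trF : \tr F = 2 by rewrite /F raddfN/= trA opprK.
have gF : Gr24 F.
  split=> //; split=> //; apply/eqP; rewrite -(@eqr_nat R) -trace_symmetric_idempotent//.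
  by rewrite trF.
split=> //.
have [g1 [g2 [oF [h1 h2 h3] FE]]] := onb_frame gF.
have AE : A = bilf A g1 g2 *: wedge g1 g2 by rewrite -skew_compress// -FE FA AF.
set l := bilf A g1 g2 in AE.
have l1 : `|l| = 1.
  have : l ^+ 2 * - 2 = - 2.
    by rewrite -(wedge_trace h1 h2 h3) -mxtraceZ expr2 -scalerA scalemxAl scalemxAr -AE trA wedge_trace.
  move=> e; have {e} : l ^+ 2 = 1 by lra.
  by move=> e; apply/eqP; rewrite -sqrp_eq1// real_normK ?num_real// e.
have -> : bilf A f1 f2 = l * bilf (wedge g1 g2) f1 f2.
  by rewrite {1}AE /bilf -scalemxAr -scalemxAl mxE.
rewrite normrM l1 mul1r bilf_wedge /abscos oE oF det_mx2.
have D (i j : 'I_2) : (frame g1 g2 *m (frame f1 f2)^T) i j =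
    dotp (if i == 0 then g1 else g2) (if j == 0 then f1 else f2).
  by rewrite mxE sum4 dotpE !mxE; do 2 case: (_ == 0).
by rewrite !D/= (dotpC f1 g1) (dotpC f1 g2); congr `|_|; ring.
Qed.

(* [|cos(E,F)|] for the plane [F] of the unit bivector [A], written so that its measurability
   in [E] is evident: [E A E] is the bivector of [E] scaled by the cosine. *)
Definition coskernel (E A : 'M[R]_4) : R :=
  Num.sqrt (2^-1 * \sum_i \sum_j (E *m A *m E) i j ^+ 2).

Lemma coskernelE (A E : 'M[R]_4) (f1 f2 : vec) : A^T = - A ->
  dotp f1 f1 = 1 -> dotp f2 f2 = 1 -> dotp f1 f2 = 0 -> E = f1^T *m f1 + f2^T *m f2 ->
  coskernel E A = `|bilf A f1 f2|.
Proof.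
move=> AT h1 h2 h3 ->; rewrite /coskernel skew_compress//.
set l := bilf A f1 f2; rewrite -sqrtr_sqr; congr Num.sqrt.
have W i j : (l *: wedge f1 f2) i j = l * (f1 0 i * f2 0 j - f2 0 i * f1 0 j).
  by rewrite !mxE !big_ord1 !mxE.
transitivity (l ^+ 2 * (dotp f1 f1 * dotp f2 f2 - dotp f1 f2 ^+ 2)); last first.
  by rewrite h1 h2 h3; ring.
by rewrite !sum4 !W !dotpE; field.
Qed.

(* the bivector with self-dual part [x] and anti-self-dual part [y] *)
Definition skew4 (x y : R3) : 'M[R]_4 :=
  let: (a, b, c) := ((x.1.1 + y.1.1) / 2, (x.1.2 + y.1.2) / 2, (x.2 + y.2) / 2) in
  let: (d, e, f) := ((x.1.1 - y.1.1) / 2, (x.1.2 - y.1.2) / 2, (x.2 - y.2) / 2) in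
  \matrix_(i, j) nth 0 (nth [::] [:: [:: 0; a; b; c]; [:: - a; 0; f; - e];
    [:: - b; - f; 0; d]; [:: - c; e; - d; 0]] i) j.

Lemma skewT x y : (skew4 x y)^T = - skew4 x y.
Proof.
by apply/matrixP => i j; rewrite !mxE; elim/all4: i; elim/all4: j; rewrite /= ?oppr0 ?opprK.
Qed.

Lemma skew_sqr00 x y : (- (skew4 x y *m skew4 x y)) i0 i0 = (d3 x x + d3 y y + 2 * d3 x y) / 4.
Proof. by rewrite !mxE sum4 !mxE/= /d3; field. Qed.

Lemma skew_trace x y : \tr (skew4 x y *m skew4 x y) = - (d3 x x + d3 y y).
Proof. by rewrite /mxtrace sum4 !mxE !sum4 !mxE/= /d3; field. Qed.

Lemma skew_cube x y : d3 x x = 1 -> d3 y y = 1 ->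
  skew4 x y *m skew4 x y *m skew4 x y = - skew4 x y.
Proof.
move=> xx yy.
(* The right side is homogeneous of degree 3: it is the cube of [skew4 x y] for all [x] and [y], and
   the factors become -1 on unit vectors. The remaining goal is a plain polynomial identity. *)
have -> : - skew4 x y = skew4 (- (d3 x x + 3 * d3 y y) / 4 * x.1.1, - (d3 x x + 3 * d3 y y) / 4 * x.1.2,
    - (d3 x x + 3 * d3 y y) / 4 * x.2) (- (3 * d3 x x + d3 y y) / 4 * y.1.1,
    - (3 * d3 x x + d3 y y) / 4 * y.1.2, - (3 * d3 x x + d3 y y) / 4 * y.2).
  by apply/matrixP => i j; rewrite xx yy !mxE; elim/all4: i; elim/all4: j => /=; field.
apply/matrixP => i j; rewrite !mxE sum4 !mxE !sum4 !mxE.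
by elim/all4: i; elim/all4: j => /=; rewrite /d3; field.
Qed.

Lemma bilf_skew (f1 f2 : vec) :
  dotp f1 f1 = 1 -> dotp f2 f2 = 1 -> dotp f1 f2 = 0 ->
  exists x y : R3, [/\ d3 x x = 1, d3 y y = 1 &
    forall x' y', bilf (skew4 x' y') f1 f2 = 2^-1 * (d3 x x' + d3 y y')].
Proof.
(* These are the Plücker coordinates. The Plücker relation gives both parts the same length, which
   is 1 by Lagrange's identity [N]. *)
move=> h1 h2 h3; pose p i j := f1 0 i * f2 0 j - f1 0 j * f2 0 i.
have N : dotp f1 f1 * dotp f2 f2 - dotp f1 f2 ^+ 2 = 1 by rewrite h1 h2 h3; ring.
exists (p i0 i1 + p i2 i3, p i0 i2 - p i1 i3, p i0 i3 + p i1 i2),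
       (p i0 i1 - p i2 i3, p i0 i2 + p i1 i3, p i0 i3 - p i1 i2).
split; first by rewrite -N !dotpE /d3 /p/=; ring.
  by rewrite -N !dotpE /d3 /p/=; ring.
by move=> x' y'; rewrite /bilf mxE sum4 !mxE !sum4 !mxE/= /d3 /p/=; field.
Qed.

End Planes.

(** * No representing measure *)

Section TonelliRestricted.
Context {d1 d2 : measure_display} {T1 : measurableType d1} {T2 : measurableType d2} {R : realType}.
Variables (mu : {measure set T1 -> \bar R}) (P : probability T2 R).
Variables (D : set T1) (k : T1 * T2 -> R).
Hypotheses (mD : measurable D) (Doo : (mu D < +oo)%E).
Hypotheses (mk : measurable_fun setT k) (k0 : forall z, 0 <= k z).

Let kD (z : T1 * T2) : \bar R := (\1_D z.1 * k z)%:E.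

Let mkD : measurable_fun setT kD.
Proof.
apply/measurable_EFinP; apply: measurable_funM => //.
have mi : measurable_fun setT (\1_D : T1 -> R) by exact: measurable_indic.
exact: (measurableT_comp mi (@measurable_fst _ _ T1 T2)).
Qed.

Let kD_ge0 z : (0 <= kD z)%E.
Proof. by rewrite lee_fin mulr_ge0. Qed.

(** The measure [mu] is arbitrary, while Tonelli asks for sigma-finiteness; the restriction
    [mfrestr] to the set [D] of finite measure provides it. *)
Lemma tonelli_restr :
  (\int[P]_y \int[mu]_(x in D) (k (x, y))%:E = \int[mu]_(x in D) \int[P]_y (k (x, y))%:E)%E.
Proof.
pose nu : {finite_measure set T1 -> \bar R} := mfrestr mD Doo.
have E (f : T1 -> \bar R) : (\int[mu]_(x in D) f x = \int[nu]_x (f \_ D) x)%E.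
  rewrite -integral_mkcond; apply: eq_measure_integral => A mA AD.
  by rewrite /nu /= /mfrestr /mrestr setIidl.
transitivity (\int[P]_y \int[nu]_x kD (x, y))%E.
  apply: eq_integral => y _; rewrite E; apply: eq_integral => x _.
  by rewrite /kD /= patchE indicE; case: (x \in D); rewrite ?mul1r ?mul0r.
rewrite -(fubini_tonelli (m1 := nu) (m2 := P) kD mkD kD_ge0) E; apply: eq_integral => x _.
rewrite patchE /kD /= indicE; case: (x \in D) => /=.
  by apply: eq_integral => y _; rewrite mul1r.
by rewrite integral0_eq// => y _; rewrite mul0r.
Qed.

Lemma measurable_tonelli_restr : measurable_fun D (fun x => \int[P]_y (k (x, y))%:E)%E.
Proof.
have k0' z : (0 <= (k z)%:E)%E by rewrite lee_fin.
have mk' : measurable_fun setT (fun z => (k z)%:E) by exact/measurable_EFinP.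
have m := measurable_fun_fubini_tonelli_F (m2 := P) _ mk' k0'.
exact: (measurable_funS measurableT _ m).
Qed.

End TonelliRestricted.

(** * The pairing with a representing measure *)

Section NotInK.
Context {R : realType}.
Notation vec := 'rV[R]_4.
Notation R' := (measurableTypeR R).
Notation R3 := (R * R * R)%type.
Notation S2 := (R' * R')%type.
Notation MatB := (MatBorel R).

Lemma measurable_entry i j : measurable_fun [set: MatB] (fun E : MatB => (E : 'M[R]_4) i j).
Proof.
apply: (measurability _ (RGenOpens.measurableE R)) => _ [_ [a [b ->] <-]].
rewrite setTI; apply: sub_sigma_algebra.
have /continuousP h := @coord_continuous R 4 4 i j.
exact/h/interval_open.
Qed.

Lemma measurable_mulmx d (T : measurableType d) (A B : T -> 'M[R]_4) :
  (forall i j, measurable_fun setT (fun t => A t i j)) ->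
  (forall i j, measurable_fun setT (fun t => B t i j)) ->
  forall i j, measurable_fun setT (fun t => (A t *m B t) i j).
Proof.
move=> mA mB i j.
have -> : (fun t => (A t *m B t) i j) = (fun t => \sum_k A t i k * B t k j).
  by apply/funext => t; rewrite mxE.
by apply: measurable_sum => k; exact: measurable_funM.
Qed.

Lemma measurable_Gr24 : measurable (@Gr24 R : set MatB).
Proof.
(* A sum of squares whose zero set is [Gr24], with the rank expressed as the trace. *)
pose G (P : 'M[R]_4) : R := \sum_i \sum_j ((P i j - P j i) ^+ 2 + ((P *m P) i j - P i j) ^+ 2)
  + (\tr P - 2) ^+ 2.
have -> : (@Gr24 R : set MatB) = G @^-1` [set 0].
  apply/seteqP; split=> P /=.
    move=> [PT [PP rP]]; rewrite /G trace_symmetric_idempotent// rP subrr expr0n addr0.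
    rewrite big1// => i _; rewrite big1// => j _.
    by rewrite PP -{2}PT mxE !subrr expr0n addr0.
  have s0 i j : 0 <= (P i j - P j i) ^+ 2 + ((P *m P) i j - P i j) ^+ 2.
    by rewrite addr_ge0// sqr_ge0.
  have S0 : 0 <= \sum_i \sum_j ((P i j - P j i) ^+ 2 + ((P *m P) i j - P i j) ^+ 2).
    by apply: sumr_ge0 => i _; apply: sumr_ge0.
  move/eqP; rewrite /G paddr_eq0 ?sqr_ge0// sqrf_eq0 subr_eq0 => /andP[/eqP z /eqP tr].
  have h i j : (P i j - P j i) ^+ 2 + ((P *m P) i j - P i j) ^+ 2 = 0.
    have /eqP := z; rewrite psumr_eq0; last by move=> ? _; apply: sumr_ge0.
    move/allP/(_ i); rewrite mem_index_enum => /(_ isT)/=.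
    rewrite psumr_eq0// => /allP/(_ j); rewrite mem_index_enum => /(_ isT)/= /eqP//.
  have PT : P^T = P.
    apply/matrixP => i j; rewrite mxE; have /eqP := h j i.
    by rewrite paddr_eq0 ?sqr_ge0// !sqrf_eq0 !subr_eq0 => /andP[/eqP].
  have PP : P *m P = P.
    apply/matrixP => i j; have /eqP := h i j.
    by rewrite paddr_eq0 ?sqr_ge0// !sqrf_eq0 !subr_eq0 => /andP[_ /eqP].
  split=> //; split=> //; apply/eqP; rewrite -(@eqr_nat R) -trace_symmetric_idempotent//.
  exact/eqP.
have mG : measurable_fun [set: MatB] (G : MatB -> R).
  apply: measurable_funD; last first.
    apply: measurable_funX; apply: measurable_funB => //.
    by apply: measurable_sum => i; exact: measurable_entry.
  apply: measurable_sum => i; apply: measurable_sum => j; apply: measurable_funD.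
    by apply: measurable_funX; apply: measurable_funB; exact: measurable_entry.
  apply: measurable_funX; apply: measurable_funB; last exact: measurable_entry.
  by apply: measurable_mulmx => *; exact: measurable_entry.
by rewrite -[X in measurable X]setTI; apply: mG.
Qed.

Lemma coskernel_ge0 (E A : 'M[R]_4) : 0 <= coskernel E A.
Proof. exact: sqrtr_ge0. Qed.

Lemma measurable_coskernel d (T : measurableType d) (A B : T -> 'M[R]_4) :
  (forall i j, measurable_fun setT (fun t => A t i j)) ->
  (forall i j, measurable_fun setT (fun t => B t i j)) ->
  measurable_fun setT (fun t => coskernel (A t) (B t)).
Proof.
move=> mA mB; rewrite /coskernel.
have ms : measurable_fun setT (Num.sqrt : R' -> R').
  by apply: continuous_measurable_fun; exact: sqrt_continuous.
apply: (measurableT_comp ms).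
apply: measurable_funM => //; apply: measurable_sum => i; apply: measurable_sum => j.
by apply: measurable_funX; apply: measurable_mulmx => //; exact: measurable_mulmx.
Qed.

Definition sphskew (z : S2 * S2) : 'M[R]_4 := skew4 (sphX z.2) (sphX z.1).

Lemma measurable_sphskew i j : measurable_fun setT (fun z => sphskew z i j).
Proof.
have lin (u v : R3) : measurable_fun setT (fun z : S2 * S2 => d3 u (sphX z.2) + d3 v (sphX z.1)).
  apply: measurable_funD.
    by have [] := bmf_snd (d1 := _) (T1 := S2) (bmf_lin u).
  by have [] := bmf_fst (d2 := _) (T2 := S2) (bmf_lin v).
have L (u v : R3) (f : S2 * S2 -> R) : (forall z, f z = d3 u (sphX z.2) + d3 v (sphX z.1)) ->
    measurable_fun setT f.
  by move=> h; rewrite (_ : f = fun z => d3 u (sphX z.2) + d3 v (sphX z.1)) //; apply/funext.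
pose e1 (t : R) : R3 := (t, 0, 0); pose e2 (t : R) : R3 := (0, t, 0); pose e3 (t : R) : R3 := (0, 0, t).
have H (a : R) (e : R -> R3) (f : S2 * S2 -> R) (b : R) :
    (forall z, f z = d3 (e a) (sphX z.2) + d3 (e b) (sphX z.1)) -> measurable_fun setT f.
  exact: L.
rewrite /sphskew; elim/all4: i; elim/all4: j.
1: apply: (H 0 e1 _ 0).
2: apply: (H 2^-1 e1 _ 2^-1).
3: apply: (H 2^-1 e2 _ 2^-1).
4: apply: (H 2^-1 e3 _ 2^-1).
5: apply: (H (- 2^-1) e1 _ (- 2^-1)).
6: apply: (H 0 e1 _ 0).
7: apply: (H 2^-1 e3 _ (- 2^-1)).
8: apply: (H (- 2^-1) e2 _ 2^-1).
9: apply: (H (- 2^-1) e2 _ (- 2^-1)).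
10: apply: (H (- 2^-1) e3 _ 2^-1).
11: apply: (H 0 e1 _ 0).
12: apply: (H 2^-1 e1 _ (- 2^-1)).
13: apply: (H (- 2^-1) e3 _ (- 2^-1)).
14: apply: (H 2^-1 e2 _ (- 2^-1)).
15: apply: (H (- 2^-1) e1 _ 2^-1).
16: apply: (H 0 e1 _ 0).
all: by move=> z; rewrite mxE /d3 /=; ring.
Qed.

Lemma coskernel_Gr24 (E : 'M[R]_4) : Gr24 E -> exists x y : R3,
  [/\ d3 x x = 1, d3 y y = 1 &
    forall x' y', coskernel E (skew4 x' y') = 2^-1 * `|d3 x x' + d3 y y'|].
Proof.
move=> /onb_frame[f1 [f2 [_ [h1 h2 h3] EE]]].
have [x [y [xx yy h]]] := bilf_skew h1 h2 h3.
exists x, y; split=> // x' y'; rewrite (coskernelE (skewT x' y') h1 h2 h3 EE) h.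
by rewrite normrM ger0_norm// invr_ge0.
Qed.

Lemma projection_area_coskernel (x y : R3) : d3 x x = 1 -> d3 y y = 1 ->
  exists2 F : 'M[R]_4, Gr24 F /\ vol2proj F (@Kbody R) = (2 * I0 * (69 / 2 - 7 / 2 * d3 x y ^+ 2))%:E &
    forall E, Gr24 E -> abscos E F = coskernel E (skew4 x y).
Proof.
move=> xx yy.
have tr : \tr (skew4 x y *m skew4 x y) = - 2 by rewrite skew_trace xx yy.
exists (- (skew4 x y *m skew4 x y)); last first.
  move=> E /onb_frame[f1 [f2 [oE [h1 h2 h3] EE]]].
  have [_ ->] := abscos_skew (skewT x y) (skew_cube xx yy) tr oE.
  by rewrite (coskernelE (skewT x y) h1 h2 h3 EE).
suff GF : Gr24 (- (skew4 x y *m skew4 x y)).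
  split=> //; rewrite vol2proj_Kbody// skew_sqr00 xx yy /kap.
  by congr (_ * _)%:E; field.
(* [abscos_skew] proves [Gr24] only in the presence of another plane [E]; a coordinate plane serves
   as [E]. *)
have [[f1 f2] [h1 h2 h3]] : exists f : vec * vec, [/\ dotp f.1 f.1 = 1, dotp f.2 f.2 = 1 & dotp f.1 f.2 = 0].
  by exists (delta_mx 0 i0, delta_mx 0 i1); split; rewrite dotpE !mxE/=; ring.
have [g1 [g2 [oE _ _]]] := onb_frame (frame_Gr24 h1 h2 h3).
by have [] := abscos_skew (skewT x y) (skew_cube xx yy) tr oE.
Qed.

Section Measure.
Variable rho : {measure set MatB -> \bar R}.
Hypothesis rhoK : forall F, Gr24 F ->
  vol2proj F (@Kbody R) = (\int[rho]_(E in (@Gr24 R : set MatB)) (abscos E F)%:E)%E.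

Lemma integral_coskernel (x y : R3) : d3 x x = 1 -> d3 y y = 1 ->
  (\int[rho]_(E in (@Gr24 R : set MatB)) (coskernel E (skew4 x y))%:E)%E =
  (2 * I0 * (69 / 2 - 7 / 2 * d3 x y ^+ 2))%:E.
Proof.
move=> xx yy; have [F [GF <-] h] := projection_area_coskernel xx yy.
by rewrite rhoK//; apply: eq_integral => E; rewrite inE => /h ->.
Qed.

Lemma measurable_coskernel_cst (A : 'M[R]_4) :
  measurable_fun setT (fun E : MatB => coskernel E A).
Proof.
apply: measurable_coskernel => i j; first exact: measurable_entry.
exact: measurable_cst.
Qed.

(* The six planes spanned by coordinate axes: their cosines with any plane sum to at least 1. *)
Definition coordinate_planes : seq (R3 * R3) :=
  [:: ((1, 0, 0), (1, 0, 0)); ((1, 0, 0), (-1, 0, 0)); ((0, 1, 0), (0, 1, 0));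
      ((0, 1, 0), (0, -1, 0)); ((0, 0, 1), (0, 0, 1)); ((0, 0, 1), (0, 0, -1))].

(** Finiteness is not part of the hypothesis on [rho]. The kernels of the coordinate planes dominate
    the constant 1, and each integrates to a projection area, which is finite. *)
Lemma rho_Gr24_lty : (rho (@Gr24 R : set MatB) < +oo)%E.
Proof.
have mG := measurable_Gr24.
pose k (p : R3 * R3) (E : MatB) : \bar R := (coskernel E (skew4 p.1 p.2))%:E.
have mk p : measurable_fun (@Gr24 R : set MatB) (k p).
  apply/measurable_EFinP; apply: measurable_funS (measurable_coskernel_cst _) => //.
have k0 p E : (0 <= k p E)%E by rewrite lee_fin coskernel_ge0.
have fin : (\int[rho]_(E in (@Gr24 R : set MatB)) (\sum_(p <- coordinate_planes) k p E) < +oo)%E.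
  rewrite ge0_integral_sum//= /coordinate_planes !big_cons big_nil /k.
  rewrite !integral_coskernel; try by rewrite /d3/=; ring.
  by rewrite -!EFinD ltry.
apply: le_lt_trans fin.
rewrite -[leLHS]mul1e -integral_cst//; apply: ge0_le_integral => //.
  by apply: emeasurable_sum => p; exact: mk.
move=> E GE; have [x [y [xx yy h]]] := coskernel_Gr24 GE.
rewrite /coordinate_planes !big_cons big_nil /k !h /d3/= -!EFinD lee_fin.
(* Applied to the three coordinates of [x] and [y], this bounds the sum of the six kernels below by
   [|x|^2 = 1]. *)
have N (a b : R) : a ^+ 2 <= 1 -> a ^+ 2 <= 2^-1 * `|a + b| + 2^-1 * `|a - b|.
  move=> a1; have a1' : `|a| <= 1 by rewrite -(@ler_pXn2r _ 2)// ?nnegrE// real_normK ?num_real// expr1n.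
  have aa : a ^+ 2 <= `|a|.
    rewrite -[a ^+ 2]real_normK ?num_real// expr2; have := normr_ge0 a; nra.
  have := ler_normD (a + b) (a - b).
  have -> : a + b + (a - b) = 2 * a by ring.
  by rewrite normrM ger0_norm//; lra.
move: xx; rewrite /d3 => xx.
have s1 := sqr_ge0 x.1.1; have s2 := sqr_ge0 x.1.2; have s3 := sqr_ge0 x.2.
have := N x.1.1 y.1.1 ltac:(lra); have := N x.1.2 y.1.2 ltac:(lra); have := N x.2 y.2 ltac:(lra).
rewrite !(mulr0, mulr1, addr0, add0r, mulrN1) => n3 n2 n1; lra.
Qed.

Lemma bmf_coskernel (E : 'M[R]_4) : Gr24 E -> bmf (fun z => coskernel E (sphskew z)).
Proof.
move=> /coskernel_Gr24[x [y [_ _ h]]].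
have -> : (fun z => coskernel E (sphskew z)) =
    (fun z => 2^-1 * `|d3 x (sphX z.2) + d3 y (sphX z.1)|) by apply/funext => z; rewrite h.
by apply: bmfZ; exact: bmf_sphlin.
Qed.

Lemma bmf_area : bmf (fun z => 2 * I0 * (69 / 2 - 7 / 2 * sphdot z ^+ 2) : R).
Proof.
have -> : (fun z => 2 * I0 * (69 / 2 - 7 / 2 * sphdot z ^+ 2)) =
    (fun z => 2 * I0 * (69 / 2) + - (2 * I0 * (7 / 2)) * sphdot z ^+ 2) :> (_ -> R).
  by apply/funext => z; ring.
by apply: bmfD; [exact: bmf_cst | apply: bmfZ; apply: bmfX; exact: bmf_sphdot].
Qed.

(** Tonelli exchanges the average over planes with the integral against [rho], which needs [W]
    non-negative. The measurability is returned for the later comparison of two such integrals. *)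
Lemma weighted_average (W : S2 * S2 -> R) : bmf W -> (forall z, 0 <= W z) ->
  (Ex sph2P (fun z => W z * (2 * I0 * (69 / 2 - 7 / 2 * sphdot z ^+ 2))))%:E =
  (\int[rho]_(E in (@Gr24 R : set MatB)) (Ex sph2P (fun z => W z * coskernel E (sphskew z)))%:E)%E
  /\ measurable_fun (@Gr24 R : set MatB) (fun E => (Ex sph2P (fun z => W z * coskernel E (sphskew z)))%:E).
Proof.
move=> bW W0; have mG := measurable_Gr24.
pose k (t : MatB * (S2 * S2)) : R := W t.2 * coskernel t.1 (sphskew t.2).
have mk : measurable_fun setT k.
  apply: measurable_funM; first by have [mW _] := bW; exact: (measurableT_comp mW measurable_snd).
  apply: measurable_coskernel => i j.
    exact: (measurableT_comp (measurable_entry i j) measurable_fst).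
  exact: (measurableT_comp (measurable_sphskew i j) measurable_snd).
have k0 t : 0 <= k t by rewrite mulr_ge0// coskernel_ge0.
have E1 (E : MatB) : E \in (@Gr24 R : set MatB) -> (\int[sph2P]_z (k (E, z))%:E)%E =
    (Ex sph2P (fun z => W z * coskernel E (sphskew z)))%:E.
  by rewrite inE => GE; rewrite -EFin_Ex//; apply: bmfM => //; exact: bmf_coskernel.
split; last first.
  apply: eq_measurable_fun (measurable_tonelli_restr sph2P (D := (@Gr24 R : set MatB)) mk k0) => E GE.
  exact: E1.
rewrite -(eq_integral _ _ E1) -(tonelli_restr sph2P mG rho_Gr24_lty mk k0).
rewrite EFin_Ex; last by apply: bmfM => //; exact: bmf_area.
apply: eq_integral => z _; rewrite /k/=.
under eq_integral do rewrite EFinM.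
rewrite ge0_integralZl//; last 3 first.
- apply/measurable_EFinP; apply: measurable_funS (measurable_coskernel_cst _) => //.
- by move=> E _; rewrite lee_fin coskernel_ge0.
- by rewrite lee_fin.
by rewrite integral_coskernel ?sphX1// EFinM /sphdot d3C.
Qed.

Lemma weight_area_ge0 :
  0 <= Ex sph2P (fun z => weight (sphdot z) * (2 * I0 * (69 / 2 - 7 / 2 * sphdot z ^+ 2))) :> R.
Proof.
have bw := @bmf_weight R; have [_ [c hc]] := bw.
(* The weight takes both signs. The exchange is done for [weight + c] and for [c], and the two
   integrals over [Gr24] are compared pointwise: the integrands differ by the square in
   [weight_average]. *)
have c0 : 0 <= c := le_trans (normr_ge0 _) (hc ((0, 0), (0, 0))).
have bc := @bmf_cst _ (S2 * S2)%type R c.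
have b1 : bmf (fun z => weight (sphdot z) + c : R) by exact: bmfD.
have w0 z : 0 <= weight (sphdot z) + c :> R.
  by have := hc z; rewrite ler_norml => /andP[+ _]; lra.
have [e1 m1] := weighted_average b1 w0.
have [e0 m0] := weighted_average bc (fun=> c0).
have bA := bmf_area.
set A := Ex sph2P _; pose B := Ex sph2P (fun z => c * (2 * I0 * (69 / 2 - 7 / 2 * sphdot z ^+ 2)) : R).
have AB : Ex sph2P (fun z => (weight (sphdot z) + c) * (2 * I0 * (69 / 2 - 7 / 2 * sphdot z ^+ 2))) = A + B.
  rewrite /A /B -ExD; [|exact: bmfM|exact: bmfM].
  by apply: eq_Ex => z; rewrite mulrDl.
suff : B <= A + B by rewrite lerDr.
rewrite -lee_fin -AB e1 /B e0; apply: ge0_le_integral => //.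
- exact: measurable_Gr24.
- by move=> E _; rewrite lee_fin; apply: Ex_ge0 => z; rewrite mulr_ge0// coskernel_ge0.
move=> E GE; rewrite lee_fin.
have bk := bmf_coskernel GE.
have -> : Ex sph2P (fun z => (weight (sphdot z) + c) * coskernel E (sphskew z)) =
    Ex sph2P (fun z => weight (sphdot z) * coskernel E (sphskew z)) +
    Ex sph2P (fun z => c * coskernel E (sphskew z)).
  rewrite -ExD; [|exact: bmfM|exact: bmfM].
  by apply: eq_Ex => z; rewrite mulrDl.
rewrite lerDr; have [x [y [xx yy h]]] := coskernel_Gr24 GE.
have -> : Ex sph2P (fun z => weight (sphdot z) * coskernel E (sphskew z)) =
    (d3 x y ^+ 4 - 4 / 3 * d3 x y ^+ 2 + 2 / 5) ^+ 2.
  by rewrite -weight_average//; apply: eq_Ex => z; rewrite h.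
exact: sqr_ge0.
Qed.

End Measure.

Lemma Kbody_not_in_K4s2 : ~ in_K4s2 (@Kbody R).
Proof.
move=> [_ [rho rhoK]]; have := weight_area_ge0 rhoK.
have -> : Ex sph2P (fun z => weight (sphdot z) * (2 * I0 * (69 / 2 - 7 / 2 * sphdot z ^+ 2))) =
    2 * I0 * Ex sph2P (fun z => weight (sphdot z) * (69 / 2 - 7 / 2 * sphdot z ^+ 2)) :> R.
  rewrite -ExZ; first by apply: eq_Ex => z; rewrite mulrCA.
  apply: bmfM; first exact: bmf_weight.
  apply: bmfD; first exact: bmf_cst.
  have -> : (fun z => - (7 / 2 * sphdot z ^+ 2)) = (fun z => - (7 / 2) * sphdot z ^+ 2) :> (_ -> R).
    by apply/funext => z; rewrite mulNr.
  by apply: bmfZ; apply: bmfX; exact: bmf_sphdot.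
rewrite weight_kappa_average; apply/negP; rewrite -ltNge.
have := @I0_gt0 R; lra.
Qed.

End NotInK.

Theorem theorem6p3 (R : realType) :
  exists K : set 'rV[R]_4,
    [/\ osym_body K, smooth_body K, body_of_revolution K,
        in_P4s2 K & ~ in_K4s2 K].
Proof.
exists (@Kbody R); split.
- exact: Kbody_osym.
- exact: Kbody_smooth.
- exact: Kbody_revolution.
- exact: Kbody_in_P4s2.
- exact: Kbody_not_in_K4s2.
Qed.
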